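(* Let $u\colon\mathbb N\to\mathbb C$ be a multiplicative function bounded by $1$. Assume that for each Dirichlet character $\chi$ the function $w=u\cdot\chi$ has the following short interval behaviour: for each $\varepsilon>0$ and each increasing sequence $(M_j)$ along which $w$ is generic there exists $H_0\ge1$ such that for each $H\ge H_0$, $$\lim_{j\to\infty}\frac1{M_j}\sum_{n\le M_j}\left|\frac1H\sum_{h\le H}w(n+h)\right|^2\le\varepsilon .$$ Then $u$ satisfies the averaged Chowla property along each increasing sequence $(N_\ell)$ for which $u$ is generic: for all sequences $v_1,\ldots,v_k\colon\mathbb N\to\mathbb C$ (bounded by $1$), $$\lim_{H\to\infty}\frac1{H^k}\sum_{h_1,\ldots,h_k\le H}\lim_{\ell\to\infty}\frac1{N_\ell}\left|\sum_{n\le N_\ell}u(n)\prod_{i=1}^kv_i(n+h_i)\right|=0 .$$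
   Context: A function $w\colon\mathbb N\to\mathbb C$ bounded by $1$ is extended to $\mathbb Z$ by $w(-n)=w(n)$ for $n\in\mathbb N$ and any $w(0)$ with $|w(0)|\le1$. Let $S$ be the left shift on $\{z\in\mathbb C:|z|\le1\}^{\mathbb Z}$. $w$ is generic along an increasing sequence $(N_\ell)$ of positive integers (equivalently, $(N_\ell)$ defines a Furstenberg system of $w$) if the measures $\frac1{N_\ell}\sum_{n\le N_\ell}\delta_{S^nw}$ converge in the weak-$*$ topology. Multiplicative means $u(mn)=u(m)u(n)$ for coprime $m,n$.
   Formalization: For arbitrary bounded v_i the inner limit over ℓ need not exist along (N_ℓ); the formal statement asserts the conclusion along (N_ℓ) itself, or any subsequence of it, for which these inner limits exist for all h_1,…,h_k ≥ 1. *)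

(* Defs.v *)
From HB Require Import structures.
From mathcomp Require Import all_boot all_order all_algebra.
From mathcomp Require Import all_classical all_reals all_analysis.
From mathcomp Require Export complex.
Set Implicit Arguments.
Unset Strict Implicit.
Unset Printing Implicit Defensive.
Import Order.TTheory GRing.Theory Num.Theory numFieldNormedType.Exports.
Local Open Scope classical_set_scope.
Local Open Scope ring_scope.
Local Open Scope complex_scope.

(* Functions N -> C, with N = {1, 2, ...}, are represented by functions
   [nat -> R[i]] whose value at 0 is never constrained nor used.  The topology
   of the complex plane is carried by [R[i]^o], and
   [Normc.normc z : R] is the modulus of z (so that
   [`|z| = (Normc.normc z)%:C]). *)

Definition bounded_by_one (R : realType) (u : nat -> R[i]) : Prop :=
  forall n, (0 < n)%N -> Normc.normc (u n) <= 1.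

(* u(1) = 1 is not required: the zero function is allowed. *)
Definition multiplicative_arith (R : realType) (u : nat -> R[i]) : Prop :=
  forall m n, (0 < m)%N -> (0 < n)%N -> coprime m n -> u (m * n)%N = u m * u n.

Definition dirichlet_character (R : realType) (q : nat) (chi : nat -> R[i])
    : Prop :=
  [/\ (0 < q)%N,
      forall m n, chi (m * n)%N = chi m * chi n,
      forall n, chi (n + q)%N = chi n
    & forall n, (chi n != 0) = coprime n q].

Definition increasing (N : nat -> nat) : Prop :=
  {homo N : i j / (i < j)%N >-> (i < j)%N}.

Definition increasing_positive (N : nat -> nat) : Prop :=
  (forall l, (0 < N l)%N) /\ increasing N.

Section closed_disc.
Variable R : realType.

Definition disc_set : set R[i]^o := [set z | Normc.normc z <= 1].

Lemma disc_set0 : (0 : R[i]^o) \in disc_set.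
Proof. by apply/mem_set; rewrite /disc_set /= !expr0n /= addr0 sqrtr0. Qed.

Definition disc : Type := set_type disc_set.

HB.instance Definition _ := Topological.copy disc (set_type disc_set).
HB.instance Definition _ := isPointed.Build disc (SigSub disc_set0).

Definition discZ : Type := prod_topology (fun _ : int => disc).

HB.instance Definition _ :=
  Topological.copy discZ (prod_topology (fun _ : int => disc)).
HB.instance Definition _ := isPointed.Build discZ (fun=> point).

Definition borel_discZ := g_sigma_algebraType (@open discZ).

Definition left_shift (x : discZ) : discZ := fun z : int => x (z + 1).

(* x(0) is left free, as any w(0) in the closed disc is allowed. *)
Definition extends (w : nat -> R[i]) (x : discZ) : Prop :=
  forall n : nat, (0 < n)%N ->
    \val (x n%:Z) = w n /\ \val (x (- n%:Z)) = w n.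

(* Weak-* convergence of the empirical measures
   N_l^-1 * \sum_(1 <= n <= N_l) \d_(S^n x) to a Borel probability measure,
   tested against real continuous functions. The choice of x(0) is immaterial:
   two extensions x, x' of w satisfy f(S^n x) - f(S^n x') --> 0 for every
   continuous f. *)
Definition generic_along (w : nat -> R[i]) (N : nat -> nat) : Prop :=
  exists2 x : discZ, extends w x &
    exists kappa : probability borel_discZ R,
      forall f : discZ -> R^o, continuous f ->
        (fun l => (N l)%:R^-1 * \sum_(1 <= n < (N l).+1) f (iter n left_shift x))
          @ \oo --> (\int[kappa]_y f y : R).

End closed_disc.

Definition short_average (R : realType) (w : nat -> R[i]) (H M : nat) : R :=
  M%:R^-1 * \sum_(1 <= n < M.+1)
    Normc.normc (H%:R^-1 * \sum_(1 <= h < H.+1) w (n + h)%N) ^+ 2.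

(* The limit along M always exists when w is generic along M, since
   [short_average w H (M j)] is then the average of a continuous function along
   the orbit. *)
Definition short_interval_behaviour (R : realType) (w : nat -> R[i]) : Prop :=
  forall eps : R, 0 < eps ->
  forall M : nat -> nat, increasing_positive M -> generic_along w M ->
  exists2 H0 : nat, (1 <= H0)%N &
    forall H : nat, (H0 <= H)%N ->
      cvgn (fun j => short_average w H (M j)) /\
      limn (fun j => short_average w H (M j)) <= eps.

Definition correlation (R : realType) (k : nat) (u : nat -> R[i])
    (v : 'I_k -> nat -> R[i]) (h : 'I_k -> nat) (N : nat) : R :=
  N%:R^-1 * Normc.normc
    (\sum_(1 <= n < N.+1) u n * \prod_(i < k) v i (n + h i)%N).

(* For arbitrary v_i the inner limits in l need not exist along N, so the
   iterated limit is taken along every subsequence on which all of them do;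
   as the correlations are bounded and there are countably many h, every N has
   such a subsequence, whatever the v_i. The indices h_i run over 1, ..., H. *)
Definition averaged_chowla_along (R : realType) (u : nat -> R[i])
    (N : nat -> nat) : Prop :=
  forall (k : nat) (v : 'I_k -> nat -> R[i]), (0 < k)%N ->
  (forall i, bounded_by_one (v i)) ->
  forall phi : nat -> nat, increasing phi ->
  (forall h : 'I_k -> nat, (forall i, (0 < h i)%N) ->
     cvgn (fun l => correlation u v h (N (phi l)))) ->
  (fun H : nat => (H%:R ^+ k)^-1 *
     \sum_(h : {ffun 'I_k -> 'I_H})
        limn (fun l => correlation u v (fun i => (h i).+1) (N (phi l))))
    @ \oo --> (0 : R).

(* Main.v *)
Require Import Defs.
From HB Require Import structures.
From mathcomp Require Import all_boot all_order all_algebra.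
From mathcomp Require Import cyclic separable cyclotomic.
From mathcomp Require Import all_classical all_reals all_analysis.
From mathcomp Require Import measurable_realfun.
From mathcomp Require Import ring lra zify.

(** Let U be an ultrafilter on [nat] containing all tails, and call mean of a
    bounded function f the limit along U of its averages over 1, ..., M l.
    This is a positive linear functional, invariant under shifts; it satisfies
    the Cauchy-Schwarz inequality, and every inner limit of the conclusion is the
    modulus of such a mean, for M the subsequence of N at hand.  Working with
    exact means makes all boundary terms disappear.

    The conclusion is first reduced to the following statement on u alone: for
    every z on the unit circle, the energy, that is the mean of
    |1/H sum_(h < H) u (n + h) z^h|^2, becomes small for suitable H.
    - A tuple of shifts can be translated by any t < H.  This replaces the v_i
      by one bounded function w, shifted by t ([joint_mean_sum_le]), and leaves
      the task of bounding sum_(h < H) |mean (u (n) w (n + h))| by o(H),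
      uniformly in w.
    - By duality that sum is controlled by the square sum of the
      autocorrelations of u, where w no longer occurs ([correlation_sum_le]).
    - By a finite form of Wiener's lemma on the atoms of a measure, the square
      sum is at most 2 H^2 times the supremum over z of the energy ([gram_le]).
    - The energy almost decreases with H and is continuous in z, so that
      smallness at each z is smallness uniformly in z, by compactness
      ([energy_uniform]).

    If z is not a root of unity, the energy is the mean of u F, where the
    function F is multiplied by z, up to O(1/H), when its argument grows by 1.
    Katai's argument applies: by the Turan-Kubilius inequality and
    multiplicativity, the mean of u F is small as soon as F (p m) and F (q m)
    are nearly uncorrelated for distinct primes p, q of a finite set with large
    sum of reciprocals ([katai_bound]).  They are, because a step of p q in m
    multiplies their correlation by a number different from 1
    ([energy_vanish_free]).

    If z^q = 1, split n = d m with m coprime to q and d composed of the primes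
    of q.  Up to a set of n of small density only finitely many d occur, and
    for fixed d the function z^(d m) of m coprime to q is a combination of
    Dirichlet characters chi modulo q ([characters_span]).  The energy is thus
    controlled by the mean squares of the short averages of u chi along the
    sequences M / d ([energy_vanish_root]).

    These are small by hypothesis, provided the limits along U are limits along
    a sequence for which u chi is generic.  Such a sequence is extracted by
    a diagonal argument ([generic_subsequence]).  The limit measure is obtained
    by coding: the shift space is a continuous image of the Cantor space, the
    limit frequencies of finite words define lengths of nested intervals, and
    the image of Lebesgue measure under the resulting expansion of real numbers
    has the prescribed frequencies. *)

Set Implicit Arguments.
Unset Strict Implicit.
Unset Printing Implicit Defensive.
Import Order.TTheory GRing.Theory Num.Theory numFieldNormedType.Exports.
Local Open Scope classical_set_scope.
Local Open Scope ring_scope.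
Local Open Scope complex_scope.

Local Notation nrm := Normc.normc.
Local Notation Re := complex.Re.
Local Notation Im := complex.Im.

(** * Moduli of complex numbers and limits along an ultrafilter *)

Section modulus.
Context {R : realType}.
Implicit Types z w : R[i].

Lemma nrm_ge0 z : 0 <= nrm z.
Proof. by case: z => a b; exact: sqrtr_ge0. Qed.

Lemma nrm0 : nrm (0 : R[i]) = 0. Proof. exact: Normc.normc0. Qed.
Lemma nrm1 : nrm (1 : R[i]) = 1. Proof. exact: Normc.normc1. Qed.

Lemma nrmM z w : nrm (z * w) = nrm z * nrm w. Proof. exact: Normc.normcM. Qed.

Lemma nrmD z w : nrm (z + w) <= nrm z + nrm w. Proof. exact: le_normcD. Qed.

Lemma nrmN z : nrm (- z) = nrm z. Proof. exact: normcN. Qed.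

Lemma nrmB z w : nrm (z - w) <= nrm z + nrm w.
Proof. by rewrite -(nrmN w); exact: nrmD. Qed.

Lemma nrmBC z w : nrm (z - w) = nrm (w - z).
Proof. by rewrite -nrmN opprB. Qed.

Lemma nrmX z n : nrm (z ^+ n) = nrm z ^+ n.
Proof. by elim: n => [|n ih]; rewrite ?expr0 ?nrm1 // !exprS nrmM ih. Qed.

Lemma nrm_real (x : R) : nrm x%:C = `|x|.
Proof. by rewrite /= expr0n addr0 sqrtr_sqr. Qed.

Lemma nrm_nat n : nrm (n%:R : R[i]) = n%:R.
Proof. by rewrite -(rmorph_nat (@real_complex_def R (Phant R))) nrm_real ger0_norm. Qed.

Lemma nrmV z : nrm z^-1 = (nrm z)^-1. Proof. exact: Normc.normcV. Qed.

Lemma nrm_conj z : nrm z^* = nrm z.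
Proof. by case: z => a b /=; rewrite sqrrN. Qed.

Lemma nrm_eq0 z : (nrm z == 0) = (z == 0).
Proof. by apply/eqP/eqP => [/Normc.eq0_normc//|->]; rewrite nrm0. Qed.

Lemma nrm_sum I (r : seq I) (P : pred I) (F : I -> R[i]) :
  nrm (\sum_(i <- r | P i) F i) <= \sum_(i <- r | P i) nrm (F i).
Proof.
apply: (big_ind2 (fun z x => nrm z <= x)) => //; first by rewrite nrm0.
by move=> z x w y zx wy; apply: le_trans (nrmD _ _) (lerD _ _).
Qed.

Lemma nrm_sqrE z : nrm z ^+ 2 = Re z ^+ 2 + Im z ^+ 2.
Proof. by case: z => a b /=; rewrite sqr_sqrtr // addr_ge0 ?sqr_ge0. Qed.

Lemma mulc_conj z : z * z^* = (nrm z ^+ 2)%:C.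
Proof.
rewrite nrm_sqrE; case: z => a b; rewrite /real_complex_def /=; simpc.
by congr (_ +i* _); ring.
Qed.

Lemma Re_le_nrm z : `|Re z| <= nrm z.
Proof.
rewrite -(@ler_pXn2r _ 2) ?nnegrE ?nrm_ge0 // nrm_sqrE real_normK ?num_real //.
by rewrite lerDl sqr_ge0.
Qed.

Lemma Im_le_nrm z : `|Im z| <= nrm z.
Proof.
rewrite -(@ler_pXn2r _ 2) ?nnegrE ?nrm_ge0 // nrm_sqrE real_normK ?num_real //.
by rewrite lerDr sqr_ge0.
Qed.

Lemma nrm_le_ReIm z : nrm z <= `|Re z| + `|Im z|.
Proof.
rewrite -(@ler_pXn2r _ 2) ?nnegrE ?nrm_ge0 ?addr_ge0 // nrm_sqrE.
rewrite -(real_normK (num_real (Re z))) -(real_normK (num_real (Im z))).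
have := normr_ge0 (Re z); have := normr_ge0 (Im z); nra.
Qed.

Lemma complex_ReD z w : Re (z + w) = Re z + Re w. Proof. by case: z; case: w. Qed.
Lemma complex_ImD z w : Im (z + w) = Im z + Im w. Proof. by case: z; case: w. Qed.
Lemma complex_ReMr (x : R) z : Re (x%:C * z) = x * Re z.
Proof. by case: z => a b; rewrite /real_complex_def /=; ring. Qed.
Lemma complex_ImMr (x : R) z : Im (x%:C * z) = x * Im z.
Proof. by case: z => a b; rewrite /real_complex_def /=; ring. Qed.
Lemma complex_ReM z w : Re (z * w) = Re z * Re w - Im z * Im w.
Proof. by case: z; case: w. Qed.
Lemma complex_ImM z w : Im (z * w) = Re z * Im w + Im z * Re w.
Proof. by case: z; case: w. Qed.

Lemma complex_Re_sum I (r : seq I) (P : pred I) (F : I -> R[i]) :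
  Re (\sum_(i <- r | P i) F i) = \sum_(i <- r | P i) Re (F i).
Proof. exact: (big_morph _ complex_ReD). Qed.
Lemma complex_Im_sum I (r : seq I) (P : pred I) (F : I -> R[i]) :
  Im (\sum_(i <- r | P i) F i) = \sum_(i <- r | P i) Im (F i).
Proof. exact: (big_morph _ complex_ImD). Qed.

Lemma invr_natC n : (n%:R : R[i])^-1 = (n%:R^-1)%:C.
Proof. by rewrite fmorphV rmorph_nat. Qed.

Lemma realc_sum I (r : seq I) (P : pred I) (F : I -> R) :
  (\sum_(i <- r | P i) F i)%:C = \sum_(i <- r | P i) (F i)%:C.
Proof. exact: rmorph_sum. Qed.

(** Rotating a complex number to the positive axis turns estimates of real
    parts into estimates of moduli. *)
Lemma phase z : exists2 c : R[i], nrm c = 1 & c * z = (nrm z)%:C.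
Proof.
have [->|z0] := eqVneq z 0; first by exists 1; rewrite ?nrm1 // mulr0 nrm0.
have n0 : nrm z != 0 by rewrite nrm_eq0.
exists ((nrm z)^-1%:C * z^*).
  by rewrite nrmM nrm_real nrm_conj ger0_norm ?invr_ge0 ?nrm_ge0 // mulVf.
by rewrite -mulrA [z^* * z]mulrC mulc_conj -rmorphM /= expr2 mulKf.
Qed.

End modulus.

Arguments Normc.normc : simpl never.

Lemma cvg_finsum {R : realType} (U : set_system nat) {FU : Filter U} I (r : seq I) (f : I -> nat -> R) (l : I -> R) :
  (forall i, f i n @[n --> U] --> l i) ->
  \sum_(i <- r) f i n @[n --> U] --> \sum_(i <- r) l i.
Proof.
move=> fl; elim: r => [|i r ih].
  by under eq_cvg do rewrite big_nil; rewrite big_nil; exact: cvg_cst.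
by under eq_cvg do rewrite big_cons; rewrite big_cons; apply: cvgD.
Qed.

Section ulim.
Context {R : realType} (U : set_system nat) {UU : UltraFilter U}.

Let UP : ProperFilter U := ultra_proper.
#[local] Existing Instance UP.

Definition bounded_seq (a : nat -> R) := exists C, forall l, `|a l| <= C.

Definition ulim (a : nat -> R) : R := lim (a l @[l --> U]).

Lemma ulimE a x : a l @[l --> U] --> x -> ulim a = x.
Proof. by move=> ax; apply: cvg_lim. Qed.

(** A bounded sequence lives in a segment, and on a compact set every
    ultrafilter converges: all bounded sequences have a limit at once, without
    passing to subsequences. *)
Lemma ulim_cvg a : bounded_seq a -> a l @[l --> U] --> ulim a.
Proof.
move=> [C aC].
have cptC : compact `[(- C), C]%classic by exact: segment_compact.
have aU : UltraFilter (a l @[l --> U]).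
  split=> [|G GP sG]; first exact: fmap_proper_filter.
  rewrite eqEsubset; split=> // A GA.
  have [//|nA] := in_ultra_setVsetC (a @^-1` A) UU.
  have : G (~` A) by apply: sG.
  by move=> /(filterI GA) /filter_ex [x []].
rewrite compact_ultra in cptC.
have [|x [_ ax]] := cptC _ aU.
  by apply: (@filterE _ _ UP) => l /=; rewrite in_itv/= -ler_norml.
by rewrite (ulimE ax).
Qed.

Lemma ulim_cst c : ulim (fun=> c) = c.
Proof. by apply: ulimE; exact: cvg_cst. Qed.

Lemma ulimD a b : bounded_seq a -> bounded_seq b ->
  ulim (fun l => a l + b l) = ulim a + ulim b.
Proof. by move=> /ulim_cvg ca /ulim_cvg cb; apply: ulimE; exact: cvgD. Qed.

Lemma ulimZ c a : bounded_seq a -> ulim (fun l => c * a l) = c * ulim a.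
Proof. by move=> /ulim_cvg ca; apply: ulimE; apply: cvgMl_tmp; exact: ca. Qed.

Lemma ler_ulim a b : bounded_seq a -> bounded_seq b ->
  (\forall l \near U, a l <= b l) -> ulim a <= ulim b.
Proof. by move=> /ulim_cvg ca /ulim_cvg cb; apply: ler_cvg_to ca cb. Qed.

End ulim.

(** * Averages and means of real functions *)

Section average.
Context {F : fieldType}.
Implicit Types f g : nat -> F.

Definition avg (N : nat) f : F := N%:R^-1 * \sum_(1 <= n < N.+1) f n.

Lemma avgD N f g : avg N (fun n => f n + g n) = avg N f + avg N g.
Proof. by rewrite /avg big_split mulrDr. Qed.

Lemma avgB N f g : avg N (fun n => f n - g n) = avg N f - avg N g.
Proof. by rewrite /avg -mulrBr sumrB. Qed.

Lemma avgZ N c f : avg N (fun n => c * f n) = c * avg N f.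
Proof. by rewrite /avg -mulr_sumr mulrCA. Qed.

Lemma eq_avg N f g : (forall n, (0 < n)%N -> f n = g n) -> avg N f = avg N g.
Proof.
by move=> fg; congr (_ * _); apply: eq_big_nat => n /andP[n0 _]; apply: fg.
Qed.

Lemma sum_multiples d N f : (0 < d)%N ->
  \sum_(1 <= n < N.+1) (d %| n)%N%:R * f (n %/ d)%N =
  \sum_(1 <= m < (N %/ d).+1) f m.
Proof.
move=> d0; elim: N => [|N ih]; first by rewrite div0n !big_nil.
rewrite big_nat_recr //= ih divnS //.
case: (boolP (d %| N.+1)%N) => dN; last by rewrite mul0r addr0 add0n.
by rewrite mul1r add1n [in RHS]big_nat_recr.
Qed.

Lemma avg_shift N f :
  avg N (fun n => f n.+1) = avg N f + N%:R^-1 * (f N.+1 - f 1%N).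
Proof.
rewrite /avg -mulrDr; congr (_ * _).
elim: N => [|N ih]; first by rewrite !big_nil subrr addr0.
by rewrite big_nat_recr //= ih [in RHS]big_nat_recr //=; ring.
Qed.

End average.

Section real_average.
Context {R : realType}.
Implicit Types f g : nat -> R.

Lemma ler_avg N f g : (forall n, (0 < n)%N -> f n <= g n) -> avg N f <= avg N g.
Proof.
move=> fg; apply: ler_wpM2l; first by rewrite invr_ge0.
by apply: ler_sum_nat => n /andP[n0 _]; apply: fg.
Qed.

Lemma avg_cst N (c : R) : (0 < N)%N -> avg N (fun=> c) = c.
Proof.
move=> N0; rewrite /avg sumr_const_nat subn1 /= -[c *+ N]mulr_natl mulKf //.
by rewrite pnatr_eq0 -lt0n.
Qed.

Lemma avg_le N f (C : R) : 0 <= C -> (forall n, (0 < n)%N -> f n <= C) ->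
  avg N f <= C.
Proof.
move=> C0 fC; case: N => [|N]; first by rewrite /avg invr0 mul0r.
by rewrite -[leRHS](@avg_cst N.+1) //; apply: ler_avg.
Qed.

Lemma norm_avg_le N f (C : R) : (forall n, (0 < n)%N -> `|f n| <= C) ->
  `|avg N f| <= C.
Proof.
move=> fC; have C0 : 0 <= C by apply: le_trans (normr_ge0 _) (fC 1%N _).
rewrite /avg normrM normfV normr_nat.
apply: le_trans (@avg_le N (fun n => `|f n|) C C0 fC).
by rewrite ler_wpM2l ?invr_ge0 // ler_norm_sum.
Qed.

Lemma Re_avg N (f : nat -> R[i]) : Re (avg N f) = avg N (fun n => Re (f n)).
Proof. by rewrite /avg invr_natC complex_ReMr complex_Re_sum. Qed.

Lemma Im_avg N (f : nat -> R[i]) : Im (avg N f) = avg N (fun n => Im (f n)).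
Proof. by rewrite /avg invr_natC complex_ImMr complex_Im_sum. Qed.

End real_average.

Section mean.
Context {R : realType} (U : set_system nat) {UU : UltraFilter U}.
Let UP : ProperFilter U := ultra_proper.
#[local] Existing Instance UP.

Implicit Types (f g : nat -> R) (M : nat -> nat).

Definition diverges M := forall A, \forall l \near U, (A <= M l)%N.

Definition rmean M f : R := ulim U (fun l => avg (M l) f).

Lemma bounded_avg M f : bounded_seq f -> bounded_seq (fun l => avg (M l) f).
Proof. by case=> C fC; exists C => l; apply: norm_avg_le. Qed.

Lemma bounded_seqD f g : bounded_seq f -> bounded_seq g ->
  bounded_seq (fun n => f n + g n).
Proof.
by move=> [C fC] [D gD]; exists (C + D) => n; apply: le_trans (ler_normD _ _) (lerD _ _).
Qed.

Lemma bounded_seqM f g : bounded_seq f -> bounded_seq g ->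
  bounded_seq (fun n => f n * g n).
Proof.
by move=> [C fC] [D gD]; exists (C * D) => n; rewrite normrM ler_pM.
Qed.

Lemma bounded_seq_cst (c : R) : bounded_seq (fun=> c).
Proof. by exists `|c|. Qed.

Lemma bounded_seqZ c f : bounded_seq f -> bounded_seq (fun n => c * f n).
Proof. by apply: bounded_seqM; exact: bounded_seq_cst. Qed.

Lemma bounded_seqX f k : bounded_seq f -> bounded_seq (fun n => f n ^+ k).
Proof.
move=> bf; elim: k => [|k ih]; first exact: bounded_seq_cst.
by under eq_fun do rewrite exprS; apply: bounded_seqM.
Qed.

Lemma bounded_seq_sum I (r : seq I) (F : I -> nat -> R) :
  (forall i, bounded_seq (F i)) -> bounded_seq (fun n => \sum_(i <- r) F i n).
Proof.
move=> bF; elim: r => [|i r ih].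
  by under eq_fun do rewrite big_nil; exact: bounded_seq_cst.
by under eq_fun do rewrite big_cons; apply: bounded_seqD.
Qed.

Lemma rmeanD M f g : bounded_seq f -> bounded_seq g ->
  rmean M (fun n => f n + g n) = rmean M f + rmean M g.
Proof.
move=> bf bg; rewrite /rmean; under eq_fun do rewrite avgD.
by apply: ulimD; exact: bounded_avg.
Qed.

Lemma rmeanZ M c f : bounded_seq f -> rmean M (fun n => c * f n) = c * rmean M f.
Proof.
move=> bf; rewrite /rmean; under eq_fun do rewrite avgZ.
by apply: ulimZ; exact: bounded_avg.
Qed.

Lemma rmean0 M : rmean M (fun=> 0) = 0.
Proof.
rewrite /rmean; under eq_fun do rewrite /avg big1 // mulr0.
exact: ulim_cst.
Qed.

Lemma rmean_sum M I (r : seq I) (F : I -> nat -> R) :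
  (forall i, bounded_seq (F i)) ->
  rmean M (fun n => \sum_(i <- r) F i n) = \sum_(i <- r) rmean M (F i).
Proof.
move=> bF; elim: r => [|i r ih].
  by under eq_fun do rewrite big_nil; rewrite rmean0 big_nil.
under eq_fun do rewrite big_cons.
by rewrite rmeanD // ?ih ?big_cons //; exact: bounded_seq_sum.
Qed.

Lemma eq_rmean M f g : (forall n, (0 < n)%N -> f n = g n) ->
  rmean M f = rmean M g.
Proof. by move=> fg; congr (ulim U _); apply/funext => l; apply: eq_avg. Qed.

Lemma ler_rmean M f g : bounded_seq f -> bounded_seq g ->
  (forall n, (0 < n)%N -> f n <= g n) -> rmean M f <= rmean M g.
Proof.
move=> bf bg fg; apply: ler_ulim; try exact: bounded_avg.
by apply: (@filterE _ _ UP) => l; apply: ler_avg.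
Qed.

Lemma rmean_ge0 M f : bounded_seq f -> (forall n, (0 < n)%N -> 0 <= f n) ->
  0 <= rmean M f.
Proof.
by move=> bf f0; rewrite -(rmean0 M); apply: ler_rmean => //; exact: bounded_seq_cst.
Qed.

Lemma rmean_le M f (C : R) : 0 <= C -> bounded_seq f ->
  (forall n, (0 < n)%N -> f n <= C) -> rmean M f <= C.
Proof.
move=> C0 bf fC; rewrite -[leRHS](@ulim_cst _ U _).
apply: ler_ulim; [exact: bounded_avg|exact: bounded_seq_cst|].
by apply: (@filterE _ _ UP) => l; apply: avg_le.
Qed.

(** Boundary terms of averages over 1, ..., M l are of order 1 / M l; this
    discards them. *)
Lemma ulim_close M (a b : nat -> R) C : diverges M ->
  bounded_seq a -> bounded_seq b ->
  (\forall l \near U, `|a l - b l| <= C * (M l)%:R^-1) -> ulim U a = ulim U b.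
Proof.
move=> dM.
suff le (a' b' : nat -> R) : bounded_seq a' -> bounded_seq b' ->
    (\forall l \near U, `|a' l - b' l| <= C * (M l)%:R^-1) -> ulim U a' <= ulim U b'.
  move=> ba bb ab; apply/eqP; rewrite eq_le !le //.
  by apply: filterS ab => l; rewrite distrC.
move=> ba bb ab; apply/ler_addgt0Pr => e e0.
rewrite addrC -(@ulim_cst _ U _ e) -ulimD //; last exact: bounded_seq_cst.
apply: ler_ulim => //; first by apply: bounded_seqD => //; exact: bounded_seq_cst.
have := dM (Num.trunc (`|C| / e)).+1; apply: filterS2 ab => l abl Ml.
rewrite -lerBlDr; apply: le_trans (ler_norm _) _; apply: le_trans abl _.
have M0 : 0 < (M l)%:R :> R by rewrite ltr0n; apply: leq_trans Ml.
rewrite ler_pdivrMr // (le_trans (ler_norm _)) // mulrC -ler_pdivrMr //.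
apply: le_trans (ltW (truncnS_gt _)) _; by rewrite ler_nat.
Qed.

Lemma rmean_cst M (c : R) : diverges M -> rmean M (fun=> c) = c.
Proof.
move=> dM; rewrite -[RHS](@ulim_cst _ U _); apply: (@ulim_close M _ _ 0) => //.
- by apply: bounded_avg; exact: bounded_seq_cst.
- exact: bounded_seq_cst.
- by apply: filterS (dM 1%N) => l M0; rewrite avg_cst // subrr normr0 mul0r.
Qed.

Lemma rmean_shift1 M f : diverges M -> bounded_seq f ->
  rmean M (fun n => f n.+1) = rmean M f.
Proof.
move=> dM bf; have [C fC] := bf.
apply: (@ulim_close M _ _ (C + C)) => //.
- by apply: bounded_avg; exists C.
- exact: bounded_avg.
- apply: (@filterE _ _ UP) => l; rewrite avg_shift [X in `|X|]addrC addKr.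
  rewrite normrM normfV normr_nat mulrC ler_wpM2r ?invr_ge0 //.
  by apply: le_trans (ler_normB _ _) (lerD _ _).
Qed.

Lemma rmean_shift M k f : diverges M -> bounded_seq f ->
  rmean M (fun n => f (n + k)%N) = rmean M f.
Proof.
move=> dM; elim: k f => [|k ih] f bf.
  by congr rmean; apply/funext => n; rewrite addn0.
rewrite -(ih f) // -(@rmean_shift1 M (fun n => f (n + k)%N)) //.
  by congr rmean; apply/funext => n; rewrite addSnnS.
by case: bf => C fC; exists C.
Qed.

(** The variance of f is nonnegative. *)
Lemma rmean_sqr M f : diverges M -> bounded_seq f ->
  rmean M f ^+ 2 <= rmean M (fun n => f n ^+ 2).
Proof.
move=> dM bf; set c := rmean M f.
have b2 : bounded_seq (fun n => f n ^+ 2) by exact: bounded_seqX.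
have b1 : bounded_seq (fun n => (- (2 * c)) * f n) by exact: bounded_seqZ.
have b0 : bounded_seq (fun=> c ^+ 2 : R) by exact: bounded_seq_cst.
have : 0 <= rmean M (fun n => (f n ^+ 2 + (- (2 * c)) * f n) + c ^+ 2).
  apply: rmean_ge0; first by apply: bounded_seqD => //; exact: bounded_seqD.
  move=> n _; rewrite (_ : _ + _ = (f n - c) ^+ 2) ?sqr_ge0 //; ring.
rewrite !rmeanD //; last exact: bounded_seqD.
by rewrite rmeanZ // rmean_cst // -/c; nra.
Qed.

(** The multiples of d up to N are the d m with m <= N / d; rounding N / d
    down changes the average by O(1 / N) only. *)
Lemma rmean_multiples M d f : (0 < d)%N -> diverges M -> bounded_seq f ->
  rmean M (fun n => (d %| n)%N%:R * f (n %/ d)%N) =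
  d%:R^-1 * rmean (fun l => M l %/ d)%N f.
Proof.
move=> d0 dM bf; have [C fC] := bf.
have C0 : 0 <= C by apply: le_trans (normr_ge0 _) (fC 1%N).
have bi : bounded_seq (fun n => (d %| n)%N%:R * f (n %/ d)%N).
  exists C => n; rewrite normrM normr_nat -[leRHS]mul1r ler_pM //.
  by case: (d %| n)%N.
rewrite -rmeanZ //; apply: (@ulim_close M _ _ C) => //.
- exact: bounded_avg.
- by apply: bounded_avg; exact: bounded_seqZ.
- apply: filterS (dM 1%N) => l M0; rewrite /avg sum_multiples // -mulr_sumr.
  set N := M l in M0 *; set S := \sum_(1 <= _ < _) _; set K := (N %/ d)%N.
  have SK : `|S| <= K%:R * C.
    apply: le_trans (ler_norm_sum _ _ _) _.
    apply: le_trans (@ler_sum_nat _ 1 K.+1 _ (fun=> C) _) _ => //.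
    by rewrite sumr_const_nat subn1 mulr_natl.
  have Nd : N%:R = K%:R * d%:R + (N %% d)%N%:R :> R.
    by rewrite -natrM -natrD -divn_eq.
  have md : (N %% d)%N%:R <= d%:R :> R by rewrite ler_nat ltnW // ltn_pmod.
  have N0 : 0 < N%:R :> R by rewrite ltr0n.
  have dR0 : 0 < d%:R :> R by rewrite ltr0n.
  have [K0|K0] := posnP K.
    have -> : S = 0 by rewrite /S -/K K0 big_nil.
    by rewrite !mulr0 subrr normr0 mulr_ge0 // invr_ge0 ltW.
  have KR0 : 0 < K%:R :> R by rewrite ltr0n.
  rewrite (_ : _ - _ = - ((N %% d)%N%:R / d%:R / K%:R / N%:R * S)); last first.
    rewrite (_ : (N %% d)%N%:R = N%:R - K%:R * d%:R); last by rewrite Nd; ring.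
    by field; rewrite !gt_eqF.
  rewrite normrN normrM ger0_norm; last first.
    by rewrite !(mulr_ge0, invr_ge0) // ltW.
  rewrite [leRHS]mulrC -[leRHS]mulr1.
  apply: le_trans (ler_wpM2l _ SK) _.
    by rewrite !(mulr_ge0, invr_ge0) // ltW.
  rewrite (_ : _ * _ = N%:R^-1 * C * ((N %% d)%N%:R / d%:R)); last first.
    by field; rewrite !gt_eqF.
  by rewrite ler_wpM2l ?mulr_ge0 ?invr_ge0 ?(ltW N0) // ler_pdivrMr // mul1r.
Qed.

Lemma diverges_div M d : (0 < d)%N -> diverges M -> diverges (fun l => M l %/ d)%N.
Proof.
move=> d0 dM A; apply: filterS (dM (A * d)%N) => l AM.
by rewrite leq_divRL.
Qed.

End mean.

(** * Means of complex functions *)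

Section complex_mean.
Context {R : realType} (U : set_system nat) {UU : UltraFilter U}.
Let UP : ProperFilter U := ultra_proper.
#[local] Existing Instance UP.
Implicit Types (f g : nat -> R[i]) (M : nat -> nat).

Definition bounded_cseq f := exists C, forall n, nrm (f n) <= C.

Lemma bounded_cseq_nrm f : bounded_cseq f -> bounded_seq (fun n => nrm (f n)).
Proof. by case=> C fC; exists C => n; rewrite ger0_norm ?nrm_ge0. Qed.

Lemma bounded_cseqD f g : bounded_cseq f -> bounded_cseq g ->
  bounded_cseq (fun n => f n + g n).
Proof.
by move=> [C fC] [D gD]; exists (C + D) => n; apply: le_trans (nrmD _ _) (lerD _ _).
Qed.

Lemma bounded_cseqM f g : bounded_cseq f -> bounded_cseq g ->
  bounded_cseq (fun n => f n * g n).
Proof.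
by move=> [C fC] [D gD]; exists (C * D) => n; rewrite nrmM ler_pM ?nrm_ge0.
Qed.

Lemma bounded_cseq_cst (c : R[i]) : bounded_cseq (fun=> c).
Proof. by exists (nrm c). Qed.

Lemma bounded_cseq_nat (b : nat -> bool) : bounded_cseq (fun n => (b n)%:R).
Proof. by exists 1 => n; case: (b n); rewrite ?nrm1 ?nrm0. Qed.

Lemma bounded_cseqJ f : bounded_cseq f -> bounded_cseq (fun n => (f n)^*).
Proof. by case=> C fC; exists C => n; rewrite nrm_conj. Qed.

Lemma bounded_cseq_real (f : nat -> R) :
  bounded_seq f -> bounded_cseq (fun n => (f n)%:C).
Proof. by case=> C fC; exists C => n; rewrite nrm_real. Qed.

Lemma bounded_cseq_comp f (h : nat -> nat) :
  bounded_cseq f -> bounded_cseq (fun n => f (h n)).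
Proof. by case=> C fC; exists C. Qed.

Lemma bounded_cseq_sum I (r : seq I) (F : I -> nat -> R[i]) :
  (forall i, bounded_cseq (F i)) -> bounded_cseq (fun n => \sum_(i <- r) F i n).
Proof.
move=> bF; elim: r => [|i r ih].
  by under eq_fun do rewrite big_nil; exact: bounded_cseq_cst.
by under eq_fun do rewrite big_cons; apply: bounded_cseqD.
Qed.

Lemma bounded_Re f : bounded_cseq f -> bounded_seq (fun n => Re (f n)).
Proof. by case=> C fC; exists C => n; apply: le_trans (Re_le_nrm _) _. Qed.

Lemma bounded_Im f : bounded_cseq f -> bounded_seq (fun n => Im (f n)).
Proof. by case=> C fC; exists C => n; apply: le_trans (Im_le_nrm _) _. Qed.

Definition cmean M f : R[i] :=
  rmean U M (fun n => Re (f n)) +i* rmean U M (fun n => Im (f n)).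

Lemma eq_cmean M f g : (forall n, (0 < n)%N -> f n = g n) ->
  cmean M f = cmean M g.
Proof. by move=> fg; congr (_ +i* _); apply: eq_rmean => n n0; rewrite fg. Qed.

Lemma cmeanD M f g : bounded_cseq f -> bounded_cseq g ->
  cmean M (fun n => f n + g n) = cmean M f + cmean M g.
Proof.
move=> bf bg; rewrite /cmean.
under eq_fun do rewrite complex_ReD; under [in X in _ +i* X = _]eq_fun do rewrite complex_ImD.
by rewrite !rmeanD //; [exact: bounded_Im|exact: bounded_Im|exact: bounded_Re|exact: bounded_Re].
Qed.

Lemma cmeanZ M c f : bounded_cseq f -> cmean M (fun n => c * f n) = c * cmean M f.
Proof.
move=> bf; rewrite /cmean.
have bR := bounded_Re bf; have bI := bounded_Im bf.
case: c => a b; set S := (X in _ = X).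
have -> : S = (a * rmean U M (fun n => Re (f n)) - b * rmean U M (fun n => Im (f n)))
  +i* (a * rmean U M (fun n => Im (f n)) + b * rmean U M (fun n => Re (f n))).
  by rewrite /S; simpc; congr (_ +i* _).
rewrite -mulNr -!rmeanZ // -!rmeanD //; try exact: bounded_seqZ.
by congr (_ +i* _); apply: eq_rmean => n _; rewrite (complex_ReM, complex_ImM) ?mulNr //=.
Qed.

Lemma cmean0 M : cmean M (fun=> 0) = 0.
Proof. by rewrite /cmean rmean0. Qed.

Lemma cmean_sum M I (r : seq I) (F : I -> nat -> R[i]) :
  (forall i, bounded_cseq (F i)) ->
  cmean M (fun n => \sum_(i <- r) F i n) = \sum_(i <- r) cmean M (F i).
Proof.
move=> bF; elim: r => [|i r ih].
  by under eq_fun do rewrite big_nil; rewrite cmean0 big_nil.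
under eq_fun do rewrite big_cons.
by rewrite cmeanD // ?ih ?big_cons //; exact: bounded_cseq_sum.
Qed.

Lemma cmean_real M (f : nat -> R) : cmean M (fun n => (f n)%:C) = (rmean U M f)%:C.
Proof. by rewrite /cmean /= rmean0. Qed.

Lemma cmean_shift M k f : diverges U M -> bounded_cseq f ->
  cmean M (fun n => f (n + k)%N) = cmean M f.
Proof.
move=> dM bf; congr (_ +i* _).
  by rewrite (@rmean_shift _ _ _ _ _ (fun n => Re (f n))) //; exact: bounded_Re.
by rewrite (@rmean_shift _ _ _ _ _ (fun n => Im (f n))) //; exact: bounded_Im.
Qed.

Lemma cmean_conj M f : bounded_cseq f -> cmean M (fun n => (f n)^*) = (cmean M f)^*.
Proof.
move=> bf; rewrite /cmean /=; congr (_ +i* _).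
  by apply: eq_rmean => n _; case: (f n).
rewrite -mulN1r -rmeanZ; last exact: bounded_Im.
by apply: eq_rmean => n _; rewrite mulN1r; case: (f n).
Qed.

(** Rotate the mean to the positive axis and compare real parts. *)
Lemma nrm_cmean M f : bounded_cseq f ->
  nrm (cmean M f) <= rmean U M (fun n => nrm (f n)).
Proof.
move=> bf; have [c c1 cf] := phase (cmean M f).
have -> : nrm (cmean M f) = Re (c * cmean M f) by rewrite cf.
rewrite -cmeanZ //; apply: ler_rmean.
- by apply: bounded_Re; apply: bounded_cseqM => //; exact: bounded_cseq_cst.
- exact: bounded_cseq_nrm.
- move=> n _; apply: le_trans (ler_norm _) _; apply: le_trans (Re_le_nrm _) _.
  by rewrite nrmM c1 mul1r.
Qed.

Lemma nrm_cmean_sqr M f g : diverges U M -> bounded_cseq f ->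
  (forall n, nrm (g n) <= 1) ->
  nrm (cmean M (fun n => f n * g n)) ^+ 2 <= rmean U M (fun n => nrm (f n) ^+ 2).
Proof.
move=> dM bf g1.
have bg : bounded_cseq g by exists 1.
have bn := bounded_cseq_nrm bf.
apply: le_trans (rmean_sqr dM bn); rewrite ler_pXn2r ?nnegrE ?nrm_ge0 //.
  apply: le_trans (nrm_cmean M (bounded_cseqM bf bg)) _; apply: ler_rmean => //.
    by apply: bounded_cseq_nrm; exact: bounded_cseqM.
  by move=> n _; rewrite nrmM ler_piMr ?nrm_ge0.
by apply: rmean_ge0 => // n _; exact: nrm_ge0.
Qed.

Lemma nrm_avg_cvg M f : bounded_cseq f ->
  nrm (avg (M l) f) @[l --> U] --> nrm (cmean M f).
Proof.
move=> bf.
have cR : avg (M l) (fun n => Re (f n)) @[l --> U] --> Re (cmean M f).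
  by apply: ulim_cvg; apply: bounded_avg; exact: bounded_Re.
have cI : avg (M l) (fun n => Im (f n)) @[l --> U] --> Im (cmean M f).
  by apply: ulim_cvg; apply: bounded_avg; exact: bounded_Im.
have nE (z : R[i]) : nrm z = Num.sqrt (Re z * Re z + Im z * Im z) by case: z.
under eq_cvg do rewrite nE Re_avg Im_avg.
rewrite nE; apply: (@continuous_cvg _ _ _ _ UP _ (@Num.sqrt R)).
  exact: sqrt_continuous.
by apply: cvgD; apply: cvgM.
Qed.

Lemma nrm_cmeanE M f : bounded_cseq f ->
  nrm (cmean M f) = ulim U (fun l => nrm (avg (M l) f)).
Proof. by move=> bf; rewrite (ulimE (nrm_avg_cvg bf)). Qed.

(** Among the d integers n, ..., n + d - 1 exactly one is a multiple of d,
    and its quotient by d is (n + d - 1) / d.  So f composed with the division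
    is, after a shift by d - 1, a sum of d functions carried by multiples of d,
    all with the mean given by [rmean_multiples]. *)
Lemma rmean_floor M d (f : nat -> R) : (0 < d)%N -> diverges U M ->
  bounded_seq f ->
  rmean U M (fun n => f (n %/ d)%N) = rmean U (fun l => M l %/ d)%N f.
Proof.
move=> d0 dM [C fC].
have bF : bounded_seq (fun n => (d %| n)%N%:R * f (n %/ d)%N).
  exists C => n; rewrite normrM normr_nat.
  by apply: le_trans (fC (n %/ d)%N); rewrite ler_piMl //; case: (d %| n)%N.
rewrite -(@rmean_shift _ _ _ _ d.-1) //; last by exists C.
have key n : f ((n + d.-1) %/ d)%N =
    \sum_(r <- iota 0 d) ((d %| n + r)%N%:R * f ((n + r) %/ d)%N).
  have r0 : (d.-1 - (n + d.-1) %% d < d)%N by lia.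
  rewrite (bigD1_seq (d.-1 - (n + d.-1) %% d)%N) /=; [|by rewrite mem_iota|exact: iota_uniq].
  have nE : (n + (d.-1 - (n + d.-1) %% d) = (n + d.-1) %/ d * d)%N.
    have := divn_eq (n + d.-1) d; have : ((n + d.-1) %% d < d)%N by rewrite ltn_pmod.
    lia.
  rewrite {}nE dvdn_mull // mulnK // mul1r big1_seq ?addr0 // => r /andP[rne].
  rewrite mem_iota add0n => /andP[_ rd].
  case: (boolP (d %| n + r)%N) => [dnr|]; last by rewrite mul0r.
  case/negP: rne; have /dvdnP[k nrk] := dnr; apply/eqP.
  have -> : (n + d.-1 = k * d + (d.-1 - r))%N by lia.
  rewrite modnMDl modn_small; lia.
rewrite (eq_rmean _ _ (fun n _ => key n)) rmean_sum; last first.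
  by move=> r; case: bF => D FD; exists D.
under eq_bigr => r _.
  rewrite (@rmean_shift _ _ _ _ _ (fun n => (d %| n)%N%:R * f (n %/ d)%N)) //.
  rewrite rmean_multiples //; last by exists C.
over.
set c := _ * rmean _ _ _.
rewrite big_const_seq count_predT size_iota iter_addr addr0 -(mulr_natl c) /c mulVKf //.
by rewrite pnatr_eq0 -lt0n.
Qed.

End complex_mean.

Arguments cmean : simpl never.

(** * The Cauchy-Schwarz inequality and roots of unity *)

Section cauchy_schwarz.
Context {R : realType}.

Lemma cauchy_schwarz I (r : seq I) (x y : I -> R) :
  (\sum_(i <- r) x i * y i) ^+ 2 <=
  (\sum_(i <- r) x i ^+ 2) * (\sum_(i <- r) y i ^+ 2).
Proof.
elim: r => [|i r ih]; first by rewrite !big_nil expr0n mul0r.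
rewrite !big_cons.
set a := \sum_(_ <- _) _ in ih *; set A := \sum_(_ <- _) _ in ih *.
set B := \sum_(_ <- _) _ in ih *; set p := x i; set q := y i.
have A0 : 0 <= A by apply: sumr_ge0 => j _; exact: sqr_ge0.
have B0 : 0 <= B by apply: sumr_ge0 => j _; exact: sqr_ge0.
suff : 2 * a * p * q <= A * q ^+ 2 + B * p ^+ 2 by nra.
apply: le_trans (ler_norm _) _.
rewrite -(@ler_pXn2r _ 2) ?nnegrE //; last first.
  by apply: addr_ge0; apply: mulr_ge0 => //; exact: sqr_ge0.
rewrite real_normK ?num_real //.
apply: (@le_trans _ _ (4 * (p * q) ^+ 2 * (A * B))).
  rewrite (_ : (2 * a * p * q) ^+ 2 = 4 * (p * q) ^+ 2 * a ^+ 2); last by ring.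
  by apply: ler_wpM2l => //; apply: mulr_ge0 => //; exact: sqr_ge0.
rewrite -subr_ge0 (_ : _ - _ = (A * q ^+ 2 - B * p ^+ 2) ^+ 2) ?sqr_ge0 //; ring.
Qed.

Lemma sqr_sum_le (I : finType) (x : I -> R) :
  (\sum_i x i) ^+ 2 <= #|I|%:R * \sum_i x i ^+ 2.
Proof.
have := cauchy_schwarz (index_enum I) (fun=> 1) x.
under eq_bigr do rewrite mul1r; under [X in X * _]eq_bigr do rewrite expr1n.
by rewrite sumr_const.
Qed.

Lemma sqr_sum_ord_le n (x : 'I_n -> R) :
  (\sum_i x i) ^+ 2 <= n%:R * \sum_i x i ^+ 2.
Proof. by have := sqr_sum_le x; rewrite card_ord. Qed.

End cauchy_schwarz.

Section roots_of_unity.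
Context {R : realType}.

Lemma nrm_root1 n (z : R[i]) : (0 < n)%N -> z ^+ n = 1 -> nrm z = 1.
Proof.
move=> n0 zn; have := nrmX z n; rewrite zn nrm1 => /esym/eqP.
by rewrite pexpr_eq1 ?nrm_ge0 // => /eqP.
Qed.

(** X^n - 1 splits into distinct linear factors, and a field with n distinct
    n-th roots of unity has a primitive one. *)
Lemma exists_prim_root n : (0 < n)%N -> exists w : R[i], n.-primitive_root w.
Proof.
move=> n0; have [r rE] := closed_field_poly_normal ('X^n - 1 : {poly R[i]}).
rewrite (monicP _) ?monicXnsubC // scale1r in rE.
have r1 : all n.-unity_root r by apply/allP => z; rewrite -root_prod_XsubC -rE.
have ur : uniq r.
  by rewrite -separable_prod_XsubC -rE separable_Xn_sub_1 // pnatr_eq0 -lt0n.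
have sr : (n <= size r)%N.
  by rewrite -ltnS -(size_prod_XsubC r id) -rE size_XnsubC.
by have /hasP[w _ pw] := has_prim_root n0 r1 ur sr; exists w.
Qed.

Lemma mulJ1 (z : R[i]) : nrm z = 1 -> z * z^* = 1.
Proof. by move=> z1; rewrite mulc_conj z1 expr1n. Qed.

(** Orthogonality of the characters of Z/nZ. *)
Lemma sum_prim_root n (w : R[i]) a b : n.-primitive_root w -> (a < n)%N -> (b < n)%N ->
  \sum_(j < n) (w ^+ j) ^+ a * ((w ^+ j) ^+ b)^* = (a == b)%:R * n%:R.
Proof.
move=> pw an bn; have n0 := prim_order_gt0 pw.
have w1 : nrm w = 1 := nrm_root1 n0 (prim_expr_order pw).
have w1X k : nrm (w ^+ k) = 1 by rewrite nrmX w1 expr1n.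
set r := w ^+ a * (w ^+ b)^*.
have rE : \sum_(j < n) (w ^+ j) ^+ a * ((w ^+ j) ^+ b)^* = \sum_(j < n) r ^+ j.
  apply: eq_bigr => j _.
  by rewrite /r exprMn -rmorphXn -!exprM mulnC [(j * b)%N]mulnC.
rewrite rE; have [ab|ab] := eqVneq a b.
  have -> : r = 1 by rewrite /r ab mulJ1.
  by under eq_bigr do rewrite expr1n; rewrite sumr_const card_ord mul1r.
have rn : r ^+ n = 1.
  have wXn k : (w ^+ k) ^+ n = 1 by rewrite exprAC (prim_expr_order pw) expr1n.
  by rewrite /r exprMn -rmorphXn !wXn rmorph1 mulr1.
have r1 : r - 1 != 0.
  rewrite subr_eq0; apply/negP => /eqP r1.
  have : w ^+ a == w ^+ b.
    have wb : (w ^+ b)^* * w ^+ b = 1 by rewrite mulrC mulJ1.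
    by rewrite -[w ^+ a]mulr1 -wb mulrA -/r r1 mul1r.
  by rewrite (eq_prim_root_expr pw) !modn_small // (negbTE ab).
by rewrite mul0r; apply: (mulfI r1); rewrite mulr0 -subrX1 rn subrr.
Qed.

End roots_of_unity.

(** * Correlations, autocorrelations and energy *)

Section wiener.
Context {R : realType} (U : set_system nat) {UU : UltraFilter U}.
Variables (M : nat -> nat) (u : nat -> R[i]).
Hypotheses (dM : diverges U M) (u1 : forall n, nrm (u n) <= 1).

(** A function of h - k only ([autocorr_toeplitz]), namely the Fourier
    coefficients of the spectral measure of u.  Keeping two indices avoids
    negative numbers. *)
Definition autocorr (h k : nat) : R[i] :=
  cmean U M (fun n => u (n + h)%N * (u (n + k)%N)^*).

Definition twisted_average (z : R[i]) (H n : nat) : R[i] :=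
  H%:R^-1 * \sum_(h < H) u (n + h)%N * z ^+ h.

(** The integral against the spectral measure of u of the Fejer kernel of
    order H, normalised to be 1 at its centre, the conjugate of z.  It detects
    an atom of the spectral measure at that point. *)
Definition energy (z : R[i]) (H : nat) : R :=
  rmean U M (fun n => nrm (twisted_average z H n) ^+ 2).

Lemma bounded_u : bounded_cseq u.
Proof. by exists 1. Qed.

Lemma bounded_shift h : bounded_cseq (fun n => u (n + h)%N).
Proof. exact: (bounded_cseq_comp (addn^~ h) bounded_u). Qed.

Lemma bounded_corr h k : bounded_cseq (fun n => u (n + h)%N * (u (n + k)%N)^*).
Proof.
by apply: bounded_cseqM; [|apply: bounded_cseqJ]; exact: bounded_shift.
Qed.

Lemma bounded_nrm2 (f : nat -> R[i]) : bounded_cseq f ->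
  bounded_seq (fun n => nrm (f n) ^+ 2).
Proof. by move=> /bounded_cseq_nrm; exact: bounded_seqX. Qed.

Lemma autocorr_shift t h k : autocorr (h + t) (k + t) = autocorr h k.
Proof.
rewrite /autocorr -[RHS](cmean_shift t) //; last exact: bounded_corr.
by apply: eq_cmean => n _; rewrite -!addnA ![(t + _)%N]addnC.
Qed.

Lemma autocorr_conj h k : (autocorr h k)^* = autocorr k h.
Proof.
rewrite /autocorr -cmean_conj; last exact: bounded_corr.
by apply: eq_cmean => n _; rewrite rmorphM /= conjcK mulrC.
Qed.

Lemma autocorr_toeplitz h k h' k' : (h + k' = k + h')%N ->
  autocorr h k = autocorr h' k'.
Proof.
move=> e; case: (leqP h h') => hh'.
  by rewrite -(autocorr_shift (h' - h) h k); congr autocorr; lia.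
by rewrite -(autocorr_shift (h - h') h' k'); congr autocorr; lia.
Qed.

Lemma nrm_autocorr_le1 h k : nrm (autocorr h k) <= 1.
Proof.
apply: le_trans (nrm_cmean _ (bounded_corr h k)) _.
apply: rmean_le => //; first by apply: bounded_cseq_nrm; exact: bounded_corr.
by move=> n _; rewrite nrmM nrm_conj -[leRHS]mul1r ler_pM ?nrm_ge0.
Qed.

Lemma rmean_comb H (c : 'I_H -> R[i]) (r : 'I_H -> nat) :
  (rmean U M (fun n => nrm (\sum_h c h * u (n + r h)%N) ^+ 2))%:C =
  \sum_h \sum_k c h * (c k)^* * autocorr (r h) (r k).
Proof.
rewrite -cmean_real.
rewrite (@eq_cmean _ _ _ _ (fun n => \sum_h \sum_k (c h * (c k)^*) *
   (u (n + r h)%N * (u (n + r k)%N)^*))); last first.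
  move=> n _; rewrite -mulc_conj rmorph_sum mulr_suml; apply: eq_bigr => h _.
  by rewrite mulr_sumr; apply: eq_bigr => k _; rewrite rmorphM /=; ring.
have bc h k : bounded_cseq (fun n => (c h * (c k)^*) *
   (u (n + r h)%N * (u (n + r k)%N)^*)).
  by apply: bounded_cseqM; [exact: bounded_cseq_cst|exact: bounded_corr].
rewrite cmean_sum; last by move=> h; exact: bounded_cseq_sum.
apply: eq_bigr => h _; rewrite cmean_sum //; apply: eq_bigr => k _.
by rewrite cmeanZ //; exact: bounded_corr.
Qed.

Definition gram (H : nat) : R := \sum_(h < H) \sum_(k < H) nrm (autocorr h k) ^+ 2.

Lemma gram_ge0 H : 0 <= gram H.
Proof. by apply: sumr_ge0 => h _; apply: sumr_ge0 => k _; exact: sqr_ge0. Qed.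

(** Let a h be the correlation at h.  The sum of the |a h|^2 is the mean of
    f (n) v (n + H - 1), where f is a combination of shifts of u.  The
    Cauchy-Schwarz inequality removes v, expanding |f|^2 leaves only
    autocorrelations of u, and two further uses of Cauchy-Schwarz separate
    them from the a h and pass from |a h|^2 to |a h|. *)
Lemma correlation_sum_le (v : nat -> R[i]) H : (forall n, nrm (v n) <= 1) ->
  (\sum_(h < H) nrm (cmean U M (fun n => u n * v (n + h)%N))) ^+ 4 <=
  H%:R ^+ 2 * gram H.
Proof.
move=> v1; set a := fun h : 'I_H => cmean U M (fun n => u n * v (n + h)%N).
set S := \sum_(h < H) nrm (a h) ^+ 2.
have S0 : 0 <= S by apply: sumr_ge0 => h _; exact: sqr_ge0.
have bv : bounded_cseq v by exists 1.
(* Shifting by H - 1 - h frees v from h and moves the dependence on h to u. *)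
have aE h : a h = cmean U M (fun n => u (n + rev_ord h)%N * v (n + H.-1)%N).
  rewrite /a -(@cmean_shift _ _ _ _ (rev_ord h)) //.
    apply: eq_cmean => n _; congr (_ * v _).
    by case: h => h hH /=; lia.
  by apply: bounded_cseqM; [exact: bounded_u|exact: (bounded_cseq_comp (addn^~ h) bv)].
set f := fun n => \sum_(h < H) (a h)^* * u (n + rev_ord h)%N.
have bf : bounded_cseq f.
  apply: bounded_cseq_sum => h; apply: bounded_cseqM; first exact: bounded_cseq_cst.
  exact: bounded_shift.
have SE : S%:C = cmean U M (fun n => f n * v (n + H.-1)%N).
  rewrite (eq_cmean _ _ (fun n _ => mulr_suml _ _ _ _)) cmean_sum; last first.
    move=> h; apply: bounded_cseqM; last exact: (bounded_cseq_comp (addn^~ H.-1) bv).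
    apply: bounded_cseqM; first exact: bounded_cseq_cst.
    exact: bounded_shift.
  rewrite /S realc_sum; apply: eq_bigr => h _; rewrite -mulc_conj mulrC.
  rewrite {2}aE -cmeanZ; first by apply: eq_cmean => n _; rewrite mulrA.
  apply: bounded_cseqM; first exact: bounded_shift.
  exact: (bounded_cseq_comp (addn^~ H.-1) bv).
set Q := rmean U M (fun n => nrm (f n) ^+ 2).
have SQ : S ^+ 2 <= Q.
  have -> : S = nrm (cmean U M (fun n => f n * v (n + H.-1)%N)).
    by rewrite -SE nrm_real ger0_norm.
  exact: nrm_cmean_sqr.
have Q0 : 0 <= Q by apply: le_trans SQ; exact: sqr_ge0.
have QS : Q ^+ 2 <= S ^+ 2 * gram H.
  have -> : Q = nrm Q%:C by rewrite nrm_real ger0_norm.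
  rewrite rmean_comb.
  have : nrm (\sum_(h < H) \sum_(k < H) (a h)^* * ((a k)^*)^* *
      autocorr (rev_ord h) (rev_ord k)) <=
    \sum_(p : 'I_H * 'I_H) (nrm (a p.1) * nrm (a p.2)) *
      nrm (autocorr (rev_ord p.1) (rev_ord p.2)).
    rewrite pair_big; apply: le_trans (nrm_sum _ _ _) _.
    by apply: ler_sum => p _; rewrite !nrmM !nrm_conj.
  rewrite -(@ler_pXn2r _ 2) ?nnegrE ?nrm_ge0 //; last first.
    by apply: sumr_ge0 => p _; rewrite !mulr_ge0 ?nrm_ge0.
  move=> /le_trans; apply; apply: le_trans (cauchy_schwarz _ _ _) _.
  rewrite le_eqVlt; apply/orP; left; apply/eqP; congr (_ * _).
    rewrite expr2 /S mulr_suml.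
    under [RHS]eq_bigr do rewrite mulr_sumr.
    by rewrite pair_big; apply: eq_bigr => p _; rewrite exprMn.
  rewrite /gram (reindex_inj rev_ord_inj) /=.
  under [RHS]eq_bigr do rewrite (reindex_inj rev_ord_inj) /=.
  by rewrite pair_big.
have S2 : S ^+ 2 <= gram H.
  have [->|Sn0] := eqVneq S 0; first by rewrite expr0n gram_ge0.
  have Sp : 0 < S ^+ 2 by rewrite exprn_gt0 // lt0r Sn0.
  rewrite -(ler_pM2l Sp); apply: le_trans QS; rewrite -expr2.
  by rewrite ler_pXn2r ?nnegrE // ?sqr_ge0.
have AS : (\sum_(h < H) nrm (a h)) ^+ 2 <= H%:R * S by exact: sqr_sum_ord_le.
rewrite (exprM _ 2 2); apply: (@le_trans _ _ ((H%:R * S) ^+ 2)).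
  by rewrite ler_pXn2r ?nnegrE ?sqr_ge0 // mulr_ge0.
by rewrite exprMn ler_wpM2l ?sqr_ge0.
Qed.

Definition power (z : R[i]) (K : nat) : R :=
  rmean U M (fun n => nrm (\sum_(k < K) z ^+ k * u (n + k)%N) ^+ 2).

Lemma powerE z K : power z K = K%:R ^+ 2 * energy z K.
Proof.
have [->|K0] := posnP K.
  rewrite expr0n mul0r /power -[RHS](rmean0 M); apply: eq_rmean => n _.
  by rewrite big_ord0 nrm0 expr0n.
have KR0 : (K%:R : R) != 0 by rewrite pnatr_eq0 -lt0n.
rewrite /energy -rmeanZ.
  apply: eq_rmean => n _; rewrite /twisted_average nrmM nrmV nrm_nat exprMn exprVn.
  by rewrite mulVKf ?expf_neq0 //; under eq_bigr do rewrite mulrC.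
apply: bounded_nrm2; apply: bounded_cseqM; first exact: bounded_cseq_cst.
apply: bounded_cseq_sum => h; apply: bounded_cseqM; first exact: bounded_shift.
exact: bounded_cseq_cst.
Qed.

Lemma power_ge0 z K : 0 <= power z K.
Proof.
apply: rmean_ge0 => [|n _]; last exact: sqr_ge0.
apply: bounded_nrm2; apply: bounded_cseq_sum => h.
by apply: bounded_cseqM; [exact: bounded_cseq_cst|exact: bounded_shift].
Qed.

Lemma powerCE z K : (power z K)%:C =
  \sum_(h < K) \sum_(k < K) z ^+ h * (z ^+ k)^* * autocorr h k.
Proof. exact: rmean_comb. Qed.

(** Parseval: as K <= n, summing over the n-th roots of unity retains the
    diagonal terms only. *)
Lemma sum_power n (w : R[i]) K : n.-primitive_root w -> (K <= n)%N ->
  \sum_(j < n) power (w ^+ j) K <= n%:R * K%:R.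
Proof.
move=> pw Kn.
have E : (\sum_(j < n) power (w ^+ j) K)%:C = n%:R * \sum_(k < K) autocorr k k.
  rewrite realc_sum; under eq_bigr do rewrite powerCE.
  rewrite exchange_big mulr_sumr; apply: eq_bigr => h _; rewrite exchange_big /=.
  rewrite (bigD1 h) //= [X in _ + X]big1 ?addr0.
    rewrite -mulr_suml (sum_prim_root pw) ?eqxx ?mul1r //; exact: leq_trans (ltn_ord _) Kn.
  move=> k kh; rewrite -mulr_suml (sum_prim_root pw).
  - by rewrite -[(h == k :> nat)]/(h == k) eq_sym (negbTE kh) !mul0r.
  - exact: leq_trans (ltn_ord _) Kn.
  - exact: leq_trans (ltn_ord _) Kn.
have -> : \sum_(j < n) power (w ^+ j) K = nrm (\sum_(j < n) power (w ^+ j) K)%:C.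
  by rewrite nrm_real ger0_norm // sumr_ge0 // => j _; exact: power_ge0.
rewrite E nrmM nrm_nat ler_wpM2l //; apply: le_trans (nrm_sum _ _ _) _.
apply: (@le_trans _ _ (\sum_(k < K) 1)).
  by apply: ler_sum => k _; exact: nrm_autocorr_le1.
by rewrite sumr_const card_ord.
Qed.

(** Expand both factors.  The sum over the n-th roots of unity retains the
    terms with k + h = k' + h' (mod n), where k, k' < 2 H and h, h' < H; since
    n = 3 H exceeds both sides, this is an equality of integers.  The retained
    term is |autocorr h h'|^2, and for given h, h' at least the H pairs
    k = h' + t, k' = h + t with t < H occur. *)
Lemma sum_power_gram n (w : R[i]) H : n.-primitive_root w -> n = (3 * H)%N ->
  n%:R * (H%:R * gram H) <= \sum_(j < n) power (w ^+ j) (2 * H) * power (w ^+ j) H.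
Proof.
move=> pw nE.
pose wt (p : ('I_(2 * H) * 'I_(2 * H)) * ('I_H * 'I_H)) : bool :=
  (p.1.1 + p.2.1 == p.1.2 + p.2.2)%N.
have E : (\sum_(j < n) power (w ^+ j) (2 * H) * power (w ^+ j) H)%:C =
   (n%:R * \sum_p (wt p)%:R * nrm (autocorr p.2.1 p.2.2) ^+ 2)%:C.
  rewrite realc_sum.
  have -> : \sum_(j < n) (power (w ^+ j) (2 * H) * power (w ^+ j) H)%:C =
    \sum_(j < n) \sum_(p : ('I_(2 * H) * 'I_(2 * H)) * ('I_H * 'I_H))
      ((w ^+ j) ^+ (p.1.1 + p.2.1) * ((w ^+ j) ^+ (p.1.2 + p.2.2))^*) *
      (autocorr p.1.1 p.1.2 * autocorr p.2.1 p.2.2).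
    apply: eq_bigr => j _; rewrite rmorphM /= !powerCE !pair_big /=.
    rewrite big_distrlr pair_big /=; apply: eq_bigr => p _.
    by rewrite !exprD !rmorphM /=; ring.
  rewrite exchange_big rmorphM rmorph_nat /= realc_sum mulr_sumr.
  apply: eq_bigr => [[[k k'] [h h']]] _ /=.
  have kH := ltn_ord k; have k'H := ltn_ord k'.
  have hH := ltn_ord h; have h'H := ltn_ord h'.
  rewrite -mulr_suml (sum_prim_root pw); [|lia|lia].
  rewrite /wt /=; case: eqP => kh; last by rewrite !mul0r mulr0.
  rewrite !mul1r (@autocorr_toeplitz k k' h' h) //.
  by rewrite -(autocorr_conj h h') [X in n%:R * X = _]mulrC mulc_conj.
rewrite (complexI E) ler_wpM2l //.
rewrite -(pair_bigA _ (fun q r => (wt (q, r))%:R * nrm (autocorr r.1 r.2) ^+ 2)).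
rewrite exchange_big /gram [X in _ * X <= _]pair_bigA /= mulr_sumr.
apply: ler_sum => -[h h'] _ /=.
rewrite -mulr_suml ler_wpM2r ?sqr_ge0 // -natr_sum ler_nat.
have bnd (a : 'I_H) (t : 'I_H) : (a + t < 2 * H)%N.
  by case: a => a aH; case: t => t tH /=; lia.
pose f (t : 'I_H) := (Ordinal (bnd h' t), Ordinal (bnd h t)).
have fi : injective f.
  by move=> t t' [] /eqP; rewrite eqn_add2l => /eqP /val_inj.
rewrite -[leqLHS](card_ord H) -(card_imset predT fi) -sum1_card.
rewrite big_mkcond /=; apply: leq_sum => p _.
case: imsetP => // -[t _ ->] /=.
by rewrite /wt /= addnAC [(h' + h)%N]addnC addnAC eqxx.
Qed.

(** Wiener's lemma: if the autocorrelations are not small in square mean, some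
    point of the circle has large energy.  In [sum_power_gram] one factor is
    bounded by s H^2 and the other, on average, by Parseval. *)
Lemma gram_le H (s : R) : (forall z, nrm z = 1 -> energy z H <= s) ->
  gram H <= 2 * s * H%:R ^+ 2.
Proof.
move=> es; have [->|H0] := posnP H.
  by rewrite /gram big_ord0 expr0n mulr0.
have n0 : (0 < 3 * H)%N by lia.
have [w pw] := @exists_prim_root R _ n0.
have HR : 0 < H%:R :> R by rewrite ltr0n.
have nR : 0 < (3 * H)%:R :> R by rewrite ltr0n.
have := sum_power_gram pw erefl.
have : \sum_(j < 3 * H) power (w ^+ j) (2 * H) * power (w ^+ j) H <=
   (3 * H)%:R * (2 * H)%:R * (H%:R ^+ 2 * s).
  apply: (@le_trans _ _ (\sum_(j < 3 * H) power (w ^+ j) (2 * H) * (H%:R ^+ 2 * s))).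
    apply: ler_sum => j _; rewrite ler_wpM2l ?power_ge0 // powerE.
    rewrite ler_wpM2l ?sqr_ge0 // es // nrmX.
    by rewrite (nrm_root1 n0 (prim_expr_order pw)) expr1n.
  rewrite -mulr_suml ler_wpM2r //; last by apply: sum_power => //; lia.
  rewrite mulr_ge0 ?sqr_ge0 //; apply: le_trans (es 1 (nrm1)).
  apply: rmean_ge0 => [|n _]; last exact: sqr_ge0.
  apply: bounded_nrm2; apply: bounded_cseqM; first exact: bounded_cseq_cst.
  apply: bounded_cseq_sum => h; apply: bounded_cseqM; first exact: bounded_shift.
  exact: bounded_cseq_cst.
move=> a b; have := le_trans b a; rewrite -mulrA ler_pM2l // natrM.
rewrite (_ : 2 * H%:R * (H%:R ^+ 2 * s) = H%:R * (2 * s * H%:R ^+ 2)); last by ring.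
by rewrite ler_pM2l.
Qed.

End wiener.

(** * Uniformity of the energy on the circle *)

Lemma sqrD_le (R : realFieldType) (a b : R) : (a + b) ^+ 2 <= 2 * a ^+ 2 + 2 * b ^+ 2.
Proof. have := sqr_ge0 (a - b); nra. Qed.

Lemma energy_arith (R : realFieldType) (x y a b e : R) :
  0 < e -> x <= 2 * y + 2 * a -> y <= e / 16 -> a <= e / 32 -> b <= e / 16 ->
  2 * x + 8 * b <= e.
Proof. by move=> e0 xy ye ae be; lra. Qed.

Lemma sum_ord_shift_close (R : realType) (x : nat -> R[i]) K j :
  (forall k, nrm (x k) <= 1) ->
  nrm (\sum_(h < K) x (h + j)%N - \sum_(h < K) x h) <= 2 * j%:R.
Proof.
move=> x1; elim: j => [|j ih].
  by under eq_bigr do rewrite addn0; rewrite subrr nrm0 mulr0.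
have step : \sum_(h < K) x (h + j.+1)%N = \sum_(h < K) x (h + j)%N + (x (K + j)%N - x j).
  elim: K {ih} => [|K ih]; first by rewrite !big_ord0 add0n subrr addr0.
  by rewrite !big_ord_recr /= ih addSnnS; ring.
rewrite step addrAC; apply: le_trans (nrmD _ _) _.
rewrite -[j.+1%:R]natr1 mulrDr mulr1 lerD // (le_trans (nrmB _ _)) //.
by have := x1 (K + j)%N; have := x1 j; lra.
Qed.

Section energy.
Context {R : realType} (U : set_system nat) {UU : UltraFilter U}.
Variables (M : nat -> nat) (u : nat -> R[i]).
Hypotheses (dM : diverges U M) (u1 : forall n, nrm (u n) <= 1).

Local Notation S := (twisted_average u).
Local Notation E := (energy U M u).

Lemma twisted_average_le1 z H n : nrm z = 1 -> nrm (S z H n) <= 1.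
Proof.
move=> z1; rewrite /twisted_average nrmM nrmV nrm_nat.
have [->|H0] := posnP H; first by rewrite invr0 mul0r.
rewrite mulrC ler_pdivrMr ?ltr0n // mul1r; apply: le_trans (nrm_sum _ _ _) _.
apply: (@le_trans _ _ (\sum_(h < H) 1)); last by rewrite sumr_const card_ord.
by apply: ler_sum => h _; rewrite nrmM nrmX z1 expr1n mulr1.
Qed.

Lemma bounded_twisted z H : nrm z = 1 -> bounded_cseq (S z H).
Proof. by move=> z1; exists 1 => n; exact: twisted_average_le1. Qed.

Lemma energy_ge0 z H : nrm z = 1 -> 0 <= E z H.
Proof.
move=> z1; apply: rmean_ge0 => [|n _]; last exact: sqr_ge0.
by apply: bounded_nrm2; exact: bounded_twisted.
Qed.

Lemma rmean_sqr_close (f g : nat -> R[i]) c : bounded_cseq f -> bounded_cseq g ->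
  (forall n, nrm (f n - g n) <= c) ->
  rmean U M (fun n => nrm (f n) ^+ 2) <=
  2 * rmean U M (fun n => nrm (g n) ^+ 2) + 2 * c ^+ 2.
Proof.
move=> bf bg fg; have bg2 := bounded_nrm2 bg; have bf2 := bounded_nrm2 bf.
rewrite -(rmean_cst (2 * c ^+ 2) dM) -rmeanZ // -rmeanD; last 2 first.
- exact: bounded_seqZ.
- exact: bounded_seq_cst.
apply: ler_rmean => //; first by apply: bounded_seqD; [exact: bounded_seqZ|exact: bounded_seq_cst].
move=> n _; apply: le_trans (sqrD_le _ _).
have c0 : 0 <= c by apply: le_trans (nrm_ge0 _) (fg n).
rewrite ler_pXn2r ?nnegrE ?addr_ge0 ?nrm_ge0 // -{1}(subrK (g n) (f n)) addrC.
by apply: le_trans (nrmD _ _) _; rewrite lerD.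
Qed.

Lemma energy_lipschitz z w H : nrm z = 1 -> nrm w = 1 ->
  E z H <= 2 * E w H + 2 * (H%:R * nrm (z - w)) ^+ 2.
Proof.
move=> z1 w1; apply: rmean_sqr_close; try exact: bounded_twisted.
have dX h : nrm (z ^+ h - w ^+ h) <= h%:R * nrm (z - w).
  rewrite subrXX nrmM mulrC ler_wpM2r ?nrm_ge0 //.
  apply: le_trans (nrm_sum _ _ _) _.
  apply: (@le_trans _ _ (\sum_(i < h) 1)); last by rewrite sumr_const card_ord.
  by apply: ler_sum => i _; rewrite nrmM !nrmX z1 w1 !expr1n mulr1.
move=> n; rewrite /twisted_average -mulrBr nrmM nrmV nrm_nat.
have [->|H0] := posnP H; first by rewrite invr0 mul0r mul0r.
rewrite mulrC ler_pdivrMr ?ltr0n // -sumrB; apply: le_trans (nrm_sum _ _ _) _.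
apply: (@le_trans _ _ (\sum_(h < H) H%:R * nrm (z - w))); last first.
  by rewrite sumr_const card_ord mulr_natr.
apply: ler_sum => h _; rewrite -mulrBr nrmM -[leRHS]mul1r ler_pM ?nrm_ge0 //.
apply: le_trans (dX h) _; rewrite ler_wpM2r ?nrm_ge0 // ler_nat ltnW //.
Qed.

(** Up to boundary terms, a window of length K is the average of the windows
    of length H that slide along it; by convexity of the square and shift
    invariance, sliding costs nothing. *)
Lemma energy_longer z H K : nrm z = 1 -> (0 < H)%N -> (0 < K)%N ->
  E z K <= 2 * E z H + 8 * (H%:R / K%:R) ^+ 2.
Proof.
move=> z1 H0 K0; have HR : 0 < H%:R :> R by rewrite ltr0n.
have KR : 0 < K%:R :> R by rewrite ltr0n.
pose g n : R[i] := K%:R^-1 * \sum_(h < K) z ^+ h * S z H (n + h)%N.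
have bh h : bounded_cseq (fun n => z ^+ h * S z H (n + h)%N).
  apply: bounded_cseqM; first exact: bounded_cseq_cst.
  exact: (bounded_cseq_comp (addn^~ h) (bounded_twisted H z1)).
have bg : bounded_cseq g.
  apply: bounded_cseqM; first exact: bounded_cseq_cst.
  by apply: bounded_cseq_sum => h; exact: bh.
have close n : nrm (S z K n - g n) <= 2 * (H%:R / K%:R).
  pose x k := u (n + k)%N * z ^+ k.
  have x1 k : nrm (x k) <= 1 by rewrite nrmM nrmX z1 expr1n mulr1.
  have gE : g n = K%:R^-1 * (H%:R^-1 * \sum_(j < H) \sum_(h < K) x (h + j)%N).
    rewrite /g; congr (_ * _); rewrite exchange_big mulr_sumr; apply: eq_bigr => h _.
    rewrite /twisted_average mulrCA; congr (_ * _); rewrite mulr_sumr.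
    by apply: eq_bigr => j _; rewrite /x addnA exprD; ring.
  have HC : (H%:R : R[i]) != 0 by rewrite pnatr_eq0 -lt0n.
  have SE : S z K n = K%:R^-1 * (H%:R^-1 * \sum_(j < H) \sum_(h < K) x h).
    by rewrite sumr_const card_ord -(mulr_natl (\sum_(h < K) x h)) mulKf.
  rewrite SE gE -!mulrBr -sumrB !nrmM !nrmV !nrm_nat mulrCA mulrA.
  rewrite [_^-1 * _^-1]mulrC -mulrA ler_pdivrMl // mulrA ler_pdivrMl //.
  rewrite (_ : K%:R * _ = 2 * H%:R) ?mulrA; last by field; rewrite gt_eqF.
  apply: le_trans (nrm_sum _ _ _) _.
  apply: (@le_trans _ _ (\sum_(h < H) (2 * H%:R))); last first.
    by rewrite sumr_const card_ord -(mulr_natl (2 * H%:R)) mulrA.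
  apply: ler_sum => j _; rewrite nrmBC; apply: le_trans (sum_ord_shift_close _ _ _) _ => //.
  by rewrite ler_pM2l // ler_nat ltnW.
apply: le_trans (rmean_sqr_close (bounded_twisted K z1) bg close) _.
rewrite (_ : 2 * _ ^+ 2 = 8 * (H%:R / K%:R) ^+ 2); last by ring.
rewrite lerD2r ler_pM2l //.
have bS2 h : bounded_seq (fun n => nrm (S z H (n + h)%N) ^+ 2).
  apply: bounded_nrm2.
  exact: (bounded_cseq_comp (addn^~ h) (bounded_twisted H z1)).
apply: (@le_trans _ _ (rmean U M (fun n => K%:R^-1 *
   \sum_(h < K) nrm (S z H (n + h)%N) ^+ 2))).
  apply: ler_rmean; [exact: bounded_nrm2| |].
    by apply: bounded_seqZ; exact: bounded_seq_sum.
  move=> n _; rewrite /g nrmM nrmV nrm_nat exprMn ler_pdivlMl // mulrA.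
  rewrite exprVn -ler_pdivlMl; last by rewrite mulr_gt0 // invr_gt0 exprn_gt0.
  rewrite (_ : (_ / _)^-1 * _ = K%:R * \sum_(h < K) nrm (S z H (n + h)%N) ^+ 2); last first.
    by congr (_ * _); field; rewrite gt_eqF.
  apply: le_trans (sqr_sum_ord_le _).
  rewrite ler_pXn2r ?nnegrE ?nrm_ge0 ?sumr_ge0 // => [|h _]; last exact: nrm_ge0.
  apply: le_trans (nrm_sum _ _ _) _; apply: ler_sum => h _.
  by rewrite nrmM nrmX z1 expr1n mul1r.
rewrite rmeanZ ?rmean_sum //; last exact: bounded_seq_sum.
rewrite (eq_bigr (fun=> E z H)) => [|h _]; last first.
  rewrite (@rmean_shift _ _ _ _ _ (fun n => nrm (S z H n) ^+ 2)) //.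
  by apply: bounded_nrm2; exact: bounded_twisted.
by rewrite sumr_const card_ord -(mulr_natl (E z H)) mulKf // gt_eqF.
Qed.

Hypothesis vanish : forall z, nrm z = 1 -> forall e, 0 < e ->
  exists2 H, (0 < H)%N & E z H <= e.

(** Dini's argument.  Otherwise there are points of the circle with energy
    above e at windows of arbitrary length.  Let z be a limit of such points.
    Some window H has small energy at z, hence at points near z by
    [energy_lipschitz], and longer windows inherit this by [energy_longer]. *)
Lemma energy_uniform e : 0 < e -> exists2 H1, (0 < H1)%N &
  forall H z, (H1 <= H)%N -> nrm z = 1 -> E z H <= e.
Proof.
move=> e0; apply: contrapT => nex.
have bad i : exists p : nat * R[i], [/\ (i < p.1)%N, nrm p.2 = 1 & e < E p.2 p.1].
  apply: contrapT => nb; apply: nex; exists i.+1 => // H z iH z1.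
  rewrite leNgt; apply/negP => eE; apply: nb; exists (H, z).
  by split.
have [p pP] := choice bad.
have [V [VV sV]] := ultraFilterLemma eventually_filter.
have VP : ProperFilter V := @ultra_proper _ _ VV.
have bp : bounded_cseq (fun i => (p i).2).
  by exists 1 => i; case: (pP i) => _ ->.
have cR := @ulim_cvg _ V VV _ (bounded_Re bp); have cI := @ulim_cvg _ V VV _ (bounded_Im bp).
set z := ulim V (fun i => Re (p i).2) +i* ulim V (fun i => Im (p i).2).
have near d : 0 < d -> \forall i \near V, nrm ((p i).2 - z) < d.
  move=> d0; have d20 : 0 < d / 2 by rewrite divr_gt0.
  have /cvgrPdist_lt/(_ _ d20) aR := cR.
  have /cvgrPdist_lt/(_ _ d20) aI := cI.
  apply: filterS2 aR aI => i a b.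
  apply: le_lt_trans (nrm_le_ReIm _) _; rewrite [ltRHS]splitr.
  by case: (p i).2 a b => x y /= a b; rewrite ltrD // distrC.
have z1 : nrm z = 1.
  apply/eqP; rewrite eq_le; apply/andP; split; apply/ler_addgt0Pr => d d0.
    have [i id] := filter_ex (near d d0); have [_ p1 _] := pP i.
    rewrite -p1 -{1}(subrK (p i).2 z) addrC; apply: le_trans (nrmD _ _) _.
    by rewrite lerD2l nrmBC ltW.
  have [i id] := filter_ex (near d d0); have [_ p1 _] := pP i.
  rewrite -p1 -{1}(subrK z (p i).2) addrC; apply: le_trans (nrmD _ _) _.
  by rewrite lerD2l ltW.
have e16 : 0 < e / 16 by rewrite divr_gt0.
have [H H0 EH] := vanish z1 e16.
have HR : 0 < H%:R :> R by rewrite ltr0n.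
(* Windows of length K >= A satisfy (H / K) ^ 2 <= e / 16. *)
pose A := (Num.trunc (16 * H%:R ^+ 2 / e + 1)).+1.
have /(@filter_ex _ _ VP)[i [iA id]] : \forall i \near V,
    (A <= i)%N /\ nrm ((p i).2 - z) < Num.sqrt (e / 32) / H%:R.
  apply: filterS2 (near (Num.sqrt (e / 32) / H%:R) _).
  - by move=> i; apply: conj.
  - by apply: sV; exists A.
  - by rewrite divr_gt0 // sqrtr_gt0 divr_gt0.
have [iK p1 eE] := pP i; move: eE; apply/negP; rewrite -leNgt.
set K := (p i).1 in iK *; set w := (p i).2 in p1 id *.
have K0 : (0 < K)%N by apply: leq_ltn_trans iK.
have KR : 0 < K%:R :> R by rewrite ltr0n.
apply: le_trans (energy_longer p1 H0 K0) _.
have b1 := energy_lipschitz H p1 z1.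
have b2 : (H%:R * nrm (w - z)) ^+ 2 <= e / 32.
  have e32 : 0 <= e / 32 by rewrite divr_ge0 ?ltW.
  rewrite -[leRHS](sqr_sqrtr e32).
  rewrite ler_pXn2r ?nnegrE ?mulr_ge0 ?sqrtr_ge0 ?nrm_ge0 //.
  by rewrite mulrC -ler_pdivlMr // ltW.
have b3 : (H%:R / K%:R) ^+ 2 <= e / 16.
  have KA : 16 * H%:R ^+ 2 / e + 1 <= K%:R :> R.
    apply: le_trans (ltW (truncnS_gt _)) _; rewrite ler_nat.
    by apply: leq_trans iA _; exact: ltnW.
  rewrite expr_div_n ler_pdivrMr ?exprn_gt0 // mulrAC ler_pdivlMr //.
  have HK : 16 * H%:R ^+ 2 <= K%:R * e by rewrite -ler_pdivrMr //; apply: le_trans KA; rewrite lerDl.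
  have K1 : 1 <= K%:R :> R by rewrite ler1n.
  have eK : 0 <= K%:R * e by rewrite mulr_ge0 // ltW.
  rewrite mulrC; apply: le_trans HK _; rewrite [leRHS]mulrC expr2 -mulrA.
  by rewrite ler_peMl.
exact: energy_arith e0 b1 EH b2 b3.
Qed.

Lemma correlation_average_small e : 0 < e -> exists2 H1, (0 < H1)%N &
  forall H v, (H1 <= H)%N -> (forall n, nrm (v n) <= 1) ->
  \sum_(h < H) nrm (cmean U M (fun n => u n * v (n + h)%N)) <= e * H%:R.
Proof.
move=> e0; have e4 : 0 < e ^+ 4 / 2 by rewrite divr_gt0 // exprn_gt0.
have [H1 H10 HP] := energy_uniform e4; exists H1 => // H v HH v1.
have s0 : 0 <= \sum_(h < H) nrm (cmean U M (fun n => u n * v (n + h)%N)).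
  by apply: sumr_ge0 => h _; exact: nrm_ge0.
rewrite -(@ler_pXn2r _ 4) ?nnegrE ?mulr_ge0 ?(ltW e0) //.
apply: le_trans (correlation_sum_le dM u1 H v1) _.
have gH : gram U M u H <= 2 * (e ^+ 4 / 2) * H%:R ^+ 2.
  by apply: gram_le => // z z1; exact: HP.
apply: (@le_trans _ _ (H%:R ^+ 2 * (2 * (e ^+ 4 / 2) * H%:R ^+ 2))).
  by rewrite ler_wpM2l ?sqr_ge0.
rewrite le_eqVlt; apply/orP; left; apply/eqP; by field.
Qed.

End energy.

(** * The Turan-Kubilius inequality and Katai's criterion *)

Section prime_factors.
Context {R : realType} (U : set_system nat) {UU : UltraFilter U}.
Let UP : ProperFilter U := ultra_proper.
#[local] Existing Instance UP.
Variables (M : nat -> nat).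
Hypotheses (dM : diverges U M).

Definition ind_dvd (d n : nat) : R := (d %| n)%N%:R.

(** The indicator of the n divisible by p but not by p^2: for these,
    n = p m with m coprime to p, and multiplicativity applies. *)
Definition exact_dvd (p n : nat) : R := ind_dvd p n - ind_dvd (p ^ 2) n.

Definition exact_density (p : nat) : R := p%:R^-1 - p%:R^-1 ^+ 2.

Lemma bounded_ind d : bounded_seq (ind_dvd d).
Proof. by exists 1 => n; rewrite normr_nat lern1; case: (d %| n)%N. Qed.

Lemma bounded_exact p : bounded_seq (exact_dvd p).
Proof.
have := bounded_seqZ (-1) (bounded_ind (p ^ 2)); move=> /(bounded_seqD (bounded_ind p)).
by under eq_fun do rewrite mulN1r.
Qed.

Lemma rmean_ind d : (0 < d)%N -> rmean U M (ind_dvd d) = d%:R^-1.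
Proof.
move=> d0; have := rmean_multiples d0 dM (@bounded_seq_cst R 1).
rewrite rmean_cst ?mulr1; last exact: diverges_div.
by move=> <-; apply: eq_rmean => n _; rewrite mulr1.
Qed.

Lemma rmean_exact2 p q : prime p -> prime q ->
  rmean U M (fun n => exact_dvd p n * exact_dvd q n) =
  if p == q then exact_density p else exact_density p * exact_density q.
Proof.
move=> pp pq; have p0 := prime_gt0 pp; have q0 := prime_gt0 pq.
have [<-|pneq] := eqVneq p q.
  rewrite (@eq_rmean _ _ _ _ (fun n => ind_dvd p n + (-1) * ind_dvd (p ^ 2) n)); last first.
    move=> n _; rewrite /exact_dvd /ind_dvd.
    case: (boolP (p ^ 2 %| n)%N) => p2; last by case: (p %| n)%N; rewrite /=; ring.
    by rewrite (dvdn_trans _ p2) ?dvdn_exp //=; ring.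
  rewrite rmeanD ?rmeanZ ?rmean_ind ?expn_gt0 ?p0 //; try exact: bounded_ind.
    by rewrite /exact_density natrX exprVn mulN1r.
  by apply: bounded_seqZ; exact: bounded_ind.
have cpq : coprime p q by rewrite prime_coprime // dvdn_prime2.
have IM a b n : coprime a b -> ind_dvd a n * ind_dvd b n = ind_dvd (a * b) n.
  by move=> ab; rewrite /ind_dvd -natrM mulnb Gauss_dvd.
rewrite (@eq_rmean _ _ _ _ (fun n => (ind_dvd (p * q) n + (-1) * ind_dvd (p * q ^ 2) n) +
    ((-1) * ind_dvd (p ^ 2 * q) n + ind_dvd (p ^ 2 * q ^ 2) n))); last first.
  move=> n _.
  rewrite -(IM p q) // -(IM p (q ^ 2)%N) ?coprimeXr // -(IM (p ^ 2)%N q) ?coprimeXl //.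
  rewrite -(IM (p ^ 2)%N (q ^ 2)%N) ?coprimeXl ?coprimeXr //; rewrite /exact_dvd; ring.
have bZ d : bounded_seq (fun n => -1 * ind_dvd d n).
  by apply: bounded_seqZ; exact: bounded_ind.
have b0 := bounded_ind.
rewrite !rmeanD //; try exact: bounded_seqD.
rewrite !rmeanZ // !rmean_ind ?muln_gt0 ?expn_gt0 ?p0 ?q0 //.
rewrite /exact_density !natrM !invfM; ring.
Qed.

Lemma rmean_exact p : prime p -> rmean U M (exact_dvd p) = exact_density p.
Proof.
move=> pp; have := rmean_exact2 pp pp; rewrite eqxx => <-.
apply: eq_rmean => n _; rewrite /exact_dvd /ind_dvd.
case: (boolP (p ^ 2 %| n)%N) => p2; last by case: (p %| n)%N; rewrite /=; ring.
by rewrite (dvdn_trans _ p2) ?dvdn_exp //=; ring.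
Qed.

Lemma exact_density_ge0 p : prime p -> 0 <= exact_density p.
Proof.
move=> pp; rewrite /exact_density subr_ge0 expr2 ler_piMr ?invr_ge0 //.
by rewrite invf_le1 ?ltr0n ?prime_gt0 // ler1n prime_gt0.
Qed.

Lemma exact_density_ge_half p : prime p -> p%:R^-1 <= 2 * exact_density p :> R.
Proof.
move=> pp; rewrite /exact_density; set t : R := p%:R^-1.
have t0 : 0 <= t by rewrite invr_ge0.
have t2 : t <= 2^-1 by rewrite lef_pV2 ?posrE ?ltr0n ?prime_gt0 // ler_nat prime_gt1.
have : 0 <= t * (1 - 2 * t) by rewrite mulr_ge0 //; lra.
by lra.
Qed.

(** Exact divisibility by different primes are independent events for the
    mean, so the variance of the number of exact divisors taken in P is the sum
    of the individual variances. *)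
Lemma turan_kubilius (P : seq nat) : uniq P -> all prime P ->
  rmean U M (fun n => (\sum_(p <- P) exact_density p - \sum_(p <- P) exact_dvd p n) ^+ 2)
  <= \sum_(p <- P) exact_density p.
Proof.
move=> uP /allP pP.
pose c p n := exact_density p - exact_dvd p n.
have bc p : bounded_seq (c p).
  have := bounded_seqZ (-1) (bounded_exact p).
  move=> /(bounded_seqD (bounded_seq_cst (exact_density p))).
  by under eq_fun do rewrite mulN1r.
rewrite (@eq_rmean _ _ _ _ (fun n => \sum_(p <- P) \sum_(q <- P) c p n * c q n)); last first.
  by move=> n _; rewrite -sumrB expr2 big_distrlr.
rewrite rmean_sum => [|p]; last first.
  by apply: bounded_seq_sum => q; exact: bounded_seqM.
rewrite big_seq [leRHS]big_seq; apply: ler_sum => p Pp.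
rewrite rmean_sum => [|q]; last exact: bounded_seqM.
have cov q : q \in P -> rmean U M (fun n => c p n * c q n) =
    if p == q then exact_density p - exact_density p * exact_density p else 0.
  move=> Pq; pose a := exact_density p; pose b := exact_density q.
  rewrite (@eq_rmean _ _ _ _ (fun n => (exact_dvd p n * exact_dvd q n +
      (- a) * exact_dvd q n) + ((- b) * exact_dvd p n + a * b))); last first.
    by move=> n _; rewrite /c -/a -/b; ring.
  have bE := bounded_exact.
  have bEE : bounded_seq (fun n => exact_dvd p n * exact_dvd q n) by exact: bounded_seqM.
  have bZ x r : bounded_seq (fun n => x * exact_dvd r n) by exact: bounded_seqZ.
  have bK (x : R) := @bounded_seq_cst R x.
  rewrite !rmeanD //; try exact: bounded_seqD.
  rewrite !rmeanZ // rmean_cst // !rmean_exact ?pP // rmean_exact2 ?pP // -/a -/b.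
  by rewrite /a /b; case: eqVneq => [->|_]; ring.
rewrite (bigD1_seq p) //= cov // eqxx big1_seq ?addr0 => [|q /andP[qp Pq]].
  rewrite gerBl mulr_ge0 //; exact/exact_density_ge0/pP.
by rewrite cov // eq_sym (negbTE qp).
Qed.

Variables (u F : nat -> R[i]).
Hypotheses (u1 : forall n, nrm (u n) <= 1) (F1 : forall n, nrm (F n) <= 1).
Hypothesis u_mult : multiplicative_arith u.

(** The restriction to m coprime to p and q is the one under which u (p m) and
    u (q m) factor. *)
Definition dilate_corr (p q m : nat) : R[i] :=
  ((~~ (p %| m)) && ~~ (q %| m))%N%:R * (F (p * m)%N * (F (q * m)%N)^*).

Lemma nrm_dilate_corr p q m : nrm (dilate_corr p q m) <= 1.
Proof.
rewrite /dilate_corr nrmM nrm_nat -[leRHS]mul1r ler_pM ?nrm_ge0 //.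
  by case: (_ && _).
by rewrite nrmM nrm_conj -[leRHS]mul1r ler_pM ?nrm_ge0.
Qed.

Lemma exact_dvd_mult p n : prime p -> (0 < n)%N -> (exact_dvd p n)%:C * u n =
  (p %| n)%N%:R * ((~~ (p %| n %/ p))%N%:R * (u p * u (n %/ p)%N)).
Proof.
move=> pp n0; have p0 := prime_gt0 pp; rewrite /exact_dvd /ind_dvd.
case: (boolP (p %| n)%N) => pn; last first.
  rewrite [(p ^ 2 %| n)%N](_ : _ = false) ?subr0 ?mul0r //.
  by apply: contraNF pn; apply: dvdn_trans; rewrite dvdn_exp.
have -> : (p ^ 2 %| n)%N = (p %| n %/ p)%N by rewrite dvdn_divRL // -expnSr.
have n'0 : (0 < n %/ p)%N by rewrite divn_gt0 // dvdn_leq.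
case: (boolP (p %| n %/ p)%N) => pn'; first by rewrite subrr !mul0r mulr0.
rewrite subr0 !mul1r -u_mult // ?prime_coprime //.
by rewrite mulnC divnK.
Qed.

(** Write each n exactly divisible by p as p m.  Then u (p) u (m) F (p m) is
    summed over p and m; as |u m| <= 1, the Cauchy-Schwarz inequality in m
    eliminates u (m), and the square of the sum over p produces the
    correlations of the dilates of F.  The range of m depends on p and q, which
    is why this step is done on finite sums. *)
Lemma sqr_avg_exact_le (P : seq nat) N : (0 < N)%N -> uniq P -> all prime P ->
  nrm (avg N (fun n => \sum_(p <- P) (exact_dvd p n)%:C * u n * F n)) ^+ 2 <=
  \sum_(p <- P) \sum_(q <- P)
     (if p == q then p%:R^-1
      else nrm (avg (N %/ maxn p q) (dilate_corr p q))).
Proof.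
move=> N0 uP /allP pP; have NR : 0 < N%:R :> R by rewrite ltr0n.
pose x m : R[i] := \sum_(p <- P) (m <= N %/ p)%N%:R *
   (u p * (~~ (p %| m))%N%:R * F (p * m)%N).
have step1 : \sum_(1 <= n < N.+1) \sum_(p <- P) (exact_dvd p n)%:C * u n * F n =
    \sum_(1 <= m < N.+1) u m * x m.
  rewrite exchange_big /=.
  under [RHS]eq_bigr do rewrite mulr_sumr.
  rewrite [RHS]exchange_big /= big_seq [RHS]big_seq; apply: eq_bigr => p Pp.
  have pp := pP _ Pp; have p0 := prime_gt0 pp.
  pose G m := (~~ (p %| m))%N%:R * (u p * u m) * F (p * m)%N.
  transitivity (\sum_(1 <= n < N.+1) (p %| n)%N%:R * G (n %/ p)%N).
    apply: eq_big_nat => n /andP[n0 _]; rewrite exact_dvd_mult // /G.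
    case: (boolP (p %| n)%N) => pn; last by rewrite !mul0r.
    by rewrite !mul1r [(p * _)%N]mulnC divnK.
  rewrite (sum_multiples _ G) // /G (@big_cat_nat _ _ _ (N %/ p).+1 1 N.+1) //=; last first.
    by rewrite ltnS leq_div.
  rewrite [X in _ = _ + X]big_nat_cond [X in _ = _ + X]big1 ?addr0; last first.
    by move=> m /andP[/andP[mN _] _]; rewrite leqNgt mN mul0r mulr0.
  apply: eq_big_nat => m /andP[_ mN]; rewrite -ltnS mN mul1r; ring.
rewrite /avg step1 nrmM nrmV nrm_nat exprMn.
have CS : nrm (\sum_(1 <= m < N.+1) u m * x m) ^+ 2 <=
    N%:R * \sum_(1 <= m < N.+1) nrm (x m) ^+ 2.
  apply: (@le_trans _ _ ((\sum_(1 <= m < N.+1) 1 * nrm (x m)) ^+ 2)).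
    rewrite ler_pXn2r ?nnegrE ?nrm_ge0 //; last first.
      by apply: sumr_ge0 => m _; rewrite mul1r nrm_ge0.
    apply: le_trans (nrm_sum _ _ _) _; apply: ler_sum => m _.
    by rewrite nrmM ler_wpM2r ?nrm_ge0.
  apply: le_trans (cauchy_schwarz _ _ _) _; apply: ler_wpM2r.
    by apply: sumr_ge0 => m _; exact: sqr_ge0.
  under eq_bigr do rewrite expr1n.
  by rewrite sumr_const_nat subn1.
have xE : (\sum_(1 <= m < N.+1) nrm (x m) ^+ 2)%:C =
    \sum_(p <- P) \sum_(q <- P) u p * (u q)^* *
      \sum_(1 <= m < (N %/ maxn p q).+1) dilate_corr p q m.
  rewrite realc_sum.
  transitivity (\sum_(1 <= m < N.+1) \sum_(p <- P) \sum_(q <- P)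
      (m <= N %/ maxn p q)%N%:R * (u p * (u q)^* * dilate_corr p q m)).
    apply: eq_bigr => m _; rewrite -mulc_conj rmorph_sum big_distrlr /=.
    rewrite big_seq [RHS]big_seq; apply: eq_bigr => p Pp.
    rewrite big_seq [RHS]big_seq; apply: eq_bigr => q Pq.
    have p0 := prime_gt0 (pP _ Pp); have q0 := prime_gt0 (pP _ Pq).
    have -> : (m <= N %/ maxn p q)%N = (m <= N %/ p)%N && (m <= N %/ q)%N.
      by rewrite !leq_divRL // ?leq_max ?p0 // maxnMr geq_max.
    rewrite !rmorphM /= !rmorph_nat /dilate_corr.
    by rewrite -!mulnb !natrM; ring.
  rewrite exchange_big /=; apply: eq_bigr => p _.
  rewrite exchange_big /=; apply: eq_bigr => q _.
  rewrite (@big_cat_nat _ _ _ (N %/ maxn p q).+1 1 N.+1) //=; last first.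
    by rewrite ltnS leq_div.
  rewrite [X in _ + X = _]big_nat_cond [X in _ + X = _]big1 ?addr0; last first.
    by move=> m /andP[/andP[mN _] _]; rewrite leqNgt mN mul0r.
  rewrite mulr_sumr; apply: eq_big_nat => m /andP[_ mN]; by rewrite -ltnS mN mul1r.
apply: (@le_trans _ _ (N%:R^-1 * \sum_(1 <= m < N.+1) nrm (x m) ^+ 2)).
  rewrite [N%:R^-1 ^+ 2]expr2 -mulrA ler_wpM2l ?invr_ge0 // ler_pdivrMl //.
have x0 : 0 <= \sum_(1 <= m < N.+1) nrm (x m) ^+ 2.
  by apply: sumr_ge0 => m _; exact: sqr_ge0.
rewrite -[X in _ * X](ger0_norm x0) -nrm_real xE ler_pdivrMl // mulr_sumr.
apply: le_trans (nrm_sum _ _ _) _; rewrite big_seq [leRHS]big_seq.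
apply: ler_sum => p Pp; rewrite mulr_sumr.
apply: le_trans (nrm_sum _ _ _) _; rewrite big_seq [leRHS]big_seq.
apply: ler_sum => q Pq; rewrite !nrmM nrm_conj.
have p0 := prime_gt0 (pP _ Pp); have q0 := prime_gt0 (pP _ Pq).
apply: (@le_trans _ _ (nrm (\sum_(1 <= m < (N %/ maxn p q).+1) dilate_corr p q m))).
  rewrite -[leRHS]mul1r ler_wpM2r ?nrm_ge0 // -[leRHS]mul1r ler_pM ?nrm_ge0 //.
have [<-|pq] := eqVneq p q.
  rewrite maxnn; apply: (@le_trans _ _ ((N %/ p)%N%:R)).
    apply: le_trans (nrm_sum _ _ _) _.
    apply: (@le_trans _ _ (\sum_(1 <= m < (N %/ p).+1) 1)); last first.
      by rewrite sumr_const_nat subn1.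
    by apply: ler_sum => m _; exact: nrm_dilate_corr.
  by rewrite ler_pdivlMr ?ltr0n // -natrM ler_nat leq_trunc_div.
rewrite /avg nrmV nrm_nat.
have [K0|K0] := posnP (N %/ maxn p q).
  by rewrite K0 big_nil nrm0 !mulr0.
have KR : 0 < (N %/ maxn p q)%N%:R :> R by rewrite ltr0n.
by rewrite mulrA ler_peMl ?nrm_ge0 // ler_pdivlMr // mul1r ler_nat leq_div.
Qed.

(** Katai's criterion in quantitative form.  By [turan_kubilius] the number of
    p in P that divide n exactly is nearly constant, so u F may be replaced by
    its product with that number, whose mean is bounded by
    [sqr_avg_exact_le]. *)
Lemma katai_bound (P : seq nat) eta : uniq P -> all prime P -> 0 <= eta ->
  (forall p q, p \in P -> q \in P -> p != q ->
     nrm (cmean U (fun l => M l %/ maxn p q)%N (dilate_corr p q)) <= eta) ->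
  (\sum_(p <- P) exact_density p) * nrm (cmean U M (fun n => u n * F n)) <=
  Num.sqrt (\sum_(p <- P) exact_density p) +
  Num.sqrt (\sum_(p <- P) p%:R^-1 + (size P)%:R ^+ 2 * eta).
Proof.
move=> uP pP eta0 off; set A := \sum_(p <- P) exact_density p.
have A0 : 0 <= A.
  rewrite /A big_seq; apply: sumr_ge0 => p Pp.
  by apply: exact_density_ge0; exact: (allP pP).
have buF : bounded_cseq (fun n => u n * F n).
  by apply: bounded_cseqM; exists 1.
have bex p : bounded_cseq (fun n => (exact_dvd p n)%:C * u n * F n).
  apply: bounded_cseqM; last by exists 1.
  by apply: bounded_cseqM; [apply: bounded_cseq_real; exact: bounded_exact|exists 1].
pose D n : R := A - \sum_(p <- P) exact_dvd p n.
have bD : bounded_seq D.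
  have : bounded_seq (fun n => A + -1 * \sum_(p <- P) exact_dvd p n).
    apply: bounded_seqD; first exact: bounded_seq_cst.
    by apply: bounded_seqZ; apply: bounded_seq_sum => p; exact: bounded_exact.
  by under eq_fun do rewrite mulN1r.
have bDuF : bounded_cseq (fun n => (D n)%:C * (u n * F n)).
  by apply: bounded_cseqM => //; exact: bounded_cseq_real.
have split : A%:C * cmean U M (fun n => u n * F n) =
   cmean U M (fun n => (D n)%:C * (u n * F n)) +
   cmean U M (fun n => \sum_(p <- P) (exact_dvd p n)%:C * u n * F n).
  rewrite -cmeanZ // -cmeanD //; last exact: bounded_cseq_sum.
  apply: eq_cmean => n _; rewrite -!mulr_suml -realc_sum /D rmorphB /=; ring.
rewrite -[A]ger0_norm // -nrm_real -nrmM split nrm_real ger0_norm //.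
apply: le_trans (nrmD _ _) _; apply: lerD.
  rewrite -(@ler_pXn2r _ 2) ?nnegrE ?nrm_ge0 ?sqrtr_ge0 // (sqr_sqrtr A0).
  apply: le_trans (nrm_cmean_sqr dM (bounded_cseq_real bD) _) _.
    by move=> n; rewrite nrmM -[leRHS]mul1r ler_pM ?nrm_ge0.
  apply: le_trans (turan_kubilius uP pP); apply: ler_rmean => //.
  - by apply: bounded_nrm2; exact: bounded_cseq_real.
  - exact: bounded_seqX.
  - by move=> n _; rewrite nrm_real real_normK ?num_real.
have e0 : 0 <= \sum_(p <- P) p%:R^-1 + (size P)%:R ^+ 2 * eta.
  by rewrite addr_ge0 ?mulr_ge0 ?sqr_ge0 // sumr_ge0 // => p _; rewrite invr_ge0.
rewrite -(@ler_pXn2r _ 2) ?nnegrE ?nrm_ge0 ?sqrtr_ge0 // (sqr_sqrtr e0).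
have bW : bounded_cseq (fun n => \sum_(p <- P) (exact_dvd p n)%:C * u n * F n).
  exact: bounded_cseq_sum.
have bdc p q : bounded_cseq (dilate_corr p q).
  by exists 1 => m; exact: nrm_dilate_corr.
have cW : nrm (avg (M l) _) @[l --> U] --> _ := nrm_avg_cvg bW.
have cR : \sum_(p <- P) \sum_(q <- P) (if p == q then p%:R^-1
      else nrm (avg (M l %/ maxn p q) (dilate_corr p q))) @[l --> U] -->
   \sum_(p <- P) \sum_(q <- P) (if p == q then p%:R^-1
      else nrm (cmean U (fun l => M l %/ maxn p q)%N (dilate_corr p q))).
  apply: cvg_finsum => p; apply: cvg_finsum => q; case: eqP => _.
    exact: cvg_cst.
  by apply: (@nrm_avg_cvg _ _ _ (fun l => M l %/ maxn p q)%N).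
have le2 : nrm (cmean U M (fun n => \sum_(p <- P) (exact_dvd p n)%:C * u n * F n)) ^+ 2
    <= \sum_(p <- P) \sum_(q <- P) (if p == q then p%:R^-1
      else nrm (cmean U (fun l => M l %/ maxn p q)%N (dilate_corr p q))).
  pose x l : R := nrm (avg (M l) (fun n => \sum_(p <- P) (exact_dvd p n)%:C * u n * F n)).
  pose y : R := nrm (cmean U M (fun n => \sum_(p <- P) (exact_dvd p n)%:C * u n * F n)).
  have cx : x l @[l --> U] --> y := cW UU.
  have cx2 : x l * x l @[l --> U] --> y * y by exact: cvgM.
  rewrite -/y expr2; apply: (ler_cvg_to cx2 cR).
  by apply: filterS (dM 1%N) => l Ml; rewrite /x -expr2; exact: sqr_avg_exact_le.
apply: le_trans le2 _.
have -> : (size P)%:R ^+ 2 * eta = \sum_(p <- P) \sum_(q <- P) eta.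
  rewrite !big_const_seq !count_predT !iter_addr !addr0.
  by rewrite -(mulr_natl eta) -(mulr_natl (_ * eta)) expr2 mulrA.
rewrite -big_split /= big_seq [leRHS]big_seq; apply: ler_sum => p Pp.
rewrite (bigD1_seq p) //= eqxx lerD2l.
apply: (@le_trans _ _ (\sum_(q <- P | q != p) eta)).
  rewrite big_seq_cond [leRHS]big_seq_cond; apply: ler_sum => q /andP[Pq qp].
  by rewrite eq_sym (negbTE qp) off // eq_sym.
by rewrite [leRHS](bigD1_seq p) //= lerDr.
Qed.

End prime_factors.

(** * Divergence of the sum of the reciprocals of the primes *)

Section prime_reciprocals.
Context {R : realType}.

Definition smooth (k n : nat) := all (fun p => p <= k)%N (primes n).

Definition smooth_sum (k x : nat) : R :=
  \sum_(1 <= n < x.+1) (smooth k n)%:R * n%:R^-1.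

Lemma smooth_sum_ge0 k x : 0 <= smooth_sum k x.
Proof. by apply: sumr_ge0 => n _; rewrite mulr_ge0. Qed.

Lemma smooth_sum1 x : smooth_sum 1 x <= 1.
Proof.
rewrite /smooth_sum; case: x => [|x]; first by rewrite big_nil.
rewrite big_nat_recl // big_nat big1 ?addr0 => [|n /andP[n1 _]].
  by rewrite invr1 mulr1; case: (smooth _ _).
have : pdiv n.+1 \in primes n.+1 by rewrite mem_primes pdiv_prime // pdiv_dvd.
rewrite /smooth; case: allP => [H /H|_]; last by rewrite mul0r.
by rewrite leqNgt prime_gt1 // pdiv_prime.
Qed.

Lemma smooth_sum_nonprime k x : ~~ prime k.+1 -> smooth_sum k.+1 x = smooth_sum k x.
Proof.
move=> np; apply: eq_big_nat => n _; congr ((_ : bool)%:R * _).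
apply: eq_in_all => p; rewrite mem_primes => /andP[pp _]; rewrite leq_eqVlt ltnS.
by case: (eqVneq p k.+1) => [pk|_] //; rewrite -pk pp in np.
Qed.

(** A smooth number divisible by the prime p = k + 1 is p times a smooth
    number; one not divisible by p has its prime factors at most k. *)
Lemma smooth_sum_prime k x : prime k.+1 ->
  smooth_sum k.+1 x <= smooth_sum k x + k.+1%:R^-1 * smooth_sum k.+1 x.
Proof.
move=> pk; set p := k.+1 in pk *.
pose G m : R := (smooth p m)%:R * (p%:R^-1 * m%:R^-1).
apply: (@le_trans _ _ (smooth_sum k x + \sum_(1 <= n < x.+1) (p %| n)%N%:R * G (n %/ p)%N)).
  rewrite /G /smooth_sum -big_split /=; apply: ler_sum_nat => n /andP[n0 _].
  case: (boolP (p %| n)%N) => pn.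
    rewrite mul1r -{2}(divnK pn) natrM invfM [X in _ * X]mulrC.
    rewrite ler_wpDl ?mulr_ge0 // ler_wpM2r ?mulr_ge0 // ler_nat.
    case: (boolP (smooth p n)) => // /allP sn.
    rewrite [smooth _ _](_ : _ = true) //; apply/allP => q; rewrite mem_primes.
    case/and3P => pq _ qn; apply: sn; rewrite mem_primes pq n0 /=.
    by apply: dvdn_trans qn _; exact: dvdn_div.
  rewrite mul0r addr0 ler_wpM2r // ler_nat.
  case: (boolP (smooth p n)) => // /allP sn.
  rewrite [smooth _ _](_ : _ = true) //; apply/allP => q qn.
  have := sn _ qn; rewrite leq_eqVlt => /orP[/eqP qp|//].
  by move: qn; rewrite mem_primes qp (negbTE pn) !andbF.
rewrite lerD2l (sum_multiples _ G) // /G.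
rewrite /smooth_sum mulr_sumr (@big_cat_nat _ _ _ (x %/ p).+1 1 x.+1) //=; last first.
  by rewrite ltnS leq_div.
rewrite ler_wpDr //; first by apply: sumr_ge0 => n _; rewrite !mulr_ge0.
by rewrite le_eqVlt; apply/orP; left; apply/eqP; apply: eq_bigr => n _; rewrite mulrCA.
Qed.

(** Solving the inequality of [smooth_sum_prime] yields the factor
    1 / (1 - 1/p) of Euler's product, which is at most
    exp (4 (1/p - 1/p^2)) because p >= 2. *)
Lemma smooth_sum_le k x : (0 < k)%N ->
  smooth_sum k x <= expR (4 * \sum_(p <- [seq p <- iota 2 k.-1 | prime p]) exact_density p).
Proof.
case: k => // k _; elim: k => [|k ih].
  by rewrite /= big_nil mulr0 expR0 smooth_sum1.
have -> : iota 2 k.+2.-1 = iota 2 k.+1.-1 ++ [:: k.+2].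
  by rewrite -[k.+2.-1]addn1 iotaD.
rewrite filter_cat big_cat mulrDr expRD.
rewrite [[seq _ <- [:: k.+2] | _]]/=; case: ifP => [pk|/negbT npk]; last first.
  by rewrite big_nil mulr0 expR0 mulr1 smooth_sum_nonprime.
rewrite big_seq1.
set t : R := k.+2%:R^-1; set s := smooth_sum k.+2 x.
have t0 : 0 < t by rewrite invr_gt0 ltr0n.
have t2 : t <= 2^-1 by rewrite lef_pV2 ?posrE ?ltr0n // ler_nat.
have s0 : 0 <= s := smooth_sum_ge0 _ _.
have ss := smooth_sum_prime x pk.
have -> : exact_density k.+2 = t * (1 - t) :> R by rewrite /exact_density -/t; ring.
have e1 : 1 + 4 * (t * (1 - t)) <= expR (4 * (t * (1 - t))) := expR_ge1Dx _.
have b0 := smooth_sum_ge0 k.+1 x.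
rewrite mulrC; apply: (@le_trans _ _ ((1 + 4 * (t * (1 - t))) * smooth_sum k.+1 x)).
  apply: (@le_trans _ _ ((1 + 4 * (t * (1 - t))) * ((1 - t) * s))); last first.
    rewrite ler_wpM2l //; first by nra.
    by move: ss; rewrite -/t -/s; lra.
  have h3 : 0 <= t * ((1 - 2 * t) * (3 - 2 * t)).
    by rewrite mulr_ge0 ?mulr_ge0 //; lra.
  have h4 : 1 <= (1 + 4 * (t * (1 - t))) * (1 - t).
    by move: h3; rewrite -subr_ge0 => h3; rewrite -subr_ge0; apply: le_trans h3 _; lra.
  by rewrite [leRHS]mulrA -[leLHS]mul1r ler_wpM2r.
by rewrite ler_pM //; nra.
Qed.

(** Every m <= n is n-smooth, so a bound on these sums would bound the
    harmonic series. *)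
Lemma sum_exact_density_unbounded (B : R) : exists P : seq nat,
  [/\ uniq P, all prime P & B <= \sum_(p <- P) exact_density p].
Proof.
apply: contrapT => nex.
have bd k : \sum_(p <- [seq p <- iota 2 k.-1 | prime p]) exact_density p <= B.
  rewrite leNgt; apply/negP => lt; apply: nex; eexists; split; last exact: (ltW lt).
    by rewrite filter_uniq // iota_uniq.
  exact: filter_all.
apply: (@dvg_harmonic R); apply: nondecreasing_is_cvgn.
  apply: nondecreasing_series => *; exact: harmonic_ge0.
exists (expR (4 * B)) => _ [n _ <-].
have [->|n0] := posnP n; first by rewrite /series /= big_geq // expR_ge0.
apply: le_trans (_ : smooth_sum n n <= _); last first.
  by apply: le_trans (smooth_sum_le _ n0) _; rewrite ler_expR ler_pM2l.
rewrite /series /smooth_sum /= big_add1 /=; apply: ler_sum_nat => m /andP[_ mn].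
rewrite [smooth _ _](_ : _ = true) ?mul1r //; apply/allP => p.
by rewrite mem_primes => /and3P[_ _ /dvdn_leq pm]; apply: leq_trans mn; exact: pm.
Qed.

End prime_reciprocals.

(** * Energy at points that are not roots of unity *)

Section not_root_of_unity.
Context {R : realType} (U : set_system nat) {UU : UltraFilter U}.
Variables (M : nat -> nat) (u : nat -> R[i]).
Hypotheses (dM : diverges U M) (u1 : forall n, nrm (u n) <= 1).
Hypothesis u_mult : multiplicative_arith u.
Variable z : R[i].
Hypothesis z1 : nrm z = 1.

Local Notation S := (twisted_average u z).
Local Notation E := (energy U M u z).

(** The image of [twisted_average] under the adjoint of the averaging
    operator, see [energy_dual].  The truncation of k - h has no effect on the
    mean, since k is of the form n + h after a shift. *)
Definition dual_average (H k : nat) : R[i] :=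
  H%:R^-1 * \sum_(h < H) z ^+ h * (S H (k - h)%N)^*.

Lemma nrm_zX n : nrm (z ^+ n) = 1.
Proof. by rewrite nrmX z1 expr1n. Qed.

Lemma nrm_dual H k : nrm (dual_average H k) <= 1.
Proof.
rewrite /dual_average nrmM nrmV nrm_nat.
have [->|H0] := posnP H; first by rewrite invr0 mul0r.
rewrite mulrC ler_pdivrMr ?ltr0n // mul1r; apply: le_trans (nrm_sum _ _ _) _.
apply: (@le_trans _ _ (\sum_(h < H) 1)); last by rewrite sumr_const card_ord.
by apply: ler_sum => h _; rewrite nrmM nrm_zX mul1r nrm_conj twisted_average_le1.
Qed.

(** Expand one of the two factors of the squared modulus and shift the term
    with index h by h, so that u is evaluated at n. *)
Lemma energy_dual H : (E H)%:C = cmean U M (fun n => u n * dual_average H n).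
Proof.
have bS : bounded_cseq (fun n => S H n).
  by exists 1 => n; exact: twisted_average_le1.
rewrite -cmean_real.
pose f h n := u n * (S H (n - h)%N)^*.
have bf h : bounded_cseq (f h).
  apply: bounded_cseqM; first by exists 1.
  by apply: bounded_cseqJ; exact: (bounded_cseq_comp (subn^~ h) bS).
have bzf h : bounded_cseq (fun n => z ^+ h * f h n).
  by apply: bounded_cseqM; [exact: bounded_cseq_cst|].
have bsf h : bounded_cseq (fun n => f h (n + h)%N).
  exact: (bounded_cseq_comp (addn^~ h) (bf h)).
have bzsf h : bounded_cseq (fun n => z ^+ h * f h (n + h)%N).
  by apply: bounded_cseqM; [exact: bounded_cseq_cst|].
transitivity (cmean U M (fun n => H%:R^-1 * \sum_(h < H) z ^+ h * f h (n + h)%N)).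
  apply: eq_cmean => n _; rewrite -mulc_conj {1}/twisted_average -mulrA mulr_suml.
  by congr (_ * _); apply: eq_bigr => h _; rewrite /f addnK; ring.
transitivity (cmean U M (fun n => H%:R^-1 * \sum_(h < H) z ^+ h * f h n)).
  rewrite !cmeanZ; [|exact: bounded_cseq_sum|exact: bounded_cseq_sum].
  rewrite !cmean_sum //; congr (_ * _); apply: eq_bigr => h _.
  by rewrite !cmeanZ // cmean_shift.
apply: eq_cmean => n _; rewrite /dual_average mulrCA [X in _ = _ * X]mulr_sumr; congr (_ * _).
by apply: eq_bigr => h _; rewrite /f; ring.
Qed.

(** For j = 1 the difference telescopes to two end terms. *)
Lemma dual_average_slow H k j :
  nrm (dual_average H (k + j) - z ^+ j * dual_average H k) <= 2 * j%:R / H%:R.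
Proof.
elim: j => [|j ih]; first by rewrite addn0 expr0 mul1r subrr nrm0 mulr0 mul0r.
have step n : nrm (dual_average H n.+1 - z * dual_average H n) <= 2 / H%:R.
  have telescope K : \sum_(h < K) z ^+ h * (S H (n.+1 - h)%N)^* -
      z * \sum_(h < K) z ^+ h * (S H (n - h)%N)^* =
      (K != 0)%:R * ((S H n.+1)^* - z ^+ K * (S H (n.+1 - K)%N)^*).
    case: K => [|K]; first by rewrite !big_ord0 mulr0 subrr mul0r.
    rewrite mul1r; elim: K => [|K ihK].
      by rewrite !big_ord_recl !big_ord0 expr0 expr1 !subn0 subSS subn0; ring.
    rewrite big_ord_recr /= [X in z * X]big_ord_recr /= mulrDr.
    rewrite opprD addrACA ihK [z ^+ K.+2]exprS subSS exprS; ring.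
  rewrite /dual_average mulrCA -mulrBr telescope nrmM nrmV nrm_nat mulrC.
  rewrite ler_wpM2r ?invr_ge0 //; case: (H) => [|H']; first by rewrite mul0r nrm0.
  rewrite mul1r; apply: le_trans (nrmB _ _) _.
  rewrite nrmM nrm_zX mul1r !nrm_conj.
  by apply: le_trans (lerD (twisted_average_le1 _ _ _ _) (twisted_average_le1 _ _ _ _)) _.
rewrite addnS exprS.
rewrite (_ : _ - _ = (dual_average H (k + j).+1 - z * dual_average H (k + j)%N) +
  z * (dual_average H (k + j)%N - z ^+ j * dual_average H k)); last by ring.
apply: le_trans (nrmD _ _) _; rewrite nrmM z1 mul1r.
apply: le_trans (lerD (step _) ih) _.
by rewrite -mulrDl -[j.+1%:R]natr1 mulrDr mulr1 addrC.
Qed.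

Hypothesis z_free : forall q, (0 < q)%N -> z ^+ q != 1.

(** The factor acquired by the product of F (p n) and the conjugate of
    F (q n) when n grows by p q, for F multiplied by z at each step. *)
Definition rotation (p q : nat) : R[i] := z ^+ (p * (p * q)) * (z ^+ (q * (p * q)))^*.

Lemma rotation_neq1 p q : (0 < p)%N -> (0 < q)%N -> p != q -> rotation p q != 1.
Proof.
suff lt a b c : (a < b)%N -> (0 < c)%N -> z ^+ (a * c) != z ^+ (b * c).
  move=> p0 q0 pq; have pq0 : (0 < p * q)%N by rewrite muln_gt0 p0.
  apply/negP => /eqP r1.
  have e : z ^+ (p * (p * q)) = z ^+ (q * (p * q)).
    rewrite -[LHS]mulr1 -(mulJ1 (nrm_zX (q * (p * q)))) mulrCA -/(rotation p q) .
    by rewrite r1 mulr1.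
  case: (ltngtP p q) pq => // l _.
    by have := lt _ _ _ l pq0; rewrite e eqxx.
  by have := lt _ _ _ l pq0; rewrite e eqxx.
move=> ab c0; apply/negP => /eqP e.
have zb : z ^+ (a * c) != 0 by rewrite -nrm_eq0 nrm_zX oner_eq0.
have d0 : (0 < (b - a) * c)%N by rewrite muln_gt0 subn_gt0 ab.
have := z_free d0; rewrite -(inj_eq (mulfI zb)) mulr1 -exprD -mulnDl subnKC ?(ltnW ab) //.
by rewrite -e eqxx.
Qed.

Lemma nrm_mul_close (a b c d : R[i]) e f : nrm a <= 1 -> nrm d <= 1 ->
  nrm (a - c) <= e -> nrm (b - d) <= f -> nrm (a * b - c * d) <= e + f.
Proof.
move=> a1 d1 ac bd.
rewrite (_ : _ - _ = (a - c) * d + a * (b - d)); last by ring.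
apply: le_trans (nrmD _ _) _; rewrite !nrmM; apply: lerD.
  by rewrite -[e]mulr1 ler_pM ?nrm_ge0.
by rewrite -[f]mul1r ler_pM ?nrm_ge0.
Qed.

(** A step of p q preserves divisibility by p and by q, and multiplies the
    summand by [rotation p q] up to O(1 / H).  As the mean is invariant under
    this step, it is nearly fixed by multiplication by a number other than 1. *)
Lemma dilate_corr_small M' p q H : diverges U M' -> (0 < p)%N -> (0 < q)%N -> p != q ->
  nrm (cmean U M' (dilate_corr (dual_average H) p q)) <=
  (2 * (p + q)%:R * (p * q)%:R / nrm (1 - rotation p q)) / H%:R.
Proof.
move=> dM' p0 q0 pq; set D := dilate_corr _ _ _; set L := (p * q)%N.
set r := rotation p q.
have bD : bounded_cseq D.
  by exists 1 => m; apply: nrm_dilate_corr => n; exact: nrm_dual.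
have bDL : bounded_cseq (fun n => D (n + L)%N) := bounded_cseq_comp (addn^~ L) bD.
have brD : bounded_cseq (fun n => (- r) * D n).
  by apply: bounded_cseqM => //; exact: bounded_cseq_cst.
have r1 : 0 < nrm (1 - r).
  by rewrite lt0r nrm_ge0 nrm_eq0 subr_eq0 eq_sym rotation_neq1.
have eD : (1 - r) * cmean U M' D = cmean U M' (fun n => D (n + L)%N + (- r) * D n).
  by rewrite cmeanD // cmeanZ // cmean_shift //; ring.
have close n : nrm (D (n + L)%N + (- r) * D n) <= 2 * (p + q)%:R * L%:R / H%:R.
  have -> : D (n + L)%N + (- r) * D n = ((~~ (p %| n)) && ~~ (q %| n))%N%:R *
     (dual_average H (p * n + p * L)%N * (dual_average H (q * n + q * L)%N)^* -
      (z ^+ (p * L) * dual_average H (p * n)%N) *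
      (z ^+ (q * L) * dual_average H (q * n)%N)^*).
    rewrite /D /dilate_corr !mulnDr /r /rotation rmorphM /=.
    rewrite dvdn_addl ?dvdn_mulr // [(q %| n + L)%N]dvdn_addl ?dvdn_mull //.
    by rewrite -/L; ring.
  rewrite nrmM nrm_nat -[leRHS]mul1r ler_pM ?nrm_ge0 //; first by case: (_ && _).
  have -> : 2 * (p + q)%:R * L%:R / H%:R =
     2 * (p * L)%N%:R / H%:R + 2 * (q * L)%N%:R / H%:R :> R.
    by rewrite !natrM natrD; ring.
  apply: nrm_mul_close.
  - exact: nrm_dual.
  - by rewrite nrm_conj nrmM nrm_zX mul1r nrm_dual.
  - exact: dual_average_slow.
  - by rewrite -rmorphB nrm_conj; exact: dual_average_slow.
rewrite mulrAC ler_pdivlMr // mulrC -nrmM eD.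
have bDD : bounded_cseq (fun n => D (n + L)%N + (- r) * D n) by exact: bounded_cseqD.
apply: le_trans (nrm_cmean _ bDD) _.
apply: rmean_le => //; last exact: bounded_cseq_nrm.
Qed.

(** Take P with large sum A of densities, then H so large that the
    correlations of dilates are negligible: [katai_bound] becomes A E <= 3 sqrt A. *)
Lemma energy_vanish_free e : 0 < e -> exists2 H, (0 < H)%N & E H <= e.
Proof.
move=> e0.
(* The bound 9 / e ^ 2 yields 3 / sqrt A <= e; adding 1 makes A positive. *)
have [P [uP pP PA]] := @sum_exact_density_unbounded R (9 / e ^+ 2 + 1).
set A := \sum_(p <- P) exact_density p in PA.
have A1 : 1 <= A.
  by apply: le_trans PA; rewrite lerDr divr_ge0 // sqr_ge0.
have A0 : 0 < A by apply: lt_le_trans A1.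
pose eta : R := A / (size P).+1%:R ^+ 2.
have s0 : 0 < (size P).+1%:R ^+ 2 :> R by rewrite exprn_gt0.
have eta0 : 0 < eta by rewrite divr_gt0.
pose K p q : R := 2 * (p + q)%:R * (p * q)%:R / nrm (1 - rotation p q).
have K0 p q : 0 <= K p q by rewrite divr_ge0 ?nrm_ge0 // !mulr_ge0.
pose Kt : R := \sum_(p <- P) \sum_(q <- P) K p q.
have KKt p q : p \in P -> q \in P -> K p q <= Kt.
  move=> Pp Pq; rewrite /Kt (bigD1_seq p) //= (bigD1_seq q) //=.
  rewrite -addrA lerDl addr_ge0 //.
    by rewrite sumr_ge0.
  by rewrite sumr_ge0 // => r _; rewrite sumr_ge0.
have Kt0 : 0 <= Kt by rewrite sumr_ge0 // => r _; rewrite sumr_ge0.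
pose H := (Num.trunc (Kt / eta)).+1.
have HK : Kt / eta <= H%:R := ltW (truncnS_gt _).
exists H => //.
have HR : 0 < H%:R :> R by rewrite ltr0n.
have off p q : p \in P -> q \in P -> p != q ->
   nrm (cmean U (fun l => M l %/ maxn p q)%N (dilate_corr (dual_average H) p q)) <= eta.
  move=> Pp Pq pq; have p0 := prime_gt0 (allP pP _ Pp).
  have q0 := prime_gt0 (allP pP _ Pq).
  apply: le_trans (dilate_corr_small _ _ p0 q0 pq) _.
    by apply: diverges_div dM; rewrite leq_max p0.
  rewrite -/(K p q) ler_pdivrMr // mulrC -ler_pdivrMr //.
  by apply: le_trans HK; rewrite ler_pM2r ?invr_gt0 // KKt.
have kb : A * E H <= Num.sqrt A +
    Num.sqrt (\sum_(p <- P) p%:R^-1 + (size P)%:R ^+ 2 * eta).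
  rewrite -[E H]ger0_norm ?energy_ge0 // -nrm_real energy_dual.
  by apply: katai_bound => //; [exact: nrm_dual|exact: ltW].
have sA : Num.sqrt (\sum_(p <- P) p%:R^-1 + (size P)%:R ^+ 2 * eta) <= 2 * Num.sqrt A.
  have -> : 2 * Num.sqrt A = Num.sqrt (4 * A).
    rewrite sqrtrM // (_ : 4 = 2 ^+ 2); last by ring.
    by rewrite sqrtr_sqr ger0_norm.
  rewrite ler_wsqrtr // (_ : 4 * A = 2 * A + 2 * A); last by ring.
  apply: lerD.
    rewrite /A mulr_sumr big_seq [leRHS]big_seq; apply: ler_sum => p Pp.
    exact/exact_density_ge_half/(allP pP).
  rewrite /eta mulrA ler_pdivrMr //.
  apply: (@le_trans _ _ ((size P).+1%:R ^+ 2 * A)).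
    by rewrite ler_pM2r // ler_pXn2r ?nnegrE // ler_nat.
  have := mulr_gt0 s0 A0; lra.
have sA0 : 0 < Num.sqrt A by rewrite sqrtr_gt0.
have AE : A * E H <= 3 * Num.sqrt A.
  by apply: le_trans kb _; lra.
have AA : A = Num.sqrt A * Num.sqrt A by rewrite -expr2 sqr_sqrtr // ltW.
have E3 : Num.sqrt A * E H <= 3.
  by move: AE; rewrite {1}AA -mulrA [leRHS]mulrC ler_pM2l.
have se : 3 <= e * Num.sqrt A.
  rewrite -ler_pdivrMl // -(@ler_pXn2r _ 2) ?nnegrE ?sqrtr_ge0 //; last first.
    by rewrite mulr_ge0 // invr_ge0 ltW.
  rewrite (sqr_sqrtr (ltW A0)) exprMn exprVn.
  by apply: le_trans PA; lra.
rewrite -(ler_pM2l sA0) [leRHS]mulrC; exact: le_trans E3 se.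
Qed.

End not_root_of_unity.

(** * Dirichlet characters span the functions on units *)

Section characters.
Context {R : realType}.
Variable q' : nat.
Local Notation q := q'.+1.

(** The operator f -> f (a x) on functions on Z/qZ. *)
Definition mul_mx (a : nat) : 'M[R[i]]_q :=
  \matrix_(x, y) ((y : nat) == (a * x) %% q)%N%:R.

Lemma mul_mx_mulmx a b : mul_mx a *m mul_mx b = mul_mx (a * b).
Proof.
apply/matrixP => x y; rewrite !mxE.
have axq : ((a * x) %% q < q)%N by rewrite ltn_pmod.
rewrite (bigD1 (Ordinal axq)) //= !mxE eqxx mul1r big1 ?addr0 => [|w wn].
  by rewrite modnMmr mulnA [(b * a)%N]mulnC.
rewrite !mxE [_ == _ :> nat](_ : _ = false) ?mul0r //.
by apply: contraNF wn => /eqP e; apply/eqP/val_inj.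
Qed.

Lemma mul_mx1 : mul_mx 1 = 1%:M.
Proof.
by apply/matrixP => x y; rewrite !mxE mul1n modn_small // eq_sym.
Qed.

Lemma mul_mx_mod a b : a = b %[mod q] -> mul_mx a = mul_mx b.
Proof. by move=> ab; apply/matrixP => x y; rewrite !mxE -modnMml ab modnMml. Qed.

Lemma mul_mxX a n : mul_mx a ^+ n = mul_mx (a ^ n).
Proof.
elim: n => [|n ih]; first by rewrite expr0 expn0 mul_mx1.
by rewrite exprS ih expnS -mul_mx_mulmx.
Qed.

Lemma mul_mx_totient a : coprime a q -> mul_mx a ^+ totient q = 1.
Proof.
by move=> aq; rewrite mul_mxX (mul_mx_mod (Euler_exp_totient aq)) mul_mx1.
Qed.

(** By Euler's theorem the minimal polynomial divides X^(totient q) - 1, whose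
    roots are simple. *)
Lemma mul_mx_diagonalizable a : coprime a q -> diagonalizable (mul_mx a).
Proof.
move=> aq; apply/diagonalizableP; have t0 : (0 < totient q)%N by rewrite totient_gt0.
have [rs rE] := closed_field_poly_normal ('X^(totient q) - 1 : {poly R[i]}).
rewrite (monicP _) ?monicXnsubC // scale1r in rE.
exists rs.
  by rewrite -separable_prod_XsubC -rE separable_Xn_sub_1 // pnatr_eq0 -lt0n.
apply: mxminpoly_min; rewrite -rE rmorphB rmorphXn /= horner_mx_X rmorph1.
by rewrite mul_mx_totient // subrr.
Qed.

Lemma mul_mx_codiag : exists2 P : 'M[R[i]]_q, P \in unitmx &
  forall a, coprime a q -> is_diag_mx (P *m mul_mx a *m invmx P).
Proof.
have /codiagonalizableP[P Pu /allP PD] :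
    {in [seq mul_mx a | a <- iota 0 q & coprime a q] &, forall A B, comm_mx A B} /\
    {in [seq mul_mx a | a <- iota 0 q & coprime a q], forall A, diagonalizable A}.
  split=> [A B /mapP[a _ ->] /mapP[b _ ->]|A /mapP[a + ->]].
    by rewrite /comm_mx !mul_mx_mulmx mulnC.
  by rewrite mem_filter => /andP[aq _]; exact: mul_mx_diagonalizable.
exists P => // a aq; rewrite -conjumx //.
have -> : mul_mx a = mul_mx (a %% q) by apply: mul_mx_mod; rewrite modn_mod.
apply: PD; apply: map_f; rewrite mem_filter mem_iota ltn_pmod // andbT.
by rewrite coprime_modl aq.
Qed.

(** The commuting diagonalisable operators [mul_mx a], for a coprime to q,
    become diagonal in a common basis.  Each diagonal entry, as a function of a,
    is a Dirichlet character, and f m is the value at 1 of [mul_mx m] applied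
    to f, hence a combination of these entries. *)
Lemma characters_span :
  exists chi : 'I_q -> nat -> R[i], (forall i, dirichlet_character q (chi i)) /\
  forall f : nat -> R[i], (forall m, f (m %% q)%N = f m) ->
  exists c : 'I_q -> R[i], forall m, coprime m q -> f m = \sum_i c i * chi i m.
Proof.
have [P Pu PD] := mul_mx_codiag.
pose D a := P *m mul_mx a *m invmx P.
have DM a b : D (a * b)%N = D a *m D b.
  by rewrite /D !mulmxA mulmxKV // -[P *m _ *m mul_mx b]mulmxA mul_mx_mulmx.
have D1 : D 1%N = 1%:M by rewrite /D mul_mx1 mulmx1 mulmxV.
have Dmod a b : a = b %[mod q] -> D a = D b by move=> ab; rewrite /D (mul_mx_mod ab).
have Ddiag a i j : coprime a q -> i != j -> D a i j = 0.
  by move=> aq ij; apply: (is_diag_mxP (PD a aq)).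
have DMi a b i : coprime a q -> D (a * b)%N i i = D a i i * D b i i.
  move=> aq; rewrite DM mxE (bigD1 i) //= big1 ?addr0 // => j ji.
  by rewrite Ddiag ?mul0r // eq_sym.
pose chi i m := (coprime m q)%:R * D m i i.
exists chi; split=> [i|f fq].
  split=> // [m n|n|n].
  - rewrite /chi coprimeMl; case: (boolP (coprime m q)) => mq; last by rewrite !mul0r.
    by rewrite DMi //; case: (coprime n q); rewrite ?mul0r ?mulr0 ?mul1r.
  - rewrite /chi (Dmod (n + q)%N n) ?modnDr //.
    by rewrite -coprime_modl modnDr coprime_modl.
  - rewrite /chi; case: (boolP (coprime n q)) => nq; last by rewrite mul0r eqxx.
    rewrite mul1r.
    have DX k : D (n ^ k)%N i i = D n i i ^+ k.
      elim: k => [|k ih]; first by rewrite expn0 D1 mxE eqxx expr0.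
      by rewrite expnS DMi // ih exprS.
    have : D n i i ^+ totient q = 1.
      by rewrite -DX (Dmod _ 1%N (Euler_exp_totient nq)) D1 mxE eqxx.
    move=> t1; apply/negP => /eqP D0; move: t1; rewrite D0 expr0n.
    by rewrite -leqn0 leqNgt totient_gt0 /= => /eqP; rewrite eq_sym oner_eq0.
(* The reduction matters for q = 1, where the class of 1 is 0. *)
pose one : 'I_q := inord (1 %% q).
pose fv : 'cV[R[i]]_q := \col_y f y.
exists (fun i => invmx P one i * (P *m fv) i 0) => m mq.
have fE : f m = (mul_mx m *m fv) one 0.
  have mlt : (m %% q < q)%N by rewrite ltn_pmod.
  rewrite mxE (bigD1 (Ordinal mlt)) //= !mxE big1 ?addr0 => [|w wn].
    by rewrite inordK ?ltn_pmod //= modnMmr muln1 eqxx mul1r fq.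
  rewrite !mxE inordK ?ltn_pmod // modnMmr muln1.
  rewrite [_ == _ :> nat](_ : _ = false) ?mul0r //.
  by apply: contraNF wn => /eqP e; apply/eqP/val_inj.
have mE : mul_mx m = invmx P *m (D m *m P) by rewrite /D mulmxKV // mulKmx.
rewrite fE mE -(mulmxA (invmx P) (D m *m P) fv) -(mulmxA (D m) P fv).
set W := P *m fv; rewrite mxE; apply: eq_bigr => i _.
rewrite [X in _ * X = _]mxE (bigD1 i) //= big1 ?addr0 => [|j ji].
  by rewrite /chi mq mul1r; ring.
by rewrite Ddiag ?mul0r // eq_sym.
Qed.

End characters.

(** * Energy at roots of unity *)

(** The values at integers coprime to q are roots of unity, by Euler's
    theorem. *)
Lemma nrm_dirichlet (R : realType) q (chi : nat -> R[i]) n :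
  dirichlet_character q chi -> nrm (chi n) <= 1.
Proof.
case=> q0 chiM chiP chi0.
have chi_mod m : chi (m %% q)%N = chi m.
  rewrite [in RHS](divn_eq m q); elim: (m %/ q)%N => [|k ih].
    by rewrite mul0n add0n.
  by rewrite mulSn addnAC -addnA addnC chiP addnC.
case: (boolP (coprime n q)) => nq; last first.
  by have := chi0 n; rewrite (negbTE nq) => /negbT; rewrite negbK => /eqP ->; rewrite nrm0.
have chi1 : chi 1%N = 1.
  have n1 : chi 1%N != 0 by rewrite chi0 coprime1n.
  by apply: (mulfI n1); rewrite -chiM mulr1.
have chiX k : chi (n ^ k)%N = chi n ^+ k.
  by elim: k => [|k ih]; rewrite ?expn0 ?expr0 // expnS exprS chiM ih.
have t1 : chi n ^+ totient q = 1.
  by rewrite -chiX -chi_mod (Euler_exp_totient nq) chi_mod.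
by rewrite (nrm_root1 _ t1) // totient_gt0.
Qed.

Lemma sum_nat_window (V : zmodType) (F : nat -> V) n L :
  \sum_(1 <= j < (n + L).+1) F j =
  \sum_(1 <= j < n.+1) F j + \sum_(1 <= h < L.+1) F (n + h)%N.
Proof.
elim: L => [|L ih]; first by rewrite addn0 [X in _ + X]big_nil addr0.
by rewrite addnS big_nat_recr //= ih [X in _ = _ + X]big_nat_recr //= addnS addrA.
Qed.

(** A window of length d K holds exactly K multiples of d, wherever it starts. *)
Lemma sum_multiples_window (R : realType) d K n (f : nat -> R[i]) : (0 < d)%N ->
  \sum_(h < d * K) (d %| n.+1 + h)%N%:R * f ((n.+1 + h) %/ d)%N =
  \sum_(1 <= h < K.+1) f (n %/ d + h)%N.
Proof.
move=> d0; pose F j := (d %| j)%N%:R * f (j %/ d)%N.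
have := sum_nat_window F n (d * K); rewrite /F !sum_multiples //.
rewrite mulnC divnDMl // sum_nat_window => /addrI ->.
rewrite big_add1 big_mkord mulnC; apply: eq_bigr => h _.
by rewrite addSnnS.
Qed.

Section q_part.
Variables (q J : nat).
Hypotheses (q0 : (0 < q)%N).
Local Notation pi := \pi(q).

(** Uniqueness of the factorisation of n into a part composed of primes of q
    and a part coprime to q. *)
Lemma q_part_dvdP n d : (0 < n)%N -> (d %| q ^ J)%N ->
  (d == n`_pi)%N = (d %| n)%N && coprime (n %/ d) q.
Proof.
move=> n0 dq; apply/eqP/andP => [->|[dn cnq]].
  split; first exact: dvdn_part.
  have e : (n %/ n`_pi = n`_pi^')%N.
    by rewrite -{1}(partnC pi n0) mulKn // part_gt0.
  rewrite e coprime_sym; apply: (@pnat_coprime pi); first exact: pnat_pi.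
  exact: part_pnat.
have d0 : (0 < d)%N by apply: dvdn_gt0 dn.
have m0 : (0 < n %/ d)%N by rewrite divn_gt0 // dvdn_leq.
rewrite -{1}(divnK dn) partnM // part_p'nat; last first.
  by rewrite -coprime_pi' // coprime_sym.
rewrite mul1n part_pnat_id //; apply: (pnat_dvd dq).
by rewrite pnatX pnat_pi.
Qed.

Lemma q_part_large n : (0 < n)%N -> ~~ (n`_pi %| q ^ J)%N ->
  exists2 p, p \in primes q & (p ^ J %| n)%N.
Proof.
move=> n0 nd; apply: contrapT => nex; move/negP: nd; apply.
apply/dvdn_partP => [|p]; first exact: part_gt0.
move=> pn.
have pq : p \in primes q by have /andP[_ /allP/(_ p pn)] := part_pnat pi n.
have pp : prime p by move: pq; rewrite mem_primes => /andP[].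
have pdq : (p %| q)%N by move: pq; rewrite mem_primes => /and3P[].
have lt : (logn p n < J)%N.
  rewrite ltnNge -pfactor_dvdn //; apply/negP => pJ; apply: nex; by exists p.
rewrite p_part; apply: (@dvdn_trans (p ^ J)); last exact: dvdn_exp2r.
apply: dvdn_exp2l; apply: leq_trans (ltnW lt).
by rewrite dvdn_leq_log // dvdn_part.
Qed.

End q_part.

Section root_of_unity.
Context {R : realType} (U : set_system nat) {UU : UltraFilter U}.
Variables (M : nat -> nat) (u : nat -> R[i]).
Hypotheses (dM : diverges U M) (u1 : forall n, nrm (u n) <= 1).
Hypothesis u_mult : multiplicative_arith u.
Variables (z : R[i]) (q : nat).
Hypotheses (q0 : (0 < q)%N) (zq : z ^+ q = 1).

Definition short_mean (w : nat -> R[i]) (H : nat) (n : nat) : R[i] :=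
  H%:R^-1 * \sum_(1 <= h < H.+1) w (n + h)%N.

(* The sequences M / d occur because the multiples of d up to M l have quotients
   up to M l / d. *)
Hypothesis short : forall chi, dirichlet_character q chi ->
  forall d, (0 < d)%N -> forall e, 0 < e -> exists H0, forall H, (H0 <= H)%N ->
  rmean U (fun l => M l %/ d)%N
    (fun n => nrm (short_mean (fun n => u n * chi n) H n) ^+ 2) <= e.

Let z1 : nrm z = 1 := nrm_root1 q0 zq.

Lemma nrm_short_mean w H n : (forall n, nrm (w n) <= 1) -> nrm (short_mean w H n) <= 1.
Proof.
move=> w1; rewrite /short_mean nrmM nrmV nrm_nat.
have [->|H0] := posnP H; first by rewrite invr0 mul0r.
rewrite mulrC ler_pdivrMr ?ltr0n // mul1r; apply: le_trans (nrm_sum _ _ _) _.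
apply: (@le_trans _ _ (\sum_(1 <= h < H.+1) 1)); last by rewrite sumr_const_nat subn1.
by apply: ler_sum => h _.
Qed.

Definition sparse_mean (w : nat -> R[i]) (d H n : nat) : R[i] :=
  H%:R^-1 * \sum_(h < H) (d %| n + h)%N%:R * w ((n + h) %/ d)%N.

(** The multiples of d in the window that follows n are d (m + 1), ...,
    d (m + K) with m = n / d, and [rmean_floor] changes the variable from n
    to m. *)
Lemma rmean_sparse w d K : (0 < d)%N -> (0 < K)%N -> (forall n, nrm (w n) <= 1) ->
  rmean U M (fun n => nrm (sparse_mean w d (d * K) n) ^+ 2) <=
  rmean U (fun l => M l %/ d)%N (fun n => nrm (short_mean w K n) ^+ 2).
Proof.
move=> d0 K0 w1.
have bs : bounded_seq (fun n => nrm (short_mean w K n) ^+ 2).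
  by apply: bounded_nrm2; exists 1 => n; exact: nrm_short_mean.
have bsp : bounded_cseq (sparse_mean w d (d * K)).
  apply: bounded_cseqM; first exact: bounded_cseq_cst.
  apply: bounded_cseq_sum => h; apply: bounded_cseqM.
    exact: (bounded_cseq_nat (fun n => d %| n + h)%N).
  by exists 1 => n.
rewrite -rmean_floor // -[leLHS](@rmean_shift _ _ _ _ 1) //; last exact: bounded_nrm2.
apply: ler_rmean => [||n _].
- by case: (bounded_nrm2 bsp) => C CP; exists C.
- by case: bs => C CP; exists C.
rewrite ler_pXn2r ?nnegrE ?nrm_ge0 // addn1 /sparse_mean sum_multiples_window //.
rewrite /short_mean natrM invfM -mulrA nrmM nrmV nrm_nat ler_piMl ?nrm_ge0 //.
by rewrite invf_le1 ?ltr0n // ler1n.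
Qed.

(** Write n = d m with m coprime to q and d composed of primes of q.  If d
    divides q^J, then u n z^n = u d (u m z^(d m)), and z^(d m) is a combination
    of Dirichlet characters in m; the window average is then a combination,
    with coefficients independent of H, of averages of u chi over multiples
    of d.  The other n are divisible by p^J for some prime p of q, and they are
    rare when J is large.  The window length is a multiple of q^J, so that
    every d divides it. *)
Lemma energy_vanish_root e : 0 < e -> exists2 H, (0 < H)%N & energy U M u z H <= e.
Proof.
move=> e0.
(* The integers divisible by p ^ J for some prime p of q are rare. *)
have [J J0 JP] : exists2 J, (0 < J)%N & \sum_(p <- primes q) (p ^ J)%N%:R^-1 <= e / 4 :> R.
  pose J := (Num.trunc (4 * (size (primes q))%:R / e)).+1; exists J => //.
  have JR : 4 * (size (primes q))%:R / e <= J%:R :> R := ltW (truncnS_gt _).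
  apply: (@le_trans _ _ (\sum_(p <- primes q) J%:R^-1)).
    rewrite big_seq [leRHS]big_seq; apply: ler_sum => p.
    rewrite mem_primes => /andP[pp _].
    have pJ0 : (0 < p ^ J)%N by rewrite expn_gt0 prime_gt0.
    by rewrite lef_pV2 ?posrE ?ltr0n // ler_nat ltnW // ltn_expl // prime_gt1.
  rewrite big_const_seq count_predT iter_addr addr0 -(mulr_natl _ (size _)).
  rewrite ler_pdivrMr ?ltr0n //.
  by move: JR; rewrite ler_pdivrMr // => JR; lra.
pose Q := (q ^ J)%N.
have Q0 : (0 < Q)%N by rewrite expn_gt0 q0.
pose g n := u n * z ^+ n.
pose good n := (n`_\pi(q) %| Q)%N.
pose main n := (good n)%:R * g n.
pose rest n := (~~ good n)%:R * g n.
pose B n : R := \sum_(p <- primes q) ind_dvd (p ^ J) n.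
have g1 n : nrm (g n) <= 1 by rewrite nrmM nrmX z1 expr1n mulr1.
have gE n : g n = main n + rest n.
  by rewrite /main /rest; case: (good n); rewrite mul0r mul1r ?addr0 ?add0r.
have restB n : (0 < n)%N -> nrm (rest n) ^+ 2 <= B n.
  move=> n0; rewrite /rest; case: (boolP (good n)) => gn.
    rewrite mul0r nrm0 expr0n; apply: sumr_ge0 => p _; exact: ler0n.
  have [p pq pJ] := q_part_large n0 gn.
  rewrite mul1r; apply: (@le_trans _ _ 1).
    by rewrite -(expr1n R 2) ler_pXn2r ?nnegrE ?nrm_ge0.
  rewrite /B (bigD1_seq p) ?primes_uniq //= /ind_dvd pJ lerDl.
  by apply: sumr_ge0 => r _; exact: ler0n.
have rmB : rmean U M B <= e / 4.
  rewrite rmean_sum => [|p]; last exact: bounded_ind.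
  apply: le_trans JP; rewrite big_seq [leRHS]big_seq; apply: ler_sum => p.
  by rewrite mem_primes => /andP[pp _]; rewrite rmean_ind // expn_gt0 prime_gt0.
(* On m coprime to q, the function z ^ (d * m) of m, of period q, is a
   combination of characters. *)
have [chi [chiD chiS]] : exists chi : 'I_q -> nat -> R[i],
    (forall i, dirichlet_character q (chi i)) /\
    forall f : nat -> R[i], (forall m, f (m %% q)%N = f m) ->
    exists c : 'I_q -> R[i], forall m, coprime m q -> f m = \sum_i c i * chi i m.
  by case: (q) q0 => // q' _; exact: characters_span.
have zper d m : z ^+ (d * (m %% q)) = z ^+ (d * m).
  rewrite [in RHS](divn_eq m q) mulnDr exprD mulnA (exprM z (d * (m %/ q)) q).
  by rewrite exprAC zq expr1n mul1r.
have [c cP] := choice (fun d => chiS (fun m => z ^+ (d * m)) (zper d)).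
pose w i n := u n * chi i n.
have w1 i n : nrm (w i n) <= 1.
  by rewrite nrmM -[leRHS]mul1r ler_pM ?nrm_ge0 // (nrm_dirichlet _ (chiD i)).
have mainE n : (0 < n)%N -> main n =
   \sum_(d <- divisors Q) \sum_i (u d * c d i) * ((d %| n)%N%:R * w i (n %/ d)%N).
  move=> n0; rewrite /main.
  have -> : (good n)%:R = \sum_(d <- divisors Q) (d == n`_\pi(q))%N%:R :> R[i].
    rewrite /good; case: (boolP (_ %| Q)%N) => gn.
      rewrite (bigD1_seq (n`_\pi(q))%N) ?divisors_uniq -?dvdn_divisors //= eqxx.
      by rewrite big1 ?addr0 // => d /negbTE ->.
    rewrite big1_seq // => d /andP[_]; rewrite -dvdn_divisors // => dQ.
    by case: eqP => // dn; rewrite -dn dQ in gn.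
  rewrite mulr_suml big_seq [RHS]big_seq; apply: eq_bigr => d.
  rewrite -dvdn_divisors // => dQ; rewrite (q_part_dvdP q0 n0 dQ).
  have d0 : (0 < d)%N by apply: dvdn_gt0 dQ.
  case: (boolP (d %| n)%N) => dn; last first.
    by rewrite mul0r big1 // => i _; rewrite mul0r mulr0.
  case: (boolP (coprime (n %/ d) q)) => cn; last first.
    rewrite mul0r big1 // => i _; rewrite mul1r /w.
    have [_ _ _ c0] := chiD i; have := c0 (n %/ d)%N; rewrite (negbTE cn).
    by move=> /negbT; rewrite negbK => /eqP ->; rewrite !mulr0.
  have m0 : (0 < n %/ d)%N by rewrite divn_gt0 // dvdn_leq.
  have cd : coprime d (n %/ d).
    rewrite coprime_sym; apply: (coprime_dvdr dQ); exact: coprimeXr.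
  rewrite mul1r /g -{1 2}(divnK dn) [(_ * d)%N]mulnC u_mult // (cP d _ cn).
  rewrite mulr_sumr; apply: eq_bigr => i _; rewrite /w mul1r; ring.
pose r := [seq (d, i) | d <- divisors Q, i <- enum 'I_q].
pose a (j : nat * 'I_q) := u j.1 * c j.1 j.2.
have rQ j : j \in r -> (j.1 %| Q)%N.
  by case/allpairsP => -[d i] /= [dQ _ ->]; rewrite dvdn_divisors.
have mainE' n : (0 < n)%N -> main n =
    \sum_(j <- r) a j * ((j.1 %| n)%N%:R * w j.2 (n %/ j.1)%N).
  move=> n0; rewrite mainE // big_allpairs; apply: eq_bigr => d _.
  by rewrite big_enum.
pose sA : R := \sum_(j <- r) nrm (a j) ^+ 2.
have sA0 : 0 <= sA by apply: sumr_ge0 => j _; exact: sqr_ge0.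
pose del : R := e / (4 * (sA * (size r)%:R + 1)).
have den0 : 0 < 4 * (sA * (size r)%:R + 1).
  by rewrite mulr_gt0 // ltr_wpDl // mulr_ge0.
have del0 : 0 < del by rewrite divr_gt0.
have H0P (j : nat * 'I_q) : exists H0, (0 < j.1)%N -> forall H, (H0 <= H)%N ->
    rmean U (fun l => M l %/ j.1)%N (fun n => nrm (short_mean (w j.2) H n) ^+ 2) <= del.
  have [d0|d0] := posnP j.1; first by exists 0%N.
  by have [H0 HP] := short (chiD j.2) d0 del0; exists H0.
have [H0 HP] := choice H0P.
pose K := (\sum_(j <- r) H0 j).+1.
pose H := (Q * K)%N.
have H0' : (0 < H)%N by rewrite muln_gt0 Q0.
exists H => //.
have HR : 0 < H%:R :> R by rewrite ltr0n.
have sparse j : j \in r -> rmean U M (fun n => nrm (sparse_mean (w j.2) j.1 H n) ^+ 2) <= del.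
  move=> jr; have jQ := rQ _ jr; have d0 : (0 < j.1)%N by apply: dvdn_gt0 jQ.
  have -> : H = (j.1 * ((Q %/ j.1) * K))%N by rewrite mulnA [(j.1 * _)%N]mulnC divnK.
  have Qj : (0 < Q %/ j.1)%N by rewrite divn_gt0 // dvdn_leq.
  apply: le_trans (rmean_sparse _ _ (w1 j.2)) _ => //; first by rewrite muln_gt0 Qj.
  apply: HP => //; apply: (@leq_trans K).
    by rewrite /K (big_rem j) //= ltnW // ltnS leq_addr.
  by rewrite leq_pmull.
have bsparse (j : nat * 'I_q) : bounded_cseq (sparse_mean (w j.2) j.1 H).
  apply: bounded_cseqM; first exact: bounded_cseq_cst.
  apply: bounded_cseq_sum => h; apply: bounded_cseqM.
    exact: (bounded_cseq_nat (fun n => j.1 %| n + h)%N).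
  by exists 1 => n.
pose RB n : R := H%:R^-1 * \sum_(h < H) B (n + h)%N.
have bB : bounded_seq B by apply: bounded_seq_sum => p; exact: bounded_ind.
have bBh h : bounded_seq (fun n => B (n + h)%N) by case: bB => C CP; exists C.
have bRB : bounded_seq RB by apply: bounded_seqZ; exact: bounded_seq_sum.
have bSP : bounded_seq (fun n => \sum_(j <- r) nrm (sparse_mean (w j.2) j.1 H n) ^+ 2).
  by apply: bounded_seq_sum => j; apply: bounded_nrm2.
have pointwise n : (0 < n)%N -> nrm (twisted_average u z H n) ^+ 2 <=
    (2 * sA) * \sum_(j <- r) nrm (sparse_mean (w j.2) j.1 H n) ^+ 2 + 2 * RB n.
  move=> n0.
  have E1 : nrm (twisted_average u z H n) = nrm (z ^+ n * twisted_average u z H n).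
    by rewrite nrmM nrmX z1 expr1n mul1r.
  have E2 : z ^+ n * twisted_average u z H n =
      \sum_(j <- r) a j * sparse_mean (w j.2) j.1 H n +
      H%:R^-1 * \sum_(h < H) rest (n + h)%N.
    have -> : \sum_(j <- r) a j * sparse_mean (w j.2) j.1 H n =
        H%:R^-1 * \sum_(h < H) main (n + h)%N.
      under [in RHS]eq_bigr do rewrite mainE' ?addn_gt0 ?n0 //.
      rewrite exchange_big mulr_sumr; apply: eq_bigr => j _.
      by rewrite /sparse_mean mulrCA mulr_sumr.
    rewrite -mulrDr -big_split /= /twisted_average mulrCA; congr (_ * _).
    rewrite mulr_sumr; apply: eq_bigr => h _; rewrite -gE /g exprD; ring.
  rewrite E1 E2; set X := \sum_(j <- r) _; set Y := _ * \sum_(h < H) _.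
  apply: (@le_trans _ _ ((nrm X + nrm Y) ^+ 2)).
    by rewrite ler_pXn2r ?nnegrE ?addr_ge0 ?nrm_ge0 // nrmD.
  apply: le_trans (sqrD_le _ _) _; apply: lerD.
    rewrite -mulrA ler_pM2l //.
    apply: le_trans (cauchy_schwarz r (fun j => nrm (a j))
      (fun j => nrm (sparse_mean (w j.2) j.1 H n))).
    rewrite ler_pXn2r ?nnegrE ?nrm_ge0 //; last first.
      by apply: sumr_ge0 => j _; rewrite mulr_ge0 ?nrm_ge0.
    apply: le_trans (nrm_sum _ _ _) _; apply: ler_sum => j _.
    by rewrite nrmM.
  rewrite ler_pM2l // /Y nrmM nrmV nrm_nat exprMn /RB.
  rewrite [_^-1 ^+ 2]expr2 -mulrA ler_pM2l ?invr_gt0 // ler_pdivrMl //.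
  apply: (@le_trans _ _ ((\sum_(h < H) nrm (rest (n + h)%N)) ^+ 2)).
    rewrite ler_pXn2r ?nnegrE ?nrm_ge0 ?nrm_sum //.
    by apply: sumr_ge0 => h _; exact: nrm_ge0.
  apply: le_trans (sqr_sum_ord_le _) _; rewrite ler_pM2l //.
  by apply: ler_sum => h _; apply: restB; rewrite addn_gt0 n0.
rewrite /energy.
apply: (@le_trans _ _ (rmean U M (fun n =>
    (2 * sA) * \sum_(j <- r) nrm (sparse_mean (w j.2) j.1 H n) ^+ 2 + 2 * RB n))).
  apply: ler_rmean => //.
    by apply: bounded_nrm2; exact: bounded_twisted.
  by apply: bounded_seqD; exact: bounded_seqZ.
rewrite rmeanD; [|exact: bounded_seqZ|exact: bounded_seqZ].
rewrite (rmeanZ M (2 * sA) bSP) (rmeanZ M 2 bRB).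
rewrite rmean_sum; last by move=> j; exact: bounded_nrm2.
rewrite /RB rmeanZ; last exact: bounded_seq_sum.
rewrite [X in _ * (_ * X)]rmean_sum //.
have -> : \sum_(h < H) rmean U M (fun n => B (n + h)%N) = H%:R * rmean U M B.
  under eq_bigr do rewrite (rmean_shift _ dM bB).
  by rewrite sumr_const card_ord mulr_natl.
rewrite mulKf ?gt_eqF //.
have S1 : \sum_(j <- r) rmean U M (fun n => nrm (sparse_mean (w j.2) j.1 H n) ^+ 2) <=
    (size r)%:R * del.
  apply: (@le_trans _ _ (\sum_(j <- r) del)).
    by rewrite big_seq [leRHS]big_seq; apply: ler_sum => j; exact: sparse.
  by rewrite big_const_seq count_predT iter_addr addr0 mulr_natl.
have S2 : sA * ((size r)%:R * del) <= e / 4.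
  rewrite /del mulrA mulrA ler_pdivrMr //.
  have -> : e / 4 * (4 * (sA * (size r)%:R + 1)) = (sA * (size r)%:R) * e + e by field.
  by rewrite lerDl ltW.
have := ler_wpM2l sA0 S1; move=> S3.
by move: rmB; lra.
Qed.

End root_of_unity.

(** * The shift space as an image of the Cantor space *)

Section initial_and_product.

Lemma cvg_initial (Y : choiceType) (Z : topologicalType) (w : Y -> Z)
    (F : set_system Y) (y : Y) : Filter F ->
  w x @[x --> F] --> w y -> F --> (y : initial_topology w).
Proof.
move=> FF wF V [_ /= [[W oW <-]] /= Wy /filterS]; apply.
by apply: wF; exact: open_nbhs_nbhs.
Qed.

Lemma cvg_product (I : Type) (T : I -> topologicalType)
    (F : set_system (prod_topology T)) (t : prod_topology T) : Filter F ->
  (forall i, x i @[x --> F] --> t i) -> F --> t.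
Proof.
move=> FF Ft; apply/cvg_sup => i.
apply: (@cvg_initial _ _ (fun f : forall i, T i => f i)) => //; exact: Ft.
Qed.

Lemma continuous_to_product (X : topologicalType) (I : Type)
    (T : I -> topologicalType) (f : X -> prod_topology T) :
  (forall i, continuous (fun x => f x i)) -> continuous f.
Proof. by move=> cf x; apply: cvg_product => i; exact: cf. Qed.

Lemma continuous_coord (I : eqType) (T : I -> topologicalType) (i : I) :
  continuous (fun x : prod_topology T => x i).
Proof. exact: (@proj_continuous I T i). Qed.

Lemma compact_set_type (X : topologicalType) (A : set X) :
  compact A -> compact [set: set_type A].
Proof.
move=> cA.
have [[a Aa]|A0] := pselect (A !=set0); last first.
  have -> : [set: set_type A] = set0.
    by rewrite -subset0 => x _; apply: A0; exists (set_val x); exact: set_valP.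
  exact: compact0.
pose pt : set_type A := SigSub (mem_set Aa).
have ci : {within A, continuous (valL_ pt (fun x : set_type A => x))}.
  apply: (proj2 (@subspace_valL_continuousP' X A (set_type A) pt (fun x : set_type A => x))).
  by move=> x; exact: cvg_id.
have cI := continuous_compact ci cA.
suff -> : [set: set_type A] = valL_ pt (fun x : set_type A => x) @` A by [].
apply/esym; rewrite -subTset => x _; exists (set_val x); first exact: set_valP.
exact: (congr1 (@^~ x) (valLK pt (fun x : set_type A => x))).
Qed.

Lemma hausdorff_set_type (X : topologicalType) (A : set X) :
  hausdorff_space X -> hausdorff_space (set_type A).
Proof.
move=> hX x y cxy; apply: val_inj; apply: hX => U V xU yV.
have cv : continuous (set_val : set_type A -> X) by exact: initial_continuous.
by have [z [zU zV]] := cxy _ _ (cv x U xU) (cv y V yV); exists (set_val z).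
Qed.

End initial_and_product.

Section disc_surjection.
Variable R : realType.

Definition real_disc_set : set (R * R) := [set p | p.1 ^+ 2 + p.2 ^+ 2 <= 1].

(** A copy of the closed disc in R x R, whose metric has values in R, as the
    Alexandroff-Hausdorff theorem requires; the distance of C has values in C. *)
Definition real_disc : Type := set_type real_disc_set.

Lemma real_disc0 : (0, 0) \in real_disc_set.
Proof. by apply/mem_set; rewrite /real_disc_set /= expr0n addr0. Qed.

HB.instance Definition _ := PseudoMetric.copy real_disc (set_type real_disc_set).
HB.instance Definition _ := isPointed.Build real_disc (SigSub real_disc0).

Lemma compact_real_disc : compact [set: real_disc].
Proof.
apply: compact_set_type.
pose B : set (R * R) := `[-1, 1]%classic `*` `[-1, 1]%classic.
have cB : compact B by apply: compact_setX; exact: segment_compact.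
apply: (subclosed_compact _ cB).
- have -> : real_disc_set = (fun p : R * R => p.1 * p.1 + p.2 * p.2) @^-1` [set x | x <= 1].
    by [].
  apply: closed_comp; last exact: closed_le.
  move=> p _; have c1 : p0.1 @[p0 --> p] --> p.1 by exact: cvg_fst.
  have c2 : p0.2 @[p0 --> p] --> p.2 by exact: cvg_snd.
  by apply: cvgD; apply: cvgM.
- move=> [x y] /= h; have := sqr_ge0 x; have := sqr_ge0 y => y0 x0.
  have b (a : R) : a ^+ 2 <= 1 -> (a \in `[-1, 1]).
    by move=> a1; rewrite in_itv /=; apply/andP; split; nra.
  split; apply: b; move: h; rewrite /real_disc_set /=; lra.
Qed.

Lemma hausdorff_real_disc : hausdorff_space real_disc.
Proof.
apply: hausdorff_set_type; apply: (@norm_hausdorff R (R * R)%type).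
Qed.

Definition pair_to_complex (p : R * R) : R[i]^o := p.1 +i* p.2.

Lemma pair_to_complex_continuous : continuous pair_to_complex.
Proof.
move=> p; apply/cvgrPdist_lt => e e0.
have [eI eR] : Im e = 0 /\ 0 < Re e.
  by move: e0; rewrite ltcE /= => /andP[/eqP -> ->].
have eE : e = (Re e)%:C by rewrite [LHS]complexE eI mulr0 addr0.
have e2 : 0 < Re e / 2 by rewrite divr_gt0.
have c1 : p'.1 @[p' --> p] --> p.1 by exact: cvg_fst.
have c2 : p'.2 @[p' --> p] --> p.2 by exact: cvg_snd.
have /cvgrPdist_lt/(_ _ e2) d1 := c1.
have /cvgrPdist_lt/(_ _ e2) d2 := c2.
apply: filterS2 d1 d2 => p' d1 d2.
rewrite eE; suff : nrm (pair_to_complex p - pair_to_complex p') < Re e by rewrite -ltcR.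
apply: le_lt_trans (nrm_le_ReIm _) _; rewrite /= [ltRHS]splitr ltrD //.
Qed.

Lemma real_disc_bound (p : real_disc) : pair_to_complex (set_val p) \in @disc_set R.
Proof.
apply/mem_set; rewrite /disc_set /=; have := set_valP p.
rewrite /real_disc_set /= => p1.
rewrite -(@ler_pXn2r _ 2) ?nnegrE ?nrm_ge0 // nrm_sqrE expr1n.
exact: p1.
Qed.

Definition to_disc (p : real_disc) : disc R := SigSub (real_disc_bound p).

Lemma to_disc_continuous : continuous to_disc.
Proof.
apply: (@continuous_comp_initial _ _ _ (set_val : disc R -> R[i]^o)).
move=> p; apply: (@continuous_comp _ _ _ (set_val : real_disc -> (R * R)%type)).
  exact: initial_continuous.
exact: pair_to_complex_continuous.
Qed.

Lemma to_disc_surj (x : disc R) : exists p, to_disc p = x.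
Proof.
have px : (Re (\val x), Im (\val x)) \in real_disc_set.
  apply/mem_set; rewrite /real_disc_set /= -nrm_sqrE.
  have : nrm (\val x) <= 1 := set_valP x.
  move=> x1; rewrite -(expr1n R 2) ler_pXn2r ?nnegrE ?nrm_ge0 //.
exists (SigSub px); apply: val_inj => /=.
by rewrite /pair_to_complex /=; case: (\val x).
Qed.

(** The disc is a compact metric space, hence an image of the Cantor space.  A
    sequence of bits contains one sequence for each coordinate k, made of the
    bits at the positions encoding (k, n). *)
Lemma cantor_onto_discZ : exists2 psi : cantor_space -> discZ R,
  continuous psi & forall x, exists y, psi y = x.
Proof.
have [g cg] := cantor_surj compact_real_disc hausdorff_real_disc.
pose slice (y : cantor_space) (k : int) : cantor_space :=
  fun n => y (pickle (k, n)).
have cslice k : continuous (fun y => slice y k).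
  apply: continuous_to_product => n.
  exact: (@continuous_coord _ (fun _ : nat => bool) (pickle (k, n))).
exists (fun y => (fun k => to_disc (g (slice y k))) : discZ R).
  apply: continuous_to_product => k y.
  apply: (@continuous_comp _ _ _ (fun y => g (slice y k)) to_disc).
    by apply: continuous_comp; [exact: cslice|exact: cg].
  exact: to_disc_continuous.
move=> x.
have /choice[t tP] k : exists t : cantor_space, to_disc (g t) = x k.
  have [p <-] := to_disc_surj (x k); have [t _ <-] := @surj _ _ _ _ g p I.
  by exists t.
pose y : cantor_space := fun m => if unpickle m is Some (k, n) then t k n else false.
exists y; apply: functional_extensionality_dep => k.
have -> : slice y k = t k; last exact: tP.
by apply: functional_extensionality_dep => n; rewrite /slice /y pickleK.
Qed.

End disc_surjection.

(** * Coding the masses of cylinders by intervals *)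

Section words.

(** The last bit comes first, so that lengthening a prefix is a cons. *)
Fixpoint prefix_word (y : cantor_space) n : seq bool :=
  if n is m.+1 then y m :: prefix_word y m else [::].

Lemma size_prefix_word y n : size (prefix_word y n) = n.
Proof. by elim: n => //= n ->. Qed.

Lemma prefix_word_eq (y y' : cantor_space) n :
  prefix_word y n = prefix_word y' n <-> (forall i, (i < n)%N -> y i = y' i).
Proof.
elim: n => [|n ih] //=; split => [[yy /ih e] i|e].
  by rewrite ltnS leq_eqVlt => /orP[/eqP ->|/e].
congr (_ :: _); first exact: e.
by apply/ih => i ilt; apply: e; exact: ltnW.
Qed.

Lemma open_prefix (W : set cantor_space) y : open W -> W y ->
  exists n, forall y', prefix_word y' n = prefix_word y n -> W y'.
Proof.
move=> oW Wy; apply: contrapT => nex.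
have bad n : exists y', prefix_word y' n = prefix_word y n /\ ~ W y'.
  apply: contrapT => nb; apply: nex; exists n => y' e.
  by apply: contrapT => nW; apply: nb; exists y'.
have [y' yP] := choice bad.
have cy : (y' n : cantor_space) @[n --> \oo] --> (y : cantor_space).
  apply: cvg_product => i; apply: cvg_near_cst.
  by exists i.+1 => // n /= ni; have [/prefix_word_eq e _] := yP n; exact: e.
have : \forall n \near \oo, W (y' n) by apply: cy; exact: open_nbhs_nbhs.
by case=> n _ /(_ n (leqnn n)); case: (yP n).
Qed.

(** Uniform continuity on a compact space: otherwise pairs with equal prefixes
    of growing length and distant values would converge, along an ultrafilter,
    to one and the same point. *)
Lemma uniform_prefix (R : realType) (g : cantor_space -> R) e :
  continuous g -> 0 < e ->
  exists n, forall y y', prefix_word y n = prefix_word y' n -> `|g y - g y'| <= e.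
Proof.
move=> cg e0; apply: contrapT => nex.
have bad n : exists q : cantor_space * cantor_space,
    prefix_word q.1 n = prefix_word q.2 n /\ e < `|g q.1 - g q.2|.
  apply: contrapT => nb; apply: nex; exists n => y y' yy.
  by rewrite leNgt; apply/negP => lt; apply: nb; exists (y, y').
have [q qP] := choice bad.
have [V [VV sV]] := ultraFilterLemma eventually_filter.
have VP : ProperFilter V := @ultra_proper _ _ VV.
have qU : UltraFilter ((q n).1 @[n --> V]).
  split=> [|G GP sG]; first exact: fmap_proper_filter.
  rewrite eqEsubset; split=> // A GA.
  have [//|nA] := in_ultra_setVsetC ((fun n => (q n).1) @^-1` A) VV.
  have : G (~` A) by apply: sG.
  by move=> /(filterI GA) /filter_ex [x []].
have := cantor_space_compact; rewrite compact_ultra => /(_ _ qU (@filterT _ _ _)).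
case=> y [_ cq1]; have {}cq1 : (q n).1 @[n --> V] --> y by exact: cq1.
have cq2 : (q n).2 @[n --> V] --> (y : cantor_space).
  apply: cvg_product => i.
  have c1 : (q n).1 i @[n --> V] --> y i.
    exact: (@continuous_cvg nat cantor_space bool V _ (fun n => (q n).1)
      (fun y => y i) y (@continuous_coord _ (fun _ : nat => bool) i y) cq1).
  have nE : \forall n \near V, (q n).1 i = (q n).2 i.
    apply: sV; exists i.+1 => // n /= ni.
    by have [/prefix_word_eq ee _] := qP n; rewrite ee.
  exact: cvg_trans (near_eq_cvg nE) c1.
have cd : g (q n).1 - g (q n).2 @[n --> V] --> g y - g y.
  apply: cvgB.
    exact: (@continuous_cvg nat cantor_space R V _ (fun n => (q n).1) g y (cg y) cq1).
  exact: (@continuous_cvg nat cantor_space R V _ (fun n => (q n).2) g y (cg y) cq2).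
move: cd; rewrite subrr => /cvgrPdist_lt/(_ _ e0) /filter_ex [n].
by rewrite sub0r normrN; case: (qP n) => _ lt /(lt_trans lt); rewrite ltxx.
Qed.

End words.

Section coding.
Context {R : realType} (p : seq bool -> R).
Hypotheses (p0 : forall s, 0 <= p s) (p_nil : p [::] = 1).
Hypothesis p_split : forall s, p s = p (false :: s) + p (true :: s).

(** In lexicographic order, the words of a given length cut the interval from
    0 to 1 into intervals of lengths [p s]; this is the left end of the one
    belonging to s. *)
Fixpoint cell_start (s : seq bool) : R :=
  if s is b :: s' then cell_start s' + (if b then p (false :: s') else 0) else 0.

Fixpoint greedy_word (t : R) n : seq bool :=
  if n is m.+1 then (cell_start (greedy_word t m) + p (false :: greedy_word t m) <= t) :: greedy_word t m
  else [::].

(** An expansion of t adapted to p: the first n bits name the interval of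
    level n that contains t.  Under Lebesgue measure the code has the masses p
    on cylinders. *)
Definition greedy_code (t : R) : cantor_space :=
  fun n => cell_start (greedy_word t n) + p (false :: greedy_word t n) <= t.

Lemma prefix_greedy_code t n : prefix_word (greedy_code t) n = greedy_word t n.
Proof. by elim: n => //= n ->. Qed.

Lemma greedy_word_cell t n : 0 <= t < 1 ->
  cell_start (greedy_word t n) <= t < cell_start (greedy_word t n) + p (greedy_word t n).
Proof.
move=> t01; elim: n => [|n /andP[lo hi]] /=; first by rewrite p_nil add0r.
have := p_split (greedy_word t n).
by case: (lerP (cell_start (greedy_word t n) + p (false :: greedy_word t n)) t) => c ps /=;
  apply/andP; split; lra.
Qed.

Lemma greedy_word_of_cell t s : cell_start s <= t < cell_start s + p s -> greedy_word t (size s) = s.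
Proof.
elim: s => //= b s ih h.
have ps := p_split s; have pf := p0 (false :: s); have pt := p0 (true :: s).
have e : greedy_word t (size s) = s.
  by apply: ih; case: b h => /andP[] lo hi; apply/andP; split; lra.
rewrite e; congr (_ :: _).
by case: b h => /andP[lo hi]; [|apply/negbTE; rewrite -ltNge]; lra.
Qed.

Lemma measurable_greedy_word n s : measurable [set t : R | greedy_word t n = s].
Proof.
elim: n s => [|n ih] s /=.
  case: s => [|b s].
    by rewrite (_ : [set _ | _] = setT) //; apply/seteqP; split.
  by rewrite (_ : [set _ | _] = set0) //; apply/seteqP; split.
case: s => [|b s]; first by rewrite (_ : [set _ | _] = set0) //; apply/seteqP; split.
have -> : [set t | (cell_start (greedy_word t n) + p (false :: greedy_word t n) <= t) :: greedy_word t n = b :: s] =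
    [set t | greedy_word t n = s] `&`
    (if b then [set` `[cell_start s + p (false :: s), +oo[] else
      [set` `]-oo, cell_start s + p (false :: s)[]).
  apply/seteqP; split=> t /=.
    case=> bE e; split=> //; move: bE; rewrite e.
    by case: b => /= h; rewrite in_itv /= ?andbT // ltNge h.
  case=> e h; rewrite e; congr (_ :: _); case: b h => /=.
    by rewrite in_itv /= andbT.
  by rewrite in_itv /= => h; apply/negbTE; rewrite -ltNge.
by apply: measurableI; [exact: ih|case: b; exact: measurable_itv].
Qed.

Let P := uniform_prob (@ltr01 R).

(** Up to the point t = 1, the numbers with word s fill the interval of s. *)
Lemma prob_greedy_word s : P [set t | greedy_word t (size s) = s] = (p s)%:E.
Proof.
rewrite /P /uniform_prob integral_uniform_pdf.
set A := [set t | _].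
have mA : measurable A by exact: measurable_greedy_word.
have mAI : measurable (A `&` `[0, 1]) by apply: measurableI.
rewrite (eq_integral (fun=> 1%:E)); last first.
  move=> x; rewrite inE /= => -[_]; rewrite in_itv /= /uniform_pdf => ->.
  by rewrite subr0 invr1.
rewrite integral_cst // mul1e.
have lo0 r : 0 <= cell_start r.
  by elim: r => //= b r ih; rewrite addr_ge0 //; case: b.
have hi1 r : cell_start r + p r <= 1.
  elim: r => [|b r ih] /=; first by rewrite p_nil add0r.
  have := p_split r; have := p0 (true :: r); case: b; lra.
pose I : set R := [set` `[cell_start s, cell_start s + p s[].
have mIm : measurable I by exact: measurable_itv.
have mI : lebesgue_measure I = (p s)%:E.
  rewrite /I lebesgue_measure_itv /= lte_fin; case: ifPn => [_|].
    by rewrite -EFinB; congr (_ %:E); ring.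
  by rewrite -leNgt gerDl => h; congr (_ %:E); apply/eqP; rewrite eq_le h p0.
apply/eqP; rewrite eq_le; apply/andP; split.
  apply: (@le_trans _ _ (lebesgue_measure (I `|` [set 1]))).
    apply: le_measure; rewrite ?inE //; first exact: measurableU.
    move=> t [wt]; rewrite /= in_itv /= => /andP[t0 t1].
    have [->|tn] := eqVneq t 1; [by right|left].
    have := @greedy_word_cell t (size s); rewrite wt => wi; rewrite /I /= in_itv /=; apply: wi.
    by rewrite t0 lt_neqAle tn.
  have U2 : (lebesgue_measure (I `|` [set (1%R : R)]) <=
      lebesgue_measure I +
      lebesgue_measure [set (1%R : R)])%E by exact: measureU2.
  by apply: (le_trans U2); rewrite lebesgue_measure_set1 adde0 mI.
rewrite -mI; apply: le_measure; rewrite ?inE //.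
move=> t; rewrite /I /= in_itv /= => h; split; first exact: greedy_word_of_cell.
have := lo0 s; have := hi1 s; rewrite /= in_itv /=; case/andP: h => a b c d.
by apply/andP; split; lra.
Qed.

End coding.

(** * The law of the coded point *)

Section coded_measure.
Context {R : realType} (p : seq bool -> R).
Hypotheses (p0 : forall s, 0 <= p s) (p_nil : p [::] = 1).
Hypothesis p_split : forall s, p s = p (false :: s) + p (true :: s).
Variable psi : cantor_space -> discZ R.
Hypothesis psi_cont : continuous psi.

Local Notation P := (uniform_prob (@ltr01 R)).

Definition coded (t : measurableTypeR R) : borel_discZ R := psi (greedy_code p t).

(** The preimage of an open set under psi is a countable union of cylinders. *)
Lemma measurable_coded : measurable_fun setT coded.
Proof.
apply: (@measurability _ _ _ (borel_discZ R) setT coded (@open (discZ R))) => //.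
move=> _ [V oV <-]; rewrite setTI.
have oW : open (psi @^-1` V) by apply: open_comp => // y _; exact: psi_cont.
have -> : coded @^-1` V = \bigcup_(s : seq bool)
    [set t | (forall y, prefix_word y (size s) = s -> V (psi y)) /\
             greedy_word p t (size s) = s].
  apply/seteqP; split=> [t Vt|t [s _ [sV ws]]] /=.
    have [n nP] := open_prefix oW Vt.
    exists (greedy_word p t n) => //=.
    have sn : size (greedy_word p t n) = n by rewrite -prefix_greedy_code size_prefix_word.
    by rewrite sn; split=> // y yn; apply: nP; rewrite prefix_greedy_code.
  by apply: sV; rewrite prefix_greedy_code.
apply: countable_bigcupT_measurable => [|s]; first exact: countableP.
have [sV|nV] := pselect (forall y, prefix_word y (size s) = s -> V (psi y)).
  rewrite (_ : [set _ | _] = [set t | greedy_word p t (size s) = s]).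
    exact: measurable_greedy_word.
  by apply/seteqP; split=> t /=; [case|].
by rewrite (_ : [set _ | _] = set0) //; apply/seteqP; split=> t //= -[].
Qed.

Let coded_mixin := isMeasurableFun.Build _ _ _ _ _ measurable_coded.
Let coded_pack : {mfun measurableTypeR R >-> borel_discZ R} :=
  MeasurableFun.Pack (MeasurableFun.Class coded_mixin).

Definition coded_law : probability (borel_discZ R) R := distribution P coded_pack.

Lemma measurable_continuous (f : discZ R -> R) : continuous f ->
  measurable_fun [set: borel_discZ R] (f : borel_discZ R -> R).
Proof.
move=> cf; apply: (measurability _ (RGenOInfty.measurableE R)) => //.
move=> _ [_ [a ->] <-]; rewrite setTI; apply: sub_sigma_algebra.
apply: open_comp => [y _|]; first exact: cf.
exact: rray_open.
Qed.

Definition extend_word (s : seq bool) : cantor_space := fun i => nth false (rev s) i.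

Lemma prefix_extend s : prefix_word (extend_word s) (size s) = s.
Proof.
elim: s => //= b s ih; congr (_ :: _).
  by rewrite /extend_word rev_cons nth_rcons size_rev ltnn eqxx.
rewrite -[RHS]ih; apply/prefix_word_eq => i ilt.
by rewrite /extend_word rev_cons nth_rcons size_rev ilt.
Qed.

Lemma integrable_bounded (g : measurableTypeR R -> R) C :
  measurable_fun setT g -> (forall t, `|g t| <= C) -> P.-integrable setT (EFin \o g).
Proof.
move=> mg gC; apply: measurable_bounded_integrable => //.
  by rewrite [X in (X < _)%E](@probability_setT _ _ R P) ltry.
exists C; split; first exact: num_real.
by move=> x Cx t _; apply: le_trans (gC t) (ltW Cx).
Qed.

Let cell s : set (measurableTypeR R) := [set t | greedy_word p t (size s) = s].

Let mcell s : measurable (cell s). Proof. exact: measurable_greedy_word. Qed.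

Lemma Rintegral_cells (F : seq bool -> R) (r : seq (seq bool)) :
  measurable_fun setT (fun t => \sum_(s <- r) F s * \1_(cell s) t) /\
  \int[P]_t (\sum_(s <- r) F s * \1_(cell s) t) = \sum_(s <- r) F s * p s.
Proof.
have bI (s : seq bool) : P.-integrable setT (EFin \o (fun t => F s * \1_(cell s) t)).
  apply: (@integrable_bounded _ `|F s|).
    by apply: measurable_funM => //; exact: measurable_indic.
  by move=> t; rewrite normrM ler_piMr // indicE normr_nat lern1; case: (_ \in _).
have b1 s : P.-integrable setT (EFin \o (\1_(cell s) : measurableTypeR R -> R)).
  apply: (@integrable_bounded _ 1); first exact: measurable_indic.
  by move=> t; rewrite indicE normr_nat lern1; case: (_ \in _).
elim: r => [|s r [mr ir]].
  under eq_fun do rewrite big_nil; split; first exact: measurable_cst.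
  by rewrite big_nil /Rintegral integral0.
under eq_fun do rewrite big_cons; rewrite big_cons; split.
  apply: measurable_funD => //; apply: measurable_funM => //.
rewrite RintegralD //; last first.
  apply: (@integrable_bounded _ (\sum_(s <- r) `|F s|)) => // t.
  apply: le_trans (ler_norm_sum _ _ _) _; apply: ler_sum => x _.
  by rewrite normrM ler_piMr // indicE normr_nat lern1; case: (_ \in _).
rewrite ir; congr (_ + _); rewrite RintegralZl //; congr (_ * _).
rewrite /Rintegral integral_indic // setIT.
exact: (congr1 fine (prob_greedy_word p0 p_nil p_split s)).
Qed.

(** Up to e, f composed with psi depends on the first n bits only, and the
    cylinder of s has mass p s. *)
Lemma coded_law_close (f : discZ R -> R) n e : continuous f ->
  (forall y y', prefix_word y n = prefix_word y' n -> `|f (psi y) - f (psi y')| <= e) ->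
  `|\int[coded_law]_y f y -
    \sum_(s : n.-tuple bool) f (psi (extend_word s)) * p s| <= e.
Proof.
move=> cf fe; pose F s := f (psi (extend_word s)).
pose r := [seq tval s | s <- enum {: n.-tuple bool}].
have [mh ih] := Rintegral_cells F r.
set h := fun t => \sum_(s <- r) _ in mh ih.
have hE t : h t = F (greedy_word p t n).
  have sn : size (greedy_word p t n) == n by rewrite -prefix_greedy_code size_prefix_word.
  rewrite /h big_map big_enum /= (bigD1 (Tuple sn)) //= big1 ?addr0 => [|s sw].
    by rewrite indicE mem_set ?mulr1 // /cell /= (eqP sn).
  rewrite indicE memNset ?mulr0 // /cell /= size_tuple => ws.
  by case/eqP: sw; apply: val_inj; rewrite /= ws.
have sE : \sum_(s : n.-tuple bool) F s * p s = \sum_(s <- r) F s * p s.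
  by rewrite /r big_map big_enum.
have close t : `|f (coded t) - h t| <= e.
  rewrite hE /F /coded; apply: fe.
  have sn : size (greedy_word p t n) = n by rewrite -prefix_greedy_code size_prefix_word.
  by rewrite prefix_greedy_code -{3}sn prefix_extend.
have mf : measurable_fun setT (f \o coded).
  apply: (@measurable_comp _ _ _ _ _ _ setT) => //.
    exact: measurable_continuous.
  exact: measurable_coded.
have hb t : `|h t| <= \sum_(s <- r) `|F s|.
  apply: le_trans (ler_norm_sum _ _ _) _; apply: ler_sum => x _.
  by rewrite normrM ler_piMr // indicE normr_nat lern1; case: (_ \in _).
have ifc : P.-integrable setT (EFin \o (f \o coded)).
  apply: (@integrable_bounded _ (\sum_(s <- r) `|F s| + e)) => // t.
  rewrite /= -(subrK (h t) (f (coded t))) addrC.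
  by apply: le_trans (ler_normD _ _) _; rewrite lerD.
have ihh : P.-integrable setT (EFin \o h) by exact: integrable_bounded mh hb.
have -> : \int[coded_law]_y f y = \int[P]_t (f \o coded) t.
  rewrite /Rintegral /coded_law (@integral_distribution _ _ _ _ _ _ coded_pack) //.
  by apply/measurable_EFinP; exact: measurable_continuous.
rewrite -[X in _ - X]/(\sum_(s : n.-tuple bool) F s * p s) sE -ih -RintegralB //.
apply: le_trans (le_normr_Rintegral _ _) _ => //.
  by apply: (@integrable_bounded _ e) => //; exact: measurable_funB.
have Ie : Rintegral P setT (fun=> e) = e.
  by have := @Rintegral_cst _ _ _ P setT measurableT e;
    rewrite [X in fine X](@probability_setT _ _ R P) mulr1.
rewrite -[leRHS]Ie; apply: le_Rintegral => //.
  apply: (@integrable_bounded _ e); last by move=> t; rewrite normr_id; exact: close.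
  by apply: measurableT_comp => //; exact: measurable_funB.
  by apply: (@integrable_bounded _ `|e|) => //; exact: measurable_cst.
by move=> t _; exact: close.
Qed.

End coded_measure.

(** * Generic subsequences *)

Section extraction.
Context {R : realType} (U : set_system nat) {UU : UltraFilter U}.
Let UP : ProperFilter U := ultra_proper.
#[local] Existing Instance UP.
Variable M : nat -> nat.
Hypothesis dM : diverges U M.

Lemma near_all_lt (Q : nat -> nat -> Prop) m :
  (forall k, \forall l \near U, Q k l) ->
  \forall l \near U, forall k, (k < m)%N -> Q k l.
Proof.
move=> nQ; elim: m => [|m ih]; first by apply: (@filterE _ _ UP).
apply: filterS2 ih (nQ m) => l lt lm k.
by rewrite ltnS leq_eqVlt => /orP[/eqP ->|/lt].
Qed.

(** For each i there are indices where the first i sequences are close to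
    their limits and M is as large as desired, since these conditions hold on
    sets of U; choose such indices one after the other. *)
Lemma diagonal_extraction (J : countType) (a : J -> nat -> R) :
  (forall j, bounded_seq (a j)) ->
  exists2 phi : nat -> nat, increasing_positive (M \o phi) &
    forall j, a j (phi i) @[i --> \oo] --> ulim U (a j).
Proof.
move=> ba.
have step i B : exists l, (B < M l)%N /\ forall k, (k < i.+1)%N ->
    forall j, unpickle k = Some j -> `|a j l - ulim U (a j)| < i.+1%:R^-1.
  have n1 : \forall l \near U, forall k, (k < i.+1)%N ->
      forall j, unpickle k = Some j -> `|a j l - ulim U (a j)| < i.+1%:R^-1.
    apply: near_all_lt => k; case: (unpickle k) => [j|]; last first.
      by apply: (@filterE _ _ UP).
    have i0 : 0 < i.+1%:R^-1 :> R by rewrite invr_gt0 ltr0n.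
    have cj : a j l @[l --> U] --> ulim U (a j) by exact: ulim_cvg.
    have /cvgrPdist_lt/(_ _ i0) := cj.
    by apply: filterS => l h _ [<-]; rewrite distrC.
  have [l [h1 h2]] := @filter_ex _ _ UP _ (filterI (dM B.+1) n1).
  by exists l.
(* L (i, B) is an index of precision i where M exceeds B. *)
have [L LP] := choice (fun iB : nat * nat => step iB.1 iB.2).
pose phi := fix phi i := if i is i'.+1 then L (i, M (phi i')) else L (0, 0)%N.
exists phi.
  split=> [l|]; first have posL iB : (0 < M (L iB))%N.
      by case: (LP iB) => h _; apply: leq_ltn_trans h.
    by case: l => [|l]; exact: posL.
  move=> i j; elim: j => // j ih; rewrite ltnS leq_eqVlt => /orP[/eqP ->|/ih].
    by rewrite /=; case: (LP (j.+1, M (phi j))).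
  by move=> lt; apply: ltn_trans lt _; rewrite /=; case: (LP (j.+1, M (phi j))).
move=> j; apply/cvgrPdist_lt => e e0.
pose N := (maxn (pickle j) (Num.trunc (1 / e)).+1).
exists N => // i /= Ni; rewrite distrC.
have pi : (pickle j < i.+1)%N by rewrite ltnS; apply: leq_trans Ni; rewrite leq_maxl.
have e1 : i.+1%:R^-1 < e.
  rewrite -[ltRHS]invrK ltf_pV2 ?posrE ?invr_gt0 ?ltr0n // -div1r.
  apply: lt_le_trans (truncnS_gt _) _; rewrite ler_nat.
  by apply: leq_trans (leq_maxr _ _) _; apply: leq_trans Ni _.
apply: lt_trans e1.
case: i Ni pi => [|i] Ni pi.
  by have [_ h] := LP (0, 0)%N; exact: h (pickle j) pi j (pickleK j).
by have [_ h] := LP (i.+1, M (phi i)); exact: h (pickle j) pi j (pickleK j).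
Qed.

Variable w : nat -> R[i].
Hypothesis w1 : bounded_by_one w.

Lemma disc_point_in n : (if n == 0%N then 0 else w n : R[i]^o) \in @disc_set R.
Proof.
apply/mem_set; rewrite /disc_set /=; case: eqP => [_|/eqP n0]; first by rewrite nrm0.
by apply: w1; rewrite lt0n.
Qed.

(** Any point of the disc may stand at 0. *)
Definition extension : discZ R := fun z : int => SigSub (disc_point_in `|z|%N).

Lemma extension_extends : extends w extension.
Proof.
by move=> n n0; rewrite /= abszN absz_nat; case: eqP => // e; rewrite e in n0.
Qed.

(** Every point of the orbit of the extended sequence is the image under psi of
    a point of the Cantor space.  Let p s be the mean frequency of the prefix s
    among these codes.  Diagonal extraction realises all the p s, and the
    prescribed limits, as limits along one subsequence.  A continuous function
    of the orbit depends, up to e, on finitely many bits of the codes, so its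
    averages converge to its integral against [coded_law]. *)
Lemma generic_subsequence (b : nat -> nat -> R) : (forall h, bounded_seq (b h)) ->
  exists phi : nat -> nat, [/\ increasing_positive (M \o phi),
    generic_along w (M \o phi) &
    forall h, b h (phi i) @[i --> \oo] --> ulim U (b h)].
Proof.
move=> bb; have [psi cpsi spsi] := cantor_onto_discZ R.
have [c cP] := choice (fun n => spsi (iter n (@left_shift R) extension)).
pose ind s n : R := (prefix_word (c n) (size s) == s)%:R.
have bind s : bounded_seq (ind s).
  by exists 1 => n; rewrite normr_nat lern1; case: (_ == _).
pose a (j : seq bool + nat) : nat -> R := fun l =>
  match j with inl s => avg (M l) (ind s) | inr h => b h l end.
have ba j : bounded_seq (a j).
  by case: j => [s|h] /=; [exact: bounded_avg|exact: bb].
have [phi iphi aphi] := diagonal_extraction ba.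
exists phi; split => //; last by move=> h; exact: (aphi (inr h)).
pose p s := rmean U M (ind s).
have p0 s : 0 <= p s by apply: rmean_ge0 => // n _; exact: ler0n.
have pn : p [::] = 1 by rewrite /p -[RHS](rmean_cst 1 dM); apply: eq_rmean.
have ps s : p s = p (false :: s) + p (true :: s).
  rewrite /p -rmeanD //; apply: eq_rmean => n _; rewrite /ind /= !eqseq_cons.
  by case: (c n (size s)); case: (_ == s); rewrite /= ?addr0 ?add0r.
exists extension; first exact: extension_extends.
exists (coded_law p cpsi) => f cf.
apply/cvgrPdist_le => e e0.
have e3 : 0 < e / 3 by rewrite divr_gt0.
have cg : continuous (f \o psi).
  by move=> y; apply: continuous_comp; [exact: cpsi|exact: cf].
have [n nP] := uniform_prefix cg e3.
pose F s : R := f (psi (extend_word s)).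
pose I : R := \sum_(s : n.-tuple bool) F s * p s.
have close1 : `|\int[coded_law p cpsi]_y f y - I| <= e / 3.
  by apply: (coded_law_close p0 pn ps cpsi) => //.
have close2 l : `|avg (M l) (fun k => f (iter k (@left_shift R) extension)) -
    \sum_(s : n.-tuple bool) F s * a (inl (tval s)) l| <= e / 3.
  have -> : \sum_(s : n.-tuple bool) F s * a (inl (tval s)) l =
      avg (M l) (fun k => F (prefix_word (c k) n)).
    rewrite /a /avg; under eq_bigr do rewrite mulrCA.
    rewrite -mulr_sumr; congr (_ * _); under eq_bigr do rewrite mulr_sumr.
    rewrite exchange_big; apply: eq_bigr => k _ /=.
    have sk : size (prefix_word (c k) n) == n by rewrite size_prefix_word.
    rewrite (bigD1 (Tuple sk)) //= big1 ?addr0 => [|s sn].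
      by rewrite /ind /= (eqP sk) eqxx mulr1.
    rewrite /ind size_tuple; case: eqP => [ee|_]; last by rewrite mulr0.
    by case/eqP: sn; apply: val_inj; rewrite /= ee.
  rewrite -avgB; apply: norm_avg_le => k _; rewrite /F -cP; apply: nP.
  by have := prefix_extend (prefix_word (c k) n); rewrite size_prefix_word => ->.
have cI : \sum_(s <- index_enum {: n.-tuple bool}) F s * a (inl (tval s)) (phi i)
    @[i --> \oo] --> I.
  apply: cvg_finsum => s; apply: cvgMl_tmp; exact: (aphi (inl (tval s))).
have /cvgrPdist_le/(_ _ e3) := cI; apply: filterS => i close3.
rewrite /= -/(avg (M (phi i)) (fun k => f (iter k (@left_shift R) extension))).
have := close2 (phi i); move: close1 close3.
set x := \int[_]_y _; set y := avg _ _; set t := \sum_(s | _) _.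
move=> h1 h2 h3; rewrite (_ : x - y = (x - I) + ((I - t) - (y - t))); last by ring.
apply: le_trans (ler_normD _ _) _; apply: (@le_trans _ _ (e / 3 + (e / 3 + e / 3))).
  by apply: lerD => //; apply: le_trans (ler_normB _ _) (lerD _ _).
by lra.
Qed.

(** A subsequence that is generic and realises the limits along U for all H
    simultaneously makes the bound provided by the hypothesis a bound on the
    means along U. *)
Lemma short_rmean e : short_interval_behaviour w -> 0 < e ->
  exists H0, forall H, (H0 <= H)%N ->
  rmean U M (fun n => nrm (short_mean w H n) ^+ 2) <= e.
Proof.
move=> sib e0.
have bs H : bounded_seq (fun n => nrm (short_mean w H n) ^+ 2).
  apply: bounded_nrm2; exists 1 => n; rewrite /short_mean nrmM nrmV nrm_nat.
  have [->|Hp] := posnP H; first by rewrite invr0 mul0r.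
  rewrite mulrC ler_pdivrMr ?ltr0n // mul1r; apply: le_trans (nrm_sum _ _ _) _.
  apply: (@le_trans _ _ (\sum_(1 <= h < H.+1) 1)); last by rewrite sumr_const_nat subn1.
  apply: ler_sum_nat => h /andP[h0 _]; apply: w1; by rewrite addn_gt0 h0 orbT.
have [phi [iphi gphi bphi]] := generic_subsequence (fun H => bounded_avg M (bs H)).
have [H0 _ HP] := sib e e0 _ iphi gphi.
exists H0 => H HH; have [_ le] := HP H HH.
apply: le_trans le; rewrite le_eqVlt; apply/orP; left; apply/eqP.
by apply/esym/cvg_lim => //; exact: bphi.
Qed.

End extraction.

(** * Tuples of shifts and the averaged Chowla property *)

Lemma ler_sum_inj (R : realDomainType) (I J : finType) (f : I -> J) (G : J -> R) :
  injective f -> (forall j, 0 <= G j) -> \sum_i G (f i) <= \sum_j G j.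
Proof.
move=> fi G0.
have -> : \sum_i G (f i) = \sum_(j <- [seq f i | i <- enum I]) G j.
  by rewrite big_map big_enum.
rewrite big_uniq; last by rewrite map_inj_uniq ?enum_uniq.
by rewrite big_mkcond /=; apply: ler_sum => j _; case: ifP.
Qed.

Section tuples_of_shifts.
Context {R : realType} (U : set_system nat) {UU : UltraFilter U}.
Variables (M : nat -> nat) (u : nat -> R[i]).
Hypotheses (dM : diverges U M) (u1 : forall n, nrm (u n) <= 1).
Variables (k : nat) (v : 'I_k -> nat -> R[i]).
Hypothesis v1 : forall i n, nrm (v i n) <= 1.

Definition joint_mean (g : 'I_k -> nat) : R :=
  nrm (cmean U M (fun n => u n * \prod_(i < k) v i (n + g i)%N)).

(** For each t < H, the tuple h is the sum of t and of a tuple y of integers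
    between - H and H, stored as y + H.  For fixed y the product of the v i is a
    single bounded function shifted by t, and the hypothesis bounds the sum
    over t.  There are (2 H)^k tuples y, and each h is counted H times. *)
Lemma joint_mean_sum_le H e : (0 < H)%N -> 
  (forall w, (forall n, nrm (w n) <= 1) ->
    \sum_(h < H) nrm (cmean U M (fun n => u n * w (n + h)%N)) <= e * H%:R) ->
  \sum_(h : {ffun 'I_k -> 'I_H}) joint_mean (fun i => (h i).+1) <=
  (2 * H)%:R ^+ k * e.
Proof.
move=> H0 hyp; have HR : 0 < H%:R :> R by rewrite ltr0n.
pose w (y : {ffun 'I_k -> 'I_(2 * H)}) m := \prod_(i < k) v i (m.+1 + y i - H)%N.
pose G (t : 'I_H) y := nrm (cmean U M (fun n => u n * w y (n + t)%N)).
have nrm_prod (F : 'I_k -> R[i]) : (forall i, nrm (F i) <= 1) -> nrm (\prod_i F i) <= 1.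
  move=> F1; apply: (big_ind (fun z => nrm z <= 1)) => //; first by rewrite nrm1.
  by move=> x y x1 y1; rewrite nrmM -[leRHS]mul1r ler_pM ?nrm_ge0.
have shift_lt (t : 'I_H) (a : 'I_H) : (a + (H - t) < 2 * H)%N.
  by case: t => t tH; case: a => a aH /=; lia.
pose f (t : 'I_H) (h : {ffun 'I_k -> 'I_H}) : {ffun 'I_k -> 'I_(2 * H)} :=
  [ffun i => Ordinal (shift_lt t (h i))].
have finj t : injective (f t).
  move=> h h' /ffunP e'; apply/ffunP => i; have := e' i; rewrite !ffunE.
  by move=> [] /eqP; rewrite eqn_add2r => /eqP /val_inj.
have fE t (h : {ffun 'I_k -> 'I_H}) : joint_mean (fun i => (h i).+1) = G t (f t h).
  rewrite /joint_mean /G; congr nrm; apply: eq_cmean => n _; congr (_ * _).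
  apply: eq_bigr => i _; congr (v i _); rewrite ffunE /=.
  by case: t => t tH /=; lia.
have G0 t y : 0 <= G t y by exact: nrm_ge0.
rewrite -(ler_pM2l HR).
have -> : H%:R * \sum_(h : {ffun 'I_k -> 'I_H}) joint_mean (fun i => (h i).+1) =
    \sum_(t < H) \sum_(h : {ffun 'I_k -> 'I_H}) G t (f t h).
  under [RHS]eq_bigr => t _ do under eq_bigr => h _ do rewrite -fE.
  by rewrite sumr_const card_ord mulr_natl.
apply: (@le_trans _ _ (\sum_(t < H) \sum_y G t y)).
  by apply: ler_sum => t _; exact: ler_sum_inj.
rewrite exchange_big; apply: (@le_trans _ _ (\sum_(y : {ffun 'I_k -> 'I_(2 * H)}) e * H%:R)).
  by apply: ler_sum => y _; apply: hyp => n; exact: nrm_prod.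
rewrite sumr_const card_ffun !card_ord -(mulr_natl (e * H%:R)) natrX le_eqVlt.
by apply/orP; left; apply/eqP; ring.
Qed.

End tuples_of_shifts.

Theorem corollary1p17 (R : realType) (u : nat -> R[i])
    (u_mult : multiplicative_arith u) (u_bounded : bounded_by_one u)
    (u_short : forall (q : nat) (chi : nat -> R[i]),
       dirichlet_character q chi ->
       short_interval_behaviour (fun n => u n * chi n))
    (N : nat -> nat) (N_incr : increasing_positive N)
    (u_generic : generic_along u N) :
  averaged_chowla_along u N.
Proof.
move=> k v k0 v_bounded phi phi_incr cv.
have [U [UU sU]] := ultraFilterLemma eventually_filter.
have UP : ProperFilter U := @ultra_proper _ _ UU.
pose M l := N (phi l).
have [_ Ninc] := N_incr.
have Mge l : (l <= M l)%N.
  elim: l => // l ih; apply: (leq_ltn_trans ih); apply: Ninc; exact: phi_incr.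
have dM : diverges U M.
  by move=> A; apply: sU; exists A => // l /= Al; apply: leq_trans (Mge l).
(* Values at 0 are unconstrained; setting them to 0 changes no sum and makes the
   bounds hold on all of nat. *)
pose zero_fix (x : nat -> R[i]) n : R[i] := if n == 0%N then 0 else x n.
have zfE x n : (0 < n)%N -> zero_fix x n = x n by rewrite /zero_fix; case: n.
have zf1 x : bounded_by_one x -> forall n, nrm (zero_fix x n) <= 1.
  move=> x1 [|n]; first by rewrite /zero_fix eqxx nrm0.
  by rewrite zfE //; exact: x1.
pose u' := zero_fix u.
have u1 : forall n, nrm (u' n) <= 1 by exact: zf1.
have u'_mult : multiplicative_arith u'.
  by move=> m n m0 n0 mn; rewrite /u' !zfE ?muln_gt0 ?m0 // u_mult.
have vanish z : nrm z = 1 -> forall e, 0 < e ->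
    exists2 H, (0 < H)%N & energy U M u' z H <= e.
  move=> z1 e e0.
  have [[q q0 zq]|nroot] := pselect (exists2 q, (0 < q)%N & z ^+ q = 1).
    apply: (energy_vanish_root dM u1 u'_mult q0 zq) => // chi chiD d d0 e' e'0.
    have w1 : bounded_by_one (fun n => u n * chi n).
      move=> n n0; rewrite nrmM -[leRHS]mul1r ler_pM ?nrm_ge0 //; first exact: u_bounded.
      exact: nrm_dirichlet chiD.
    have [H0 HP] := short_rmean (diverges_div d0 dM) w1 (u_short q chi chiD) e'0.
    exists H0 => H HH; apply: le_trans (HP H HH); rewrite le_eqVlt; apply/orP; left.
    apply/eqP/eq_rmean => n _; congr (nrm _ ^+ 2); congr (_ * _).
    by apply: eq_big_nat => h /andP[h0 _]; rewrite /u' zfE // addn_gt0 h0 orbT.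
  apply: energy_vanish_free => // q q0; apply/negP => /eqP zq.
  by apply: nroot; exists q.
pose v' i := zero_fix (v i).
have v'1 i n : nrm (v' i n) <= 1 by exact: zf1.
have limE (g : 'I_k -> nat) : (forall i, (0 < g i)%N) ->
    limn (fun l => correlation u v g (N (phi l))) = joint_mean U M u' v' g.
  move=> g0; have bf : bounded_cseq (fun n => u' n * \prod_(i < k) v' i (n + g i)%N).
    exists 1 => n; rewrite nrmM -[leRHS]mul1r ler_pM ?nrm_ge0 //.
    apply: (big_ind (fun z => nrm z <= 1)) => //; first by rewrite nrm1.
    by move=> x y x1 y1; rewrite nrmM -[leRHS]mul1r ler_pM ?nrm_ge0.
  have corrE l : correlation u v g (N (phi l)) =
      nrm (avg (M l) (fun n => u' n * \prod_(i < k) v' i (n + g i)%N)).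
    rewrite /correlation /avg nrmM nrmV nrm_nat; congr (_ * nrm _).
    apply: eq_big_nat => n /andP[n0 _]; rewrite /u' zfE //; congr (_ * _).
    by apply: eq_bigr => i _; rewrite /v' zfE // addn_gt0 n0.
  rewrite /joint_mean nrm_cmeanE //; apply/esym/ulimE.
  under eq_cvg do rewrite -corrE.
  by apply: cvg_trans (cv g g0); exact: cvg_app.
apply/cvgrPdist_le => e e0.
have e2 : 0 < e / 2 ^+ k by rewrite divr_gt0 // exprn_gt0.
have [H1 H10 HP] := correlation_average_small dM u1 vanish e2.
exists H1 => // H /= HH; have H0 : (0 < H)%N by apply: leq_trans HH.
have HR : 0 < H%:R ^+ k :> R by rewrite exprn_gt0 // ltr0n.
under eq_bigr => h _ do rewrite limE //.
have S0 : 0 <= \sum_(h : {ffun 'I_k -> 'I_H}) joint_mean U M u' v' (fun i => (h i).+1).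
  by apply: sumr_ge0 => h _; exact: nrm_ge0.
rewrite sub0r normrN ger0_norm; last by rewrite mulr_ge0 // invr_ge0 ltW.
rewrite ler_pdivrMl //.
have le : \sum_(h : {ffun 'I_k -> 'I_H}) joint_mean U M u' v' (fun i => (h i).+1) <=
    (2 * H)%:R ^+ k * (e / 2 ^+ k).
  by apply: joint_mean_sum_le => // w w1; exact: HP.
apply: le_trans le _; rewrite le_eqVlt; apply/orP; left; apply/eqP.
by rewrite natrM exprMn; field; rewrite gt_eqF // exprn_gt0.
Qed.
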